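(* Let $\Omega,\Omega'\subseteq\mathbb{R}^n$ be open and let $\mu\colon\Omega\to\Omega'$ be a diffeomorphism. Then $\mu^*(\hat{\mathcal E}_m(\Omega'))\subseteq\hat{\mathcal E}_m(\Omega)$ and $\mu^*(\hat{\mathcal N}(\Omega'))\subseteq\hat{\mathcal N}(\Omega)$; thus the pullback $\mu^*\colon\hat{\mathcal G}(\Omega')\to\hat{\mathcal G}(\Omega)$ is well-defined by its action on representatives.
   Context: Notation. $I=(0,1]$. $\mathcal D(\Omega)$ is the space of test functions on an open set $\Omega\subseteq\mathbb{R}^n$. $A\subset\subset B$ means that $A$ is compact and contained in the interior of $B$. $B_r(x)$ is the open Euclidean ball. Smoothness of maps on or into locally convex spaces is in the sense of convenient calculus (Kriegl–Michor). $f(\varepsilon)=O(g(\varepsilon))$ means: there are $\varepsilon_0>0$, $C>0$ with $|f(\varepsilon)|\le Cg(\varepsilon)$ for all $\varepsilon\le\varepsilon_0$. $\partial_{x+y}^\alpha=(\partial_x+\partial_y)^\alpha$ (expanded by the binomial theorem). Smoothing kernels. $\widetilde{\mathcal A}_q(\Omega)$ ($q\in\mathbb{N}_0$) is the set of all $\tilde\phi\in C^\infty(I\times\Omega,\mathcal D(\Omega))$, $(\varepsilon,x)\mapsto[y\mapsto\tilde\phi_{\varepsilon,x}(y)]$, such that (LSK1) $\forall K\subset\subset\Omega$ $\exists\varepsilon_0,C>0$ $\forall x\in K$ $\forall\varepsilon<\varepsilon_0$: $\operatorname{supp}\tilde\phi_{\varepsilon,x}\subseteq B_{C\varepsilon}(x)$;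 (LSK2) $\forall K\subset\subset\Omega$ $\forall\alpha,\beta\in\mathbb{N}_0^n$: $(\partial_{x+y}^\alpha\partial_y^\beta\tilde\phi)_{\varepsilon,x}(y)=O(\varepsilon^{-n-|\beta|})$ uniformly for $x\in K$, $y\in\Omega$; (LSK3) $\forall K\subset\subset\Omega$ $\forall\alpha\in\mathbb{N}_0^n$ $\forall f\in C^\infty(\Omega)$: $\int_\Omega f(y)(\partial_x^\alpha\tilde\phi)_{\varepsilon,x}(y)\,dy=(\partial^\alpha f)(x)+O(\varepsilon^{q+1})$ uniformly for $x\in K$. Basic space: $\hat{\mathcal E}(\Omega)=C^\infty(\mathcal D(\Omega)\times\Omega)$, the smooth (scalar-valued) functions $R\colon(\varphi,x)\mapsto R(\varphi,x)$, an algebra under pointwise operations. Moderateness: $\hat{\mathcal E}_m(\Omega)$ is the set of $R\in\hat{\mathcal E}(\Omega)$ such that $\forall K\subset\subset\Omega$ $\forall\alpha\in\mathbb{N}_0^n$ $\exists q\in\mathbb{N}_0$ $\exists N\in\mathbb{N}$ $\forall\tilde\phi\in\widetilde{\mathcal A}_q(\Omega)$: $\sup_{x\in K}|\partial_x^\alpha(R(\tilde\phi_{\varepsilon,x},x))|=O(\varepsilon^{-N})$. Negligibility: $\hat{\mathcal N}(\Omega)$ is the set of $R\in\hat{\mathcal E}(\Omega)$ such that $\forall K\subset\subset\Omega$ $\forall\alpha\in\mathbb{N}_0^n$ $\forall m\in\mathbb{N}$ $\exists q\in\mathbb{N}_0$ $\forall\tilde\phi\in\widetilde{\mathcal A}_q(\Omega)$: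 $\sup_{x\in K}|\partial_x^\alpha(R(\tilde\phi_{\varepsilon,x},x))|=O(\varepsilon^m)$. $\hat{\mathcal E}_m(\Omega)$ is a subalgebra of $\hat{\mathcal E}(\Omega)$, $\hat{\mathcal N}(\Omega)$ is an ideal in $\hat{\mathcal E}_m(\Omega)$, and $\hat{\mathcal G}(\Omega)=\hat{\mathcal E}_m(\Omega)/\hat{\mathcal N}(\Omega)$. Pullback. For $\rho\in\mathcal D(\Omega')$, $(\mu^*\rho)(y)=\rho(\mu y)\,|\det\mathrm D\mu(y)|$, and $\mu_*=(\mu^{-1})^*\colon\mathcal D(\Omega)\to\mathcal D(\Omega')$. For $R\in\hat{\mathcal E}(\Omega')$, $\mu^*R\in\hat{\mathcal E}(\Omega)$ is defined by $(\mu^*R)(\varphi,x)=R(\mu_*\varphi,\mu x)$. *)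

(* Defs.v *)
From HB Require Import structures.
From mathcomp Require Import all_boot all_order all_algebra.
From mathcomp Require Import all_classical all_reals all_analysis.

Set Implicit Arguments.
Unset Strict Implicit.
Unset Printing Implicit Defensive.

Import Order.TTheory GRing.Theory Num.Theory.
Import numFieldNormedType.Exports.

Local Open Scope classical_set_scope.
Local Open Scope ring_scope.

(* Test functions and nonlinear functionals are scalar-valued, with real or
   complex scalars. Complex numbers are pairs (real part, imaginary part),
   which makes them a normed module over R; as that module carries the sup norm,
   the modulus is [sabs]. *)
Variant scalars := RealScalars | ComplexScalars.

Definition scalar_of (R : realType) (s : scalars) : normedModType R :=
  match s with
  | RealScalars => R
  | ComplexScalars => (R * R)%type
  end.

Definition sabs (R : realType) (s : scalars) : scalar_of R s -> R :=
  match s with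
  | RealScalars => fun a : R => `|a|
  | ComplexScalars => fun z : R * R => Num.sqrt (z.1 ^+ 2 + z.2 ^+ 2)
  end.

Definition smul (R : realType) (s : scalars) :
    scalar_of R s -> scalar_of R s -> scalar_of R s :=
  match s with
  | RealScalars => fun a b : R => a * b
  | ComplexScalars => fun z w : R * R =>
      (z.1 * w.1 - z.2 * w.2, z.1 * w.2 + z.2 * w.1)
  end.

(* The Lebesgue integral over 'rV[R]_n is written as an iterated
   one-dimensional integral; it is only applied to continuous functions with
   compact support, for which the two agree by Fubini's theorem. *)
Fixpoint int_Rn (R : realType) (n : nat) : ('rV[R]_n -> R) -> R :=
  match n with
  | 0 => fun f => f 0
  | m.+1 => fun f =>
      \int[lebesgue_measure]_(t in [set: R])
        int_Rn (fun y : 'rV[R]_m => f (row_mx (t%:M : 'rV[R]_1) y))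
  end.

Definition scalar_int (R : realType) (s : scalars) (n : nat) :
    ('rV[R]_n -> scalar_of R s) -> scalar_of R s :=
  match s with
  | RealScalars => fun f : 'rV[R]_n -> R => int_Rn f
  | ComplexScalars => fun f : 'rV[R]_n -> R * R =>
      (int_Rn (fun y => (f y).1), int_Rn (fun y => (f y).2))
  end.

Section Calculus.
Context {R : realType} {n : nat}.
Implicit Types (V : normedModType R) (W : set 'rV[R]_n).

Definition pderiv V (i : 'I_n) (f : 'rV[R]_n -> V) : 'rV[R]_n -> V :=
  fun x => 'D_(delta_mx 0 i) f x.

Definition pderivs V (l : seq 'I_n) (f : 'rV[R]_n -> V) : 'rV[R]_n -> V :=
  foldr (@pderiv V) f l.

Definition mindex := {ffun 'I_n -> nat}.

Definition mlen (a : mindex) : nat := (\sum_i a i)%N.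

Definition mseq (a : mindex) : seq 'I_n :=
  flatten [seq nseq (a i) i | i <- enum 'I_n].

Definition mderiv V (a : mindex) (f : 'rV[R]_n -> V) : 'rV[R]_n -> V :=
  pderivs (mseq a) f.

(* Functions on an open set W are represented by functions on the whole space
   whose values outside W are irrelevant. *)
Definition smooth_on V W (f : 'rV[R]_n -> V) : Prop :=
  forall (l : seq 'I_n) x, W x ->
    {for x, continuous (pderivs l f)} /\
    forall i, derivable (pderivs l f) x (delta_mx 0 i).

Definition smooth_curve V (c : R -> V) : Prop :=
  forall (k : nat) (t : R), derivable (derive1n k c) t 1.

Definition euclid_norm (x : 'rV[R]_n) : R :=
  Num.sqrt (\sum_i x 0 i ^+ 2).

Definition euclid_ball (x : 'rV[R]_n) (r : R) : set 'rV[R]_n :=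
  [set y | euclid_norm (y - x) < r].

Definition cpt_inside (K W : set 'rV[R]_n) : Prop :=
  compact K /\ K `<=` W°.

(* f eps x = O(g eps) for eps in (0, 1], uniformly for x in A *)
Definition uniform_bigO (T : Type) (A : set T) (f : R -> T -> R) (g : R -> R) :
    Prop :=
  exists2 eps0 : R, 0 < eps0 & exists2 C : R, 0 < C &
    forall eps, 0 < eps <= 1 -> eps <= eps0 ->
      forall x, A x -> f eps x <= C * g eps.

Record diffeo (W W' : set 'rV[R]_n) := Diffeo {
  diffeo_fun : 'rV[R]_n -> 'rV[R]_n;
  diffeo_inv : 'rV[R]_n -> 'rV[R]_n;
  diffeo_fun_in : forall x, W x -> W' (diffeo_fun x);
  diffeo_inv_in : forall y, W' y -> W (diffeo_inv y);
  diffeo_funK : forall x, W x -> diffeo_inv (diffeo_fun x) = x;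
  diffeo_invK : forall y, W' y -> diffeo_fun (diffeo_inv y) = y;
  diffeo_fun_smooth : smooth_on W diffeo_fun;
  diffeo_inv_smooth : smooth_on W' diffeo_inv }.

End Calculus.

Arguments mindex n : clear implicits.

Section Algebra.
Context {R : realType} (s : scalars) {n : nat}.
Local Notation E := 'rV[R]_n.
Local Notation K := (scalar_of R s).
Implicit Types (W : set E) (phi : E -> K) (c : R -> E -> K).
Implicit Types (ker : R -> E -> E -> K) (F : (E -> K) -> E -> K).

Definition supp phi : set E := closure [set y | phi y != 0].

(* Test functions on W are extended by zero to the whole space. *)
Definition test_fun W phi : Prop :=
  smooth_on [set: E] phi /\ cpt_inside (supp phi) W.

(* The continuous seminorms of the strict inductive limit of the Frechet
   spaces of smooth functions supported in L, for L compact in W. *)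
Definition test_seminorm W (p : (E -> K) -> R) : Prop :=
  [/\ forall phi psi, test_fun W phi -> test_fun W psi ->
        p (fun y => phi y + psi y) <= p phi + p psi,
      forall (a : R) phi, test_fun W phi ->
        p (fun y => a *: phi y) = `|a| * p phi &
      forall L, cpt_inside L W ->
        exists (m : nat) (C : R), forall phi, test_fun W phi -> supp phi `<=` L ->
          forall B : R,
            (forall (a : mindex n) y, (mlen a <= m)%N ->
               sabs (mderiv a phi y) <= B) ->
            p phi <= C * B].

(* [d k] is the k-th derivative of the curve for the locally convex topology
   of the space of test functions. *)
Definition smooth_test_curve W c : Prop :=
  exists d : nat -> R -> E -> K,
    [/\ d 0%N = c,
        forall k t, test_fun W (d k t) &
        forall k t p, test_seminorm W p ->
          (fun h : R => p (fun y =>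
             h^-1 *: (d k (t + h) y - d k t y) - d k.+1 t y)) @ 0^' --> (0 : R)].

(* Smoothness in convenient calculus: smooth curves are mapped to smooth
   curves; this is also the definition on the non-open domain (0, 1] x W. *)
Definition smooth_kernel W ker : Prop :=
  forall (e : R -> R) (x : R -> E),
    smooth_curve e -> smooth_curve x ->
    (forall t, 0 < e t <= 1) -> (forall t, W (x t)) ->
    smooth_test_curve W (fun t => ker (e t) (x t)).

Definition pdx (i : 'I_n) (g : E -> E -> K) : E -> E -> K :=
  fun x y => pderiv i (g ^~ y) x.

Definition pdy (i : 'I_n) (g : E -> E -> K) : E -> E -> K :=
  fun x y => pderiv i (g x) y.

Definition pdxy (i : 'I_n) (g : E -> E -> K) : E -> E -> K :=
  fun x y => pdx i g x y + pdy i g x y.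

Definition LSK1 W ker : Prop :=
  forall L, cpt_inside L W ->
    exists eps0 C : R, [/\ 0 < eps0, 0 < C &
      forall x (eps : R), L x -> 0 < eps <= 1 -> eps < eps0 ->
        supp (ker eps x) `<=` euclid_ball x (C * eps)].

Definition LSK2 W ker : Prop :=
  forall L, cpt_inside L W -> forall a b : mindex n,
    uniform_bigO (L `*` W)
      (fun eps xy =>
         sabs (foldr pdxy (foldr pdy (ker eps) (mseq b)) (mseq a) xy.1 xy.2))
      (fun eps => eps ^- (n + mlen b)%N).

Definition LSK3 (q : nat) W ker : Prop :=
  forall L, cpt_inside L W -> forall (a : mindex n) (f : E -> K),
    smooth_on W f ->
    uniform_bigO L
      (fun eps x =>
         sabs (scalar_int (patch (fun=> 0) W
                 (fun y => smul (f y) (mderiv a ((ker eps) ^~ y) x)))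
               - mderiv a f x))
      (fun eps => eps ^+ q.+1).

Definition smoothing_kernel (q : nat) W ker : Prop :=
  [/\ smooth_kernel W ker, LSK1 W ker, LSK2 W ker & LSK3 q W ker].

(* Elements of the basic space are represented by functions whose values
   outside (test functions on W) x W are irrelevant. *)
Definition basic_space W : set ((E -> K) -> E -> K) :=
  [set F | forall (c : R -> E -> K) (x : R -> E),
     smooth_test_curve W c -> smooth_curve x -> (forall t, W (x t)) ->
     smooth_curve (fun t => F (c t) (x t))].

Definition moderate_gf W : set ((E -> K) -> E -> K) :=
  [set F | basic_space W F /\
     forall L, cpt_inside L W -> forall a : mindex n,
     exists q N : nat, forall ker, smoothing_kernel q W ker ->
       uniform_bigO L
         (fun eps x => sabs (mderiv a (fun z => F (ker eps z) z) x))
         (fun eps => eps ^- N)].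

Definition negligible_gf W : set ((E -> K) -> E -> K) :=
  [set F | basic_space W F /\
     forall L, cpt_inside L W -> forall (a : mindex n) (m : nat),
     exists q : nat, forall ker, smoothing_kernel q W ker ->
       uniform_bigO L
         (fun eps x => sabs (mderiv a (fun z => F (ker eps z) z) x))
         (fun eps => eps ^+ m)].

Definition gf_coset W F : set ((E -> K) -> E -> K) :=
  [set G | negligible_gf W (fun phi x => G phi x - F phi x)].

(* The quotient of moderate by negligible functions, as a set of cosets. *)
Definition gf_quotient W : Type :=
  {A : set ((E -> K) -> E -> K) | exists2 F, moderate_gf W F & A = gf_coset W F}.

Definition gf_represents W F (A : gf_quotient W) : Prop :=
  moderate_gf W F /\ sval A = gf_coset W F.

Definition push_test W W' (mu : diffeo W W') phi : E -> K :=
  patch (fun=> 0) W' (fun y => `|\det (jacobian (diffeo_inv mu) y)| *: phi (diffeo_inv mu y)).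

Definition pull_fun W W' (mu : diffeo W W') F : (E -> K) -> E -> K :=
  fun phi x => F (push_test mu phi) (diffeo_fun mu x).

End Algebra.

Arguments basic_space {R} s {n} W.
Arguments moderate_gf {R} s {n} W.
Arguments negligible_gf {R} s {n} W.
Arguments gf_quotient {R} s {n} W.

(* Main.v *)
(* Put psi_{eps,x'} = mu_* (phi_{eps,nu x'}) with nu the inverse of mu. Then
   (mu^* R)(phi_{eps,x}, x) = R(psi_{eps,x'}, x') at x' = mu x, so by the chain rule
   everything follows from the fact that psi is a smoothing kernel on W' of the same
   order q as phi.
   - Smoothness: push-forward is bounded for the seminorms of test functions.
     Moreover, a function that maps smooth curves to smooth curves is smooth (Boman):
     testing with a curve through a bad sequence of lines bounds all line derivatives
     locally, and mixed derivatives are recovered by Kemperman's identity.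
   - LSK1: mu is locally Lipschitz.
   - LSK2: say that g_eps(x, y) has order m near the diagonal if a word in
     d_{x+y} and d_y with k letters d_y maps it to O(eps^(m-k)). Orders add up under
     products, and the substitution (x, y) -> (nu x, nu y) preserves them: it turns
     d_{x+y} into combinations of d_{x+y} and of (Dnu(y) - Dnu(x)) d_y, whose
     coefficient has order 1 because it vanishes on the diagonal.
   - LSK3: change variables in the integral and apply LSK3 for phi to f o mu.
     The supports shrink, so the formula is only needed for integrands supported near
     a point. There nu is deformed into an affine map; the integral of
     g(Psi_t) det(DPsi_t) does not depend on t since its t-derivative is a divergence.
     For invertible matrices the formula follows by block elimination. *)

(* Kernels and elements of the basic space are smooth only in the sense that they map curves to
   curves, whereas LSK2, moderateness and negligibility speak of partial derivatives. The curve test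
   composes trivially and is used for every construction; Boman's theorem turns it into existence,
   continuity and symmetry of partial derivatives wherever an estimate is made. Two choices keep the
   estimates uniform in eps. The chain rule is stated with coefficients that depend on the
   diffeomorphism alone, so they can be bounded before the kernel is known. The conditions LSK1 and
   LSK2 are proved near one point at a time, where one ball, one Lipschitz constant and one tube
   around the diagonal suffice, and are then glued by compactness. The change of variables is
   carried out for the iterated integral itself: the tools are the fundamental theorem of calculus
   and differentiation under the integral sign, and the order of integration is never exchanged. *)
Require Import Defs.
From HB Require Import structures.
From mathcomp Require Import all_boot all_order all_fingroup all_algebra.
From mathcomp Require Import all_classical all_reals all_analysis.
From mathcomp Require Import ring lra zify.

Set Implicit Arguments.
Unset Strict Implicit.
Unset Printing Implicit Defensive.
Import Order.TTheory GRing.Theory Num.Theory.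
Import numFieldNormedType.Exports.

Local Notation "f ^` ()" := (derive1 f) : ring_scope.
Local Notation "f ^` ( n )" := (derive1n n f) : ring_scope.

(** * Smooth curves *)

(* Locking keeps [done] from unfolding the iterated derivatives. *)
HB.lock Definition scurve (R : realType) (V : normedModType R) (c : R -> V) : Prop :=
  smooth_curve c.

Section SmoothCurves.
Local Open Scope ring_scope.
Local Open Scope classical_set_scope.
Context {R : realType}.
Implicit Types (V : normedModType R) (t : R).

Lemma scurveE V (c : R -> V) : scurve c = smooth_curve c.
Proof. by rewrite scurve.unlock. Qed.

Definition der V (c : R -> V) (t : R) (d : V) : Prop := is_derive t 1 c d.

Lemma der_derive1 V (c : R -> V) t d : der c t d -> c^`() t = d.
Proof. by move=> h; rewrite derive1E; exact: derive_val. Qed.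

Lemma der_derivable V (c : R -> V) t d : der c t d -> derivable c t 1.
Proof. by case. Qed.

Lemma derivable_der V (c : R -> V) t : derivable c t 1 -> der c t (c^`() t).
Proof. by move=> h; rewrite derive1E; exact: derivableP. Qed.

Lemma der_uniq V (c : R -> V) t d d' : der c t d -> der c t d' -> d = d'.
Proof. by move=> /der_derive1 <- /der_derive1. Qed.

Lemma der_cvgP V (c : R -> V) t d :
  der c t d <-> (fun h : R => h^-1 *: (c (h + t) - c t)) @ 0^' --> d.
Proof.
have E : (fun h : R => h^-1 *: ((c \o shift t) (h *: (1 : R)) - c t)) =
    (fun h : R => h^-1 *: (c (h + t) - c t)).
  by apply/funext => h /=; rewrite [h *: _]mulr1.
split=> [[D Dd]|D].
  move: D Dd; rewrite /derivable /derive E => D Dd.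
  by move/cvg_ex: D => [l Dl]; move: Dd; rewrite (cvg_lim _ Dl)// => <-.
split; first by apply/cvg_ex; exists d; rewrite E.
by rewrite /derive E; exact: cvg_lim D.
Qed.

Lemma der_cvg V (c : R -> V) t d :
  der c t d -> (fun h : R => c (h + t)) @ 0^' --> c t.
Proof.
move=> h.
have dc : {for t, continuous c}.
  by apply: differentiable_continuous; apply/derivable1_diffP; exact: der_derivable h.
have := @cvg_comp _ _ _ (fun h : R => h + t) c (0^') (nbhs t) (nbhs (c t)).
apply; last exact: dc.
apply: cvg_within_filter.
have := @cvgD _ R^o _ _ _ (fun h : R => h) (fun=> t) 0 t cvg_id (cvg_cst t).
rewrite add0r; apply; exact: nbhs_filter.
Qed.

Lemma der_continuous V (c : R -> V) t d : der c t d -> {for t, continuous c}.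
Proof.
by move=> h; apply: differentiable_continuous; apply/derivable1_diffP; exact: der_derivable h.
Qed.

Lemma der_near V (c c' : R -> V) t d :
  (\near t, c t = c' t) -> der c t d -> der c' t d.
Proof. by move=> cc' cd; apply: (near_eq_is_derive cc' cd). Qed.

Lemma der_cst V (v : V) t : der (fun=> v) t 0.
Proof. exact: is_derive_cst. Qed.

Lemma der_id t : der (fun t : R => t) t 1.
Proof. exact: is_derive_id. Qed.

Lemma der_add V (a b : R -> V) t da db :
  der a t da -> der b t db -> der (fun t => a t + b t) t (da + db).
Proof. by move=> ha hb; exact: is_deriveD. Qed.

Lemma der_opp V (a : R -> V) t da : der a t da -> der (fun t => - a t) t (- da).
Proof. by move=> ha; exact: is_deriveN. Qed.

Lemma der_scale V (f : R -> R) (a : R -> V) t df da :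
  der f t df -> der a t da ->
  der (fun t => f t *: a t) t (df *: a t + f t *: da).
Proof.
move=> hf ha; have ca := der_cvg ha; move/der_cvgP: hf => hf; move/der_cvgP: ha => ha.
apply/der_cvgP.
have -> : (fun h => h^-1 *: (f (h + t) *: a (h + t) - f t *: a t)) =
   (fun h => (h^-1 *: (f (h + t) - f t)) *: a (h + t)
             + f t *: (h^-1 *: (a (h + t) - a t))).
  apply/funext => h; rewrite [h^-1 *: (_ - _ : R)]/(h^-1 * _).
  rewrite (scalerA (f t)) (mulrC (f t)) -scalerA -scalerA -scalerDr.
  by congr (_ *: _); rewrite scalerBl scalerBr addrA subrK.
apply: cvgD; first exact: cvgZ.
exact: cvgZr.
Qed.

Lemma der_mul (f g : R -> R) t df dg :
  der f t df -> der g t dg -> der (fun t => f t * g t) t (df * g t + f t * dg).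
Proof. exact: der_scale. Qed.

Lemma der_comp V (c : R -> V) (s : R -> R) t ds dc :
  der s t ds -> der c (s t) dc -> der (fun t => c (s t)) t (ds *: dc).
Proof.
move=> hs hc.
have ds' : differentiable s t by apply/derivable1_diffP; exact: der_derivable hs.
have dc' : differentiable c (s t) by apply/derivable1_diffP; exact: der_derivable hc.
have dcs : differentiable (c \o s) t by exact: differentiable_comp.
have -> : (fun t => c (s t)) = c \o s by [].
suff -> : ds *: dc = (c \o s)^`() t.
  by apply: derivable_der; apply/derivable1_diffP.
rewrite derive1E' //= diff_comp//=.
rewrite (deriv1E (der_derivable hs)) /= scale1r.
rewrite (deriv1E (der_derivable hc)) /=.
by rewrite (der_derive1 hs) (der_derive1 hc).
Qed.

Lemma der_inv (f : R -> R) t df :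
  f t != 0 -> der f t df -> der (fun t => (f t)^-1) t (- (f t)^-1 * (f t)^-1 * df).
Proof.
move=> f0 hf; have := derivableV f0 (der_derivable hf) => h.
have := deriveV f0 (der_derivable hf) => hE.
suff -> : - (f t)^-1 * (f t)^-1 * df = 'D_1 (fun t => (f t)^-1) t by exact: derivableP.
rewrite hE (_ : 'D_1 f t = df); last by rewrite -derive1E; exact: der_derive1.
by rewrite [RHS]/(_ * _) expr2 invfM mulNr.
Qed.

Lemma der_lin V V' (p : {linear V -> V'}) (c : R -> V) t d :
  continuous p -> der c t d -> der (fun t => p (c t)) t (p d).
Proof.
move=> cp /der_cvgP hc; apply/der_cvgP.
have -> : (fun h => h^-1 *: (p (c (h + t)) - p (c t))) =
          p \o (fun h => h^-1 *: (c (h + t) - c t)).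
  by apply/funext => h /=; rewrite linearZ -linearB.
by apply: cvg_comp hc _; exact: cp.
Qed.

(** Differentiability of order k with the derivatives as witnesses: closure under sums, products and
    compositions is then an induction on k that uses only the first-order rules for [der]. *)
Fixpoint cn V k (c : R -> V) : Prop :=
  if k is k'.+1 then exists2 d, forall t, der c t (d t) & cn k' d else True.

Lemma cnS V k (c : R -> V) :
  cn k.+1 c <-> (forall t, derivable c t 1) /\ cn k c^`().
Proof.
split=> [[d hd kd]|[hc kc]].
  have -> : c^`() = d by apply/funext => t; exact: der_derive1.
  by split=> // t; exact: der_derivable.
by exists c^`() => // t; exact: derivable_der.
Qed.

Lemma cnW V k (c : R -> V) : cn k.+1 c -> cn k c.
Proof.
elim: k c => // k IH c [d hd kd]; exists d => //; exact: IH.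
Qed.

Lemma scurve_cn V (c : R -> V) : scurve c <-> forall k, cn k c.
Proof.
rewrite scurveE; split.
  move=> hc k; elim: k c hc => // k IH c hc; apply/cnS; split.
    by move=> t; exact: (hc 0%N t).
  by apply: IH => j t; have := hc j.+1 t; rewrite derive1Sn.
move=> hc k t; elim: k c hc => [|k IH] c hc.
  by have /cnS[] := hc 1%N.
rewrite derive1Sn; apply: IH => j.
by have /cnS[] := hc j.+1.
Qed.

Lemma scurve_der V (c : R -> V) t : scurve c -> der c t (c^`() t).
Proof. by move=> /scurve_cn /(_ 1%N) /cnS[h _]; exact: derivable_der. Qed.

Lemma scurve_derive V (c : R -> V) : scurve c -> scurve c^`().
Proof. by move=> /scurve_cn h; apply/scurve_cn => k; have /cnS[] := h k.+1. Qed.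

Lemma scurve_derive_n V (c : R -> V) k : scurve c -> scurve c^`(k).
Proof.
by move=> h; elim: k => [|k IH]; rewrite ?derive1n0 ?derive1nS //; exact: scurve_derive.
Qed.

Lemma scurveS V (c d : R -> V) : (forall t, der c t (d t)) -> scurve d -> scurve c.
Proof.
by move=> h /scurve_cn hd; apply/scurve_cn => -[|k] //; exists d.
Qed.

Lemma scurve_continuous V (c : R -> V) : scurve c -> continuous c.
Proof. by move=> hc t; exact: der_continuous (scurve_der t hc). Qed.

(** Coinduction, for curves whose derivatives are not given by a formula: those known only locally
    and those obtained as limits. *)
Lemma scurve_coind V (P : (R -> V) -> Prop) :
  (forall c, P c -> (forall t, derivable c t 1) /\ P c^`()) ->
  forall c, P c -> scurve c.
Proof.
move=> hP c Pc; apply/scurve_cn => k; elim: k c Pc => // k IH c Pc.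
by apply/cnS; have [h1 h2] := hP _ Pc; split=> //; exact: IH.
Qed.

Lemma scurve_local V (c : R -> V) :
  (forall t0, exists2 c0, scurve c0 & \near t0, c t0 = c0 t0) -> scurve c.
Proof.
move: c; apply: scurve_coind => c hc.
have dc : forall t, derivable c t 1.
  move=> t; have [c0 s0 n0] := hc t; apply: near_eq_derivable (der_derivable (scurve_der t s0)).
  by near do apply/esym.
split=> // t; have [c0 s0 n0] := hc t; exists c0^`(); first exact: scurve_derive.
have := near_join n0; apply: filterS => u nu.
by rewrite !derive1E; exact: near_eq_derive.
Unshelve. all: by end_near. Qed.

Lemma scurve_cst V (v : V) : scurve (fun=> v : V).
Proof.
apply/scurve_cn => k; elim: k v => // k IH v; exists (fun=> 0) => // t; exact: der_cst.
Qed.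

Lemma scurve_id : scurve (fun t : R => t).
Proof. by apply: (@scurveS R^o _ (fun=> 1)); [move=> t; exact: der_id|exact: scurve_cst]. Qed.

Lemma cn_add V k (a b : R -> V) : cn k a -> cn k b -> cn k (fun t => a t + b t).
Proof.
elim: k a b => // k IH a b [da ha ka] [db hb kb].
by exists (fun t => da t + db t); [move=> t; exact: der_add|exact: IH].
Qed.

Lemma scurve_add V (a b : R -> V) : scurve a -> scurve b -> scurve (fun t => a t + b t).
Proof. by move=> /scurve_cn ha /scurve_cn hb; apply/scurve_cn => k; exact: cn_add. Qed.

Lemma cn_scale V k (f : R -> R) (a : R -> V) :
  cn k f -> cn k a -> cn k (fun t => f t *: a t).
Proof.
elim: k f a => // k IH f a kf ka; have kf' := cnW kf; have ka' := cnW ka.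
case: kf => df hf kf; case: ka => da ha ka.
exists (fun t => df t *: a t + f t *: da t); first by move=> t; exact: der_scale.
by apply: cn_add; exact: IH.
Qed.

Lemma scurve_scale V (f : R -> R) (a : R -> V) :
  scurve f -> scurve a -> scurve (fun t => f t *: a t).
Proof. by move=> /scurve_cn ha /scurve_cn hb; apply/scurve_cn => k; exact: cn_scale. Qed.

Lemma scurve_mul (f g : R -> R) :
  scurve f -> scurve g -> scurve (fun t => f t * g t).
Proof. exact: scurve_scale. Qed.

Lemma scurve_opp V (a : R -> V) : scurve a -> scurve (fun t => - a t).
Proof.
move=> h; rewrite (_ : (fun t => - a t) = (fun t => (-1 : R) *: a t)).
  by apply: scurve_scale => //; exact: scurve_cst.
by apply/funext => t; rewrite scaleN1r.
Qed.

Lemma scurve_sub V (a b : R -> V) : scurve a -> scurve b -> scurve (fun t => a t - b t).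
Proof. by move=> ha hb; apply: scurve_add => //; exact: scurve_opp. Qed.

Lemma scurve_sum V (I : Type) (r : seq I) (a : I -> R -> V) :
  (forall i, scurve (a i)) -> scurve (fun t => \sum_(i <- r) a i t).
Proof.
move=> h; elim: r => [|i r IH].
  rewrite (_ : (fun t => _) = (fun=> 0)); first exact: scurve_cst.
  by apply/funext => t; rewrite big_nil.
rewrite (_ : (fun t => _) = (fun t => a i t + \sum_(i <- r) a i t)).
  exact: scurve_add.
by apply/funext => t; rewrite big_cons.
Qed.

Lemma scurve_prod (I : Type) (r : seq I) (a : I -> R -> R) :
  (forall i, scurve (a i)) -> scurve (fun t => \prod_(i <- r) a i t).
Proof.
move=> h; elim: r => [|i r IH].
  rewrite (_ : (fun t => _) = (fun=> 1)); first exact: scurve_cst.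
  by apply/funext => t; rewrite big_nil.
rewrite (_ : (fun t => _) = (fun t => a i t * \prod_(i <- r) a i t)).
  exact: scurve_mul.
by apply/funext => t; rewrite big_cons.
Qed.

Lemma cn_comp V k (c : R -> V) (s : R -> R) : cn k s -> cn k c -> cn k (fun t => c (s t)).
Proof.
elim: k c s => // k IH c s ks kc; have ks' := cnW ks; case: ks => ds hs ks; case: kc => dc hc kc.
exists (fun t => ds t *: dc (s t)); first by move=> t; exact: der_comp.
by apply: cn_scale => //; exact: IH.
Qed.

Lemma scurve_comp V (c : R -> V) (s : R -> R) :
  scurve s -> scurve c -> scurve (fun t => c (s t)).
Proof. by move=> /scurve_cn hs /scurve_cn hc; apply/scurve_cn => k; exact: cn_comp. Qed.

Lemma scurve_inv (f : R -> R) :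
  (forall t, f t != 0) -> scurve f -> scurve (fun t => (f t)^-1).
Proof.
move=> f0 sf; apply/scurve_cn => k; elim: k => // k IH.
exists (fun t => - (f t)^-1 * (f t)^-1 * f^`()%classic t).
  by move=> t; apply: der_inv => //; exact: scurve_der.
apply: cn_scale; last by have /scurve_cn := scurve_derive sf.
apply: cn_scale => //; move: IH; rewrite -/cn => IH.
rewrite (_ : (fun t => _) = (fun t => (-1 : R) *: (f t)^-1)).
  by apply: cn_scale => //; have /scurve_cn := @scurve_cst _ (-1 : R).
by apply/funext => t; rewrite scaleN1r.
Qed.

Lemma scurve_lin V V' (p : {linear V -> V'}) (c : R -> V) :
  continuous p -> scurve c -> scurve (fun t => p (c t)).
Proof.
move=> cp /scurve_cn hc; apply/scurve_cn => k; move/(_ k): hc.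
elim: k c => // k IH c [d hd kd]; exists (fun t => p (d t)); last exact: IH.
by move=> t; exact: der_lin.
Qed.

(* The k-th derivative of exp(-1/t) is a polynomial in 1/t times exp(-1/t). *)
Definition flat (m : nat) (t : R) : R :=
  if 0 < t then t^-1 ^+ m * expR (- t^-1) else 0.

(** One term of the exponential series bounds expR (1/t) from below. The exponent m + 2 leaves a
    factor t^2, which makes the difference quotients at 0 tend to 0 in [der_flat]. *)
Lemma flat_le m t : `|flat m t| <= (m.+2)`!%:R * t ^+ 2.
Proof.
rewrite /flat; case: ltP => [t0|_]; last by rewrite normr0 mulr_ge0 // sqr_ge0.
have s0 : 0 < t^-1 by rewrite invr_gt0.
rewrite ger0_norm; last by rewrite mulr_ge0 ?expR_ge0 // exprn_ge0 // ltW.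
have := @expR_ge1Dxn R t^-1 m.+1 (ltW s0); rewrite expRN => h.
have {}h : t^-1 ^+ m.+2 / (m.+2)`!%:R <= expR t^-1.
  by apply: le_trans h; rewrite lerDr ler01.
have f0 : 0 < (m.+2)`!%:R :> R by rewrite ltr0n fact_gt0.
move: h; rewrite ler_pdivrMr // => h.
rewrite ler_pdivrMr ?expR_gt0 //.
have -> : t^-1 ^+ m = t ^+ 2 * t^-1 ^+ m.+2.
  by rewrite -[m.+2]addn2 exprD mulrCA -exprMn divff ?gt_eqF // expr1n mulr1.
rewrite (_ : _ * _ * expR _ = t ^+ 2 * (expR t^-1 * (m.+2)`!%:R)); last by ring.
by rewrite ler_pM2l ?exprn_gt0.
Qed.

Lemma der_flat m t : der (flat m) t (flat m.+2 t - m%:R * flat m.+1 t).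
Proof.
have [t0|t0|t0] := ltgtP 0 t.
- apply: (@der_near _ (fun t => t^-1 ^+ m * expR (- t^-1))).
    near=> u; rewrite /flat ifT //; near: u; exact: lt_nbhsr.
  have di : der (fun t : R => t^-1) t (- t^-1 * t^-1 * 1).
    by apply: der_inv; [rewrite gt_eqF|exact: der_id].
  have dp : der (fun t : R => t^-1 ^+ m) t (- (m%:R * t^-1 ^+ m.+1)).
    have := @is_deriveX _ _ (fun t : R => t^-1) m t 1 _ di.
    rewrite /der; have -> : (fun t0 : R => t0^-1) ^+ m = (fun t0 : R => t0^-1 ^+ m).
      by apply/funext => u; rewrite fctE.
    move=> h; apply: (is_derive_eq h).
    rewrite (_ : _ *: _ = (m%:R * t^-1 ^+ m.-1) * (- t^-1 * t^-1 * 1)) //.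
    case: m {h} => [|m]; first by rewrite !mul0r oppr0.
    by rewrite /= !exprS; ring.
  have de : der (fun t : R => expR (- t^-1)) t (- (- t^-1 * t^-1 * 1) *: expR (- t^-1)).
    apply: (@der_comp _ (@expR R) (fun t => - t^-1)); first exact: der_opp.
    exact: is_derive_expR.
  have := der_mul dp de; rewrite /flat t0 !exprS.
  set x := t^-1 ^+ m; set y := expR _ => h.
  rewrite (_ : _ - _ = - (m%:R * (t^-1 * x)) * y + x * (- (- t^-1 * t^-1 * 1) *: y)) //.
  rewrite (_ : _ *: y = - (- t^-1 * t^-1 * 1) * y) //; ring.
- apply: (@der_near _ (fun=> 0)).
    near=> u; rewrite /flat ifF //; apply/negbTE; rewrite -leNgt; near: u.
    by apply: filterS (lt_nbhsl t0) => x /ltW.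
  by rewrite /flat !ifF ?mulr0 ?subr0 ?(lt_gtF t0) //; exact: der_cst.
- have fl0 k : flat k 0 = 0 by rewrite /flat ltxx.
  rewrite -t0 !fl0 mulr0 subr0; have f0 := fl0 m; apply/der_cvgP.
  apply/cvgr0Pnorm_le => e e0.
  near=> h; rewrite addr0 f0 subr0 normrM normfV.
  have h0 : h != 0 by near: h; exact: nbhs_dnbhs_neq.
  rewrite ler_pdivrMl ?normr_gt0 //; apply: le_trans (flat_le _ _) _.
  rewrite -[h ^+ 2]real_normK ?num_real // expr2 mulrA mulrC ler_pM2l ?normr_gt0 //.
  rewrite -ler_pdivlMl ?ltr0n ?fact_gt0 // mulrC.
  near: h; apply: cvg_within; apply: (@nbhs0_le _ R).
  by rewrite divr_gt0 // ltr0n fact_gt0.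
Unshelve. all: by end_near. Qed.

Lemma scurve_flat m : scurve (flat m).
Proof.
apply/scurve_cn => k; elim: k m => // k IH m.
exists (fun t => flat m.+2 t - m%:R * flat m.+1 t); first exact: der_flat.
apply: cn_add => //; rewrite (_ : (fun t => _) = (fun t => (- m%:R) *: flat m.+1 t)).
  by apply: cn_scale => //; have /scurve_cn := @scurve_cst _ (- m%:R : R).
by apply/funext => t; rewrite -mulNr.
Qed.

Lemma flat_gt0 m t : 0 < t -> 0 < flat m t.
Proof. by move=> t0; rewrite /flat t0 mulr_gt0 ?expR_gt0 // exprn_gt0 // invr_gt0. Qed.

Lemma flat_ge0 m t : 0 <= flat m t.
Proof.
by rewrite /flat; case: ltP => // t0; rewrite mulr_ge0 ?expR_ge0 // exprn_ge0 // invr_ge0 ltW.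
Qed.

Definition smooth_step (t : R) : R := flat 0 t / (flat 0 t + flat 0 (1 - t)).

Lemma smooth_step_den t : 0 < flat 0 t + flat 0 (1 - t).
Proof.
have [t0|t0] := ltP 0 t; first by rewrite ltr_pwDl ?flat_gt0 // flat_ge0.
by rewrite ltr_wpDl ?flat_ge0 // flat_gt0 //; lra.
Qed.

Lemma scurve_smooth_step : scurve smooth_step.
Proof.
apply: scurve_mul; first exact: scurve_flat.
apply: scurve_inv; first by move=> t; rewrite gt_eqF // smooth_step_den.
apply: scurve_add; first exact: scurve_flat.
apply: (@scurve_comp _ (flat 0) (fun t => 1 - t)); last exact: scurve_flat.
by apply: scurve_sub; [exact: scurve_cst|exact: scurve_id].
Qed.

Lemma smooth_step0 t : t <= 0 -> smooth_step t = 0.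
Proof. by move=> t0; rewrite /smooth_step /flat ltNge t0 /= mul0r. Qed.

Lemma smooth_step1 t : 1 <= t -> smooth_step t = 1.
Proof.
move=> t0; have := smooth_step_den t; rewrite /smooth_step.
have -> : flat 0 (1 - t) = 0 by rewrite /flat ifF //; apply/negbTE; rewrite -leNgt; lra.
by rewrite addr0 => h; rewrite divff // gt_eqF.
Qed.

Lemma smooth_step_ge0 t : 0 <= smooth_step t.
Proof. by rewrite divr_ge0 ?flat_ge0 // ltW // smooth_step_den. Qed.

Lemma smooth_step_le1 t : smooth_step t <= 1.
Proof. by rewrite ler_pdivrMr ?smooth_step_den // mul1r lerDl flat_ge0. Qed.

(** The support |t| <= 1/4 is narrow enough for the copies at 2^k t - 1 in [special_sum] to be
    disjoint; the plateau |t| <= 1/8 is where they are evaluated. *)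
Definition bumpf (t : R) : R := smooth_step (2 + 8 * t) * smooth_step (2 - 8 * t).

Lemma scurve_bump : scurve bumpf.
Proof.
have sm (a b : R) : scurve (fun t => a + b * t).
  apply: scurve_add; first exact: scurve_cst.
  by apply: scurve_mul; [exact: scurve_cst|exact: scurve_id].
apply: scurve_mul; first by apply: scurve_comp; [exact: sm|exact: scurve_smooth_step].
apply: (@scurve_comp _ smooth_step (fun t => 2 - 8 * t)); last exact: scurve_smooth_step.
rewrite (_ : (fun t => _) = (fun t => 2 + (- 8) * t)); first exact: sm.
by apply/funext => t; rewrite mulNr.
Qed.

Lemma bump1 t : `|t| <= 1 / 8 -> bumpf t = 1.
Proof. by rewrite ler_norml => /andP[h1 h2]; rewrite /bumpf !smooth_step1 ?mulr1 //; lra. Qed.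

Lemma bump0 t : 1 / 4 <= `|t| -> bumpf t = 0.
Proof.
rewrite ler_normr => /orP[h|h]; rewrite /bumpf.
  by rewrite (@smooth_step0 (2 - 8 * t)) ?mulr0 //; lra.
by rewrite smooth_step0 ?mul0r //; lra.
Qed.

Lemma bump_ge0 t : 0 <= bumpf t.
Proof. by rewrite mulr_ge0 // smooth_step_ge0. Qed.

Lemma bump_le1 t : bumpf t <= 1.
Proof. by rewrite -[leRHS]mulr1 ler_pM ?smooth_step_ge0 ?smooth_step_le1. Qed.

End SmoothCurves.

Arguments scurve_continuous {R V c} sc x [A] : rename.

(** * Taylor bounds and limits of sequences of smooth curves *)

Section RealCurves.
Local Open Scope ring_scope.
Local Open Scope classical_set_scope.
Context {R : realType}.
Implicit Types (t a b : R) (c f g : R -> R).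

Lemma lim_norm_le (T : Type) (F : set_system T) {FF : ProperFilter F} (u : T -> R) (l C : R) :
  u @ F --> l -> (\forall x \near F, `|u x| <= C) -> `|l| <= C.
Proof.
move=> ul uC; rewrite leNgt; apply/negP => Cl.
have e0 : 0 < `|l| - C by rewrite subr_gt0.
have /cvgrPdist_lt /(_ _ e0) h := ul.
have [x [h1 h2]] := @filter_ex _ F _ _ (filterI uC h).
have : `|l| <= `|l - u x| + `|u x| by rewrite -{1}(subrK (u x) l) ler_normD.
by move: h1 h2; lra.
Qed.

(** The intermediate point is written as a convex combination, so that b < a and b = a are covered
    as well. *)
Lemma scurve_MVT c a b : scurve c ->
  exists2 th : R, 0 <= th <= 1 & c b - c a = c^`() (a + th * (b - a)) * (b - a).
Proof.
move=> hc.
have main : forall a b, a < b ->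
    exists2 th : R, 0 <= th <= 1 & c b - c a = c^`() (a + th * (b - a)) * (b - a).
  move=> {}a {}b ab.
  have [|x xab ->] := @MVT R c c^`() a b ab (fun x _ => scurve_der x hc).
    by apply: continuous_subspaceT; exact: scurve_continuous.
  have ba0 : 0 < b - a by rewrite subr_gt0.
  exists ((x - a) / (b - a)).
    move: xab; rewrite in_itv/= => /andP[ax xb].
    apply/andP; split; first by rewrite divr_ge0 // ?subr_ge0 ltW.
    by rewrite ler_pdivrMr // mul1r lerD2r ltW.
  by rewrite divfK ?gt_eqF // [a + (x - a)]addrC subrK.
have [ab|ab|<-] := ltgtP a b; first exact: main.
  have [th /andP[th0 th1] E] := main _ _ ab; exists (1 - th); first by apply/andP; split; lra.
  rewrite (_ : a + _ = b + th * (a - b)); last by ring.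
  by move: E; set D := c^`() _ => E; rewrite -opprB E; ring.
by exists 0; rewrite ?lexx ?ler01 // !subrr mulr0.
Qed.

(** Two mean value steps, hence C instead of C / 2. The bound on the second derivative is assumed
    near t only, which is all that [locally_bounded_derivatives] provides. *)
Lemma scurve_taylor c t (r C : R) :
  scurve c -> (forall u, `|u - t| < r -> `|c^`(2) u| <= C) ->
  forall h, `|h| < r -> `|c (t + h) - c t - h * c^`() t| <= C * h ^+ 2.
Proof.
move=> hc hC h hr.
have [th h1 ->] := scurve_MVT t (t + h) hc.
rewrite (_ : t + h - t = h); last by ring.
have [th' h2] := scurve_MVT t (t + th * h) (scurve_derive hc).
rewrite (_ : t + th * h - t = th * h); last by ring.
set D := c^`() (t + _); set D' := c^`() t => E.
rewrite mulrC -mulrBr E normrM normrM.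
have C0 : 0 <= C by apply: le_trans (hC t _); rewrite // subrr normr0; exact: le_lt_trans hr.
have hth : `|th * h| <= `|h|.
  by case/andP: h1 => t0 t1; rewrite normrM ger0_norm // ler_piMl.
rewrite -real_normK ?num_real // (_ : C * _ = `|h| * (C * `|h|)); last by ring.
apply: ler_wpM2l => //; apply: ler_pM => //.
apply: hC; apply: le_lt_trans hr; rewrite addrC addKr.
case/andP: h2 => t0 t1; rewrite normrM ger0_norm //.
by apply: le_trans hth; rewrite ler_piMl.
Qed.

Definition locally_bounded_derivatives (f : nat -> R -> R) : Prop :=
  forall (m : nat) t0, exists2 r : R, 0 < r & exists C : R,
    \forall N \near \oo, forall t, `|t - t0| < r -> `|(f N)^`(m) t| <= C.

(** The Taylor bound is uniform in N. A difference quotient with fixed step h converges as N grows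
    and is within C h of the derivative, so the derivatives at t form a Cauchy sequence; the Taylor
    bound then passes to the limit and shows that g is differentiable. *)
Lemma limit_der (f : nat -> R -> R) g :
  (forall N, scurve (f N)) -> (forall t, f ^~ t @ \oo --> g t) ->
  locally_bounded_derivatives f ->
  exists2 d : R -> R, forall t, (fun N => (f N)^`() t) @ \oo --> d t & forall t, der g t (d t).
Proof.
move=> sf fg fB.
have taylor t : exists2 r : R, 0 < r & exists2 C : R, 0 <= C & \forall N \near \oo, forall h, `|h| < r ->
    `|f N (t + h) - f N t - h * (f N)^`() t| <= C * h ^+ 2.
  have [r r0 [C hC]] := fB 2 t; exists r => //; exists C.
    have [N hN] := @filter_ex _ _ _ _ hC.
    by apply: le_trans (hN t _); rewrite // subrr normr0.
  by apply: filterS hC => N hN h hr; exact: scurve_taylor hr.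
suff cv t : cvgn (fun N => (f N)^`() t).
  exists (fun t => limn (fun N => (f N)^`() t)) => // t.
  have [r r0 [C C0 hC]] := taylor t.
  set d := limn _; have hd : (fun N => (f N)^`() t) @ \oo --> d by exact: cv.
  have T h : `|h| < r -> `|g (t + h) - g t - h * d| <= C * h ^+ 2.
    move=> hr; apply: (@lim_norm_le _ \oo _ (fun N => f N (t + h) - f N t - h * (f N)^`() t)).
      by apply: cvgB; [apply: cvgB; exact: fg|apply: cvgMr].
    by apply: filterS hC => N; apply.
  apply/der_cvgP/cvgrPdist_le => e e0.
  have hh : \forall h \near (0 : R), `|h| < r /\ `|h| <= e / (C + 1).
    near=> h; split; near: h; first exact: (@nbhs0_lt _ R).
    by apply: (@nbhs0_le _ R); rewrite divr_gt0 // ltr_wpDl.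
  near=> h; have h0 : h != 0 by near: h; exact: nbhs_dnbhs_neq.
  have [hr he] : `|h| < r /\ `|h| <= e / (C + 1) by near: h; exact: cvg_within hh.
  rewrite (_ : d - _ = - (h^-1 * (g (t + h) - g t - h * d))).
    rewrite normrN normrM normfV ler_pdivrMl ?normr_gt0 //.
    apply: le_trans (T _ hr) _.
    rewrite -real_normK ?num_real // expr2 mulrCA ler_pM2l ?normr_gt0 //.
    apply: le_trans (ler_wpM2l C0 he) _.
    by rewrite mulrA ler_pdivrMr ?ltr_wpDl // mulrDr mulr1 mulrC lerDl ltW.
  rewrite (addrC h t) (_ : h^-1 *: _ = h^-1 * (g (t + h) - g t)) //; by field.
have [r r0 [C C0 hC]] := taylor t.
apply: cauchy_cvg; apply: cauchy_exP => e e0.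
(* C may be 0, hence C + 1. This gives C * h < e / 2 and leaves e / 2 for the convergence of the
   difference quotient. *)
pose h := Num.min (r / 2) (e / 2 / (C + 1)).
have h0 : 0 < h by rewrite lt_min !divr_gt0 // ltr_wpDl.
have hr : `|h| < r.
  rewrite gtr0_norm // (le_lt_trans (_ : _ <= r / 2)) //; first by rewrite ge_min lexx.
  by lra.
have Ch : C * h < e / 2 + 0.
  rewrite addr0; apply: (@le_lt_trans _ _ (C * (e / 2 / (C + 1)))).
    by apply: ler_wpM2l => //; rewrite ge_min lexx orbT.
  rewrite mulrA ltr_pdivrMr ?ltr_wpDl // mulrDr mulr1 mulrC ltrDl.
  by rewrite divr_gt0.
exists (h^-1 * (g (t + h) - g t)).
have q : (fun N => h^-1 * (f N (t + h) - f N t)) @ \oo --> h^-1 * (g (t + h) - g t).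
  by apply: cvgMr; apply: cvgB; exact: fg.
have e2 : 0 < e / 2 by rewrite divr_gt0.
have /cvgrPdist_lt /(_ _ e2) q' := q.
rewrite /nbhs /=; apply: filterS2 q' hC => N q1 /(_ _ hr) q2.
have q3 : `|h^-1 * (f N (t + h) - f N t) - (f N)^`() t| <= C * h.
  rewrite (_ : _ - _ = h^-1 * (f N (t + h) - f N t - h * (f N)^`() t)).
    rewrite normrM normfV ler_pdivrMl ?normr_gt0 ?gt_eqF // (gtr0_norm h0).
    by rewrite mulrCA -expr2.
  by field; rewrite gt_eqF.
rewrite /ball /= (le_lt_trans (ler_distD (h^-1 * (f N (t + h) - f N t)) _ _)) //.
by move: q1 q3 Ch; lra.
Unshelve. all: by end_near. Qed.

Lemma limit_scurve (f : nat -> R -> R) g :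
  (forall N, scurve (f N)) -> (forall t, f ^~ t @ \oo --> g t) ->
  locally_bounded_derivatives f ->
  scurve g /\ forall m t, (fun N => (f N)^`(m) t) @ \oo --> g^`(m) t.
Proof.
move=> sf fg fB; split.
  (* By [limit_der], the class of limits of such sequences is closed under differentiation. *)
  pose P g := exists f : nat -> R -> R, [/\ forall N, scurve (f N),
     forall t, f ^~ t @ \oo --> g t & locally_bounded_derivatives f].
  apply: (@scurve_coind _ _ P); last by exists f.
  move=> {sf fg fB}{}g [{}f [sf fg fB]]; have [d hd dg] := limit_der sf fg fB.
  split; first by move=> t; exact: der_derivable (dg t).
  exists (fun N => (f N)^`()); split.
  - by move=> N; exact: scurve_derive.
  - by move=> t; rewrite (der_derive1 (dg t)).
  - move=> m t; have [r r0 [C hC]] := fB m.+1 t; exists r => //; exists C.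
    by apply: filterS hC => N; rewrite derive1Sn.
move=> m; elim: m f g sf fg fB => [|m IH] f g sf fg fB t; first exact: fg.
have [d hd dg] := limit_der sf fg fB.
rewrite derive1Sn (_ : (fun N => _) = (fun N => (f N)^`()^`(m) t)); last first.
  by apply/funext => N; rewrite derive1Sn.
apply: (IH (fun N => (f N)^`())).
- by move=> N; exact: scurve_derive.
- by move=> u; rewrite (der_derive1 (dg u)).
- move=> k u; have [r r0 [C hC]] := fB k.+1 u; exists r => //; exists C.
  by apply: filterS hC => N; rewrite derive1Sn.
Qed.

Lemma derive_n_near V k (c c' : R -> (V : normedModType R)) t :
  (\near t, c t = c' t) -> c^`(k) t = c'^`(k) t.
Proof.
elim: k c c' => [|k IH] c c' cc'; first exact: nbhs_singleton cc'.
rewrite !derive1Sn; apply: IH; have := near_join cc'; apply: filterS => u nu.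
by rewrite !derive1E; exact: near_eq_derive.
Qed.

Lemma derive_n_comp_affine V k (c : R -> (V : normedModType R)) (p q t : R) : scurve c ->
  (fun t => c (p * t + q))^`(k) t = p ^+ k *: c^`(k) (p * t + q).
Proof.
elim: k c t => [|k IH] c t sc; first by rewrite expr0 scale1r.
rewrite derive1Sn.
have -> : (fun t => c (p * t + q))^`() = (fun t => (fun t => p *: c^`() t) (p * t + q)).
  apply/funext => u; apply: der_derive1.
  apply: (@der_comp _ _ c (fun t => p * t + q)); last exact: scurve_der.
  rewrite -[p in der _ _ p]addr0 -[X in der _ _ (X + _)](_ : 0 * u + p * 1 = p).
    apply: der_add; last exact: der_cst.
    by apply: der_mul; [exact: der_cst|exact: der_id].
  by rewrite mul0r add0r mulr1.
have sc' := scurve_derive sc.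
rewrite (IH (fun t => p *: c^`() t)); last by apply: scurve_scale => //; exact: scurve_cst.
rewrite exprSr -scalerA; congr (_ *: _).
suff E : forall c : R -> V, scurve c -> (fun t => p *: c t)^`(k) = (fun t => p *: c^`(k) t).
  by rewrite (E c^`()) // derive1Sn.
elim: k {IH} => // k IH d sd; rewrite !derive1Sn.
rewrite -IH; last exact: scurve_derive.
congr derive1n; apply/funext => u; apply: der_derive1.
by have := der_scale (der_cst p u) (scurve_der u sd); rewrite scale0r add0r.
Qed.

Lemma derive_n_sum k (I : Type) (r : seq I) (c : I -> R -> R) : (forall i, scurve (c i)) ->
  (fun t => \sum_(i <- r) c i t)^`(k) = (fun t => \sum_(i <- r) (c i)^`(k) t).
Proof.
elim: k c => // k IH c sc; rewrite derive1Sn.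
have -> : (fun t => \sum_(i <- r) c i t)^`() = (fun t => \sum_(i <- r) (c i)^`() t).
  apply/funext => t; apply: der_derive1.
  elim: r {IH} => [|i r IH].
    by rewrite (_ : (fun t => _) = fun=> 0) ?big_nil; [exact: der_cst|apply/funext => u; rewrite big_nil].
  rewrite (_ : (fun t => _) = (fun t => c i t + \sum_(i <- r) c i t)); last first.
    by apply/funext => u; rewrite big_cons.
  by rewrite big_cons; apply: der_add => //; exact: scurve_der.
rewrite IH; last by move=> i; exact: scurve_derive.
by apply/funext => t; apply: eq_bigr => i _; rewrite derive1Sn.
Qed.

Lemma derive_n_scale k (p : R) (c : R -> R) : scurve c ->
  (fun t => p * c t)^`(k) = (fun t => p * c^`(k) t).
Proof.
elim: k c => // k IH d sd; rewrite !derive1Sn -IH; last exact: scurve_derive.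
congr derive1n; apply/funext => u; apply: der_derive1.
by have := der_mul (der_cst p u) (scurve_der u sd); rewrite mul0r add0r.
Qed.

Lemma derive_n_sub k (c d : R -> R) : scurve c -> scurve d ->
  (fun t => c t - d t)^`(k) = (fun t => c^`(k) t - d^`(k) t).
Proof.
elim: k c d => // k IH c d sc sd; rewrite !derive1Sn -IH; try exact: scurve_derive.
congr derive1n; apply/funext => u; apply: der_derive1.
by apply: der_add; [exact: scurve_der|apply: der_opp; exact: scurve_der].
Qed.

Lemma bounded_derivatives c : scurve c -> (forall s, 1 / 4 < `|s| -> c s = 0) ->
  forall m, exists2 C : R, 0 <= C & forall t, `|c^`(m) t| <= C.
Proof.
move=> sc c0 m.
have {}c0 : forall s, 1 / 4 < `|s| -> c^`(m) s = 0.
  move=> s hs; rewrite (@derive_n_near _ m c (fun=> 0)).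
    suff -> : (fun=> 0 : R)^`(m) = (fun=> 0) :> (R -> R) by [].
    elim: m => // m IH; rewrite derive1nS IH; apply/funext => u.
    exact: der_derive1 (der_cst _ _).
  have op : open [set x : R | 1 / 4 < `|x|].
    by have := @open_comp _ _ (fun x : R => `|x|) [set x | 1/4 < x]; apply;
      [move=> x _; exact: norm_continuous|exact: open_gt].
  have : nbhs s [set x : R | 1 / 4 < `|x|] by exact: open_nbhs_nbhs.
  by apply: filterS => x hx; exact: c0.
have cc : continuous (fun x => `|c^`(m) x|).
  move=> x; apply: continuous_comp; last exact: norm_continuous.
  exact: scurve_continuous (scurve_derive_n m sc) x.
have [//|x _ hx] := @EVT_max R (fun x => `|c^`(m) x|) (-1) 1 _ (continuous_subspaceT cc).
exists `|c^`(m) x| => // t; have [ht|ht] := lerP `|t| 1.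
  by apply: hx; rewrite in_itv/= -ler_norml.
by rewrite c0 ?normr0 //; lra.
Qed.

End RealCurves.

(** * Mixed differences and Kemperman's identity *)

Section SpecialCurve.
Local Open Scope ring_scope.
Local Open Scope classical_set_scope.
Context {R : realType}.
Implicit Types (t : R).

(** Smaller than every power of 2^-k: differentiating the k-th copy in [special_sum] m times costs a
    factor (2^k)^m. *)
Definition rho (k : nat) : R := 2^-1 ^+ (k * k).

Lemma rho_gt0 k : 0 < rho k.
Proof. by rewrite exprn_gt0 // invr_gt0. Qed.

(** On exponents this is k (m + 1) <= k^2 + (m + 1)^2. *)
Lemma rho_le m k : (2 ^+ k) ^+ m * rho k <= 2 ^+ (m.+1 * m.+1) * 2^-1 ^+ k.
Proof.
have p2 j : 0 < 2 ^+ j :> R by rewrite exprn_gt0.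
rewrite /rho !exprVn -exprM ler_pdivrMr // mulrAC ler_pdivlMr // -!exprD.
rewrite ler_weXn2l ?ler1n //; nia.
Qed.

Lemma sum_halves N : \sum_(k < N) 2^-1 ^+ k <= 2 :> R.
Proof.
suff -> : \sum_(k < N) 2^-1 ^+ k = 2 - 2 * 2^-1 ^+ N :> R.
  by rewrite gerBl mulr_ge0 // exprn_ge0 // invr_ge0.
elim: N => [|N IH]; first by rewrite big_ord0 expr0 mulr1 subrr.
by rewrite big_ord_recr /= IH exprS; field.
Qed.

(** One coordinate of the curve through infinitely many prescribed pieces. The copies a_k gam (2^k t
    - 1) have disjoint supports that accumulate only at 0, and |a_k| <= rho k bounds every
    derivative of the partial sums uniformly, so the sum is smooth across 0 too. *)
Lemma special_sum (gam : R -> R) (a : nat -> R) :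
  scurve gam -> (forall s, 1 / 4 < `|s| -> gam s = 0) -> (forall k, `|a k| <= rho k) ->
  exists2 g : R -> R, scurve g &
    forall t j, `|2 ^+ j * t - 1| <= 1 / 4 -> g t = a j * gam (2 ^+ j * t - 1).
Proof.
move=> sg g0 ha.
pose f N t := \sum_(k < N) a k * gam (2 ^+ k * t - 1).
have p2 j : 0 < 2 ^+ j :> R by rewrite exprn_gt0.
(* At each t the partial sums are eventually constant, so pointwise convergence is immediate. *)
have fN t N0 N : (N0 <= N)%N -> (forall k, (N0 <= k)%N -> gam (2 ^+ k * t - 1) = 0) ->
    f N t = f N0 t.
  move=> NN h; rewrite -(subnKC NN); elim: (N - N0)%N => [|d IH]; first by rewrite addn0.
  by rewrite addnS /f big_ord_recr /= -/(f _ t) IH h ?mulr0 ?addr0 // leq_addr.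
have ev t : exists N0 : nat, forall k, (N0 <= k)%N -> gam (2 ^+ k * t - 1) = 0.
  have [t0|t0] := lerP t 0.
    exists 0%N => k _; apply: g0.
    have : 2 ^+ k * t <= 0 by rewrite pmulr_rle0.
    by move=> h; rewrite ler0_norm; lra.
  exists (Num.bound (2 / t)) => k hk; apply: g0.
  have h : 2 <= 2 ^+ k * t.
    rewrite -ler_pdivrMr //; apply: le_trans (_ : k%:R <= _).
      apply: le_trans (ltW (archi_boundP _)) _; first by rewrite divr_ge0 // ltW.
      by rewrite ler_nat.
    by rewrite -natrX ler_nat ltnW // ltn_expl.
  by rewrite ger0_norm; lra.
have fcv t : exists l : R, f ^~ t @ \oo --> l.
  have [N0 hN] := ev t; exists (f N0 t); apply: cvg_near_cst.
  by exists N0 => // N /= NN; exact: fN.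
have [g hg] := choice fcv.
have sf N : scurve (f N).
  apply: scurve_sum => k; apply: scurve_mul; first exact: scurve_cst.
  apply: (@scurve_comp _ _ gam (fun t => 2 ^+ k * t - 1)) => //.
  apply: scurve_sub; last exact: scurve_cst.
  by apply: scurve_mul; [exact: scurve_cst|exact: scurve_id].
exists g.
  have [] // := @limit_scurve R f g sf hg.
  move=> m t0; exists 1 => //.
  have [C C0 hC] := bounded_derivatives sg g0 m.
  exists (C * 2 ^+ (m.+1 * m.+1) * 2); near=> N => t _.
  rewrite derive_n_sum; last first.
    move=> k; apply: scurve_mul; first exact: scurve_cst.
    apply: (@scurve_comp _ _ gam (fun t => 2 ^+ k * t - 1)) => //.
    apply: scurve_sub; last exact: scurve_cst.
    by apply: scurve_mul; [exact: scurve_cst|exact: scurve_id].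
  apply: le_trans (ler_norm_sum _ _ _) _.
  apply: (@le_trans _ _ (\sum_(k < N) C * 2 ^+ (m.+1 * m.+1) * 2^-1 ^+ k)).
    apply: ler_sum => k _; rewrite derive_n_scale; last first.
      apply: (@scurve_comp _ _ gam (fun t => 2 ^+ k * t - 1)) => //.
      apply: scurve_sub; last exact: scurve_cst.
      by apply: scurve_mul; [exact: scurve_cst|exact: scurve_id].
    rewrite (derive_n_comp_affine m (2 ^+ k) (-1) t sg) !normrM.
    rewrite [`|(2 ^+ k) ^+ m|]ger0_norm; last by rewrite exprn_ge0 // ltW.
    apply: (@le_trans _ _ (rho k * ((2 ^+ k) ^+ m * C))).
      apply: ler_pM => //.
      by apply: ler_wpM2l => //; rewrite exprn_ge0 // ltW.
    rewrite (_ : rho k * _ = C * ((2 ^+ k) ^+ m * rho k)); last by ring.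
    by rewrite -mulrA; apply: ler_wpM2l => //; exact: rho_le.
  rewrite -mulr_sumr; apply: ler_wpM2l (sum_halves N).
  by rewrite mulr_ge0 // exprn_ge0.
(* Doubling or halving a number of [3/4, 5/4] leaves this interval, so all copies other than the
   j-th vanish at t. *)
move=> t j hj; have hjt : 3 / 4 <= 2 ^+ j * t <= 5 / 4.
  by move: hj; rewrite ler_norml => /andP[h1 h2]; apply/andP; split; lra.
have t0 : 0 < t by rewrite -(pmulr_rgt0 _ (p2 j)); case/andP: hjt; lra.
have other k : k != j -> gam (2 ^+ k * t - 1) = 0.
  move=> kj; apply: g0; case/andP: hjt => h1 h2.
  have [kj'|kj'] := leqP k j.
    have {}kj' : (k < j)%N by rewrite ltn_neqAle kj.
    have : 2 ^+ k * t * 2 <= 2 ^+ j * t.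
      by rewrite mulrAC -exprSr ler_pM2r // ler_weXn2l ?ler1n.
    by move=> h; rewrite ler0_norm; lra.
  have : 2 ^+ j * t * 2 <= 2 ^+ k * t.
    by rewrite mulrAC -exprSr ler_pM2r // ler_weXn2l ?ler1n.
  by move=> h; rewrite ger0_norm; lra.
have cj : f ^~ t @ \oo --> a j * gam (2 ^+ j * t - 1).
  apply: cvg_near_cst; exists j.+1 => // N /= jN.
  rewrite /f (bigD1 (Ordinal jN)) //= big1 ?addr0 // => i ij.
  by rewrite other ?mulr0 //; apply: contraNneq ij => ij; apply/eqP/val_inj.
exact: (cvg_unique _ (hg t) cj).
Unshelve. all: by end_near. Qed.

End SpecialCurve.

Section Differences.
Local Open Scope ring_scope.
Local Open Scope classical_set_scope.

(** The iterated forward difference of f at x with the steps listed in l. *)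
Fixpoint md (R : realType) (E : zmodType) (l : seq E) (f : E -> R) (x : E) : R :=
  if l is v :: l' then md l' f (x + v) - md l' f x else f x.

Context {R : realType}.

Lemma md0 (E : zmodType) (l : seq E) (f : E -> R) x : 0 \in l -> md l f x = 0.
Proof.
elim: l x => // v l IH x; rewrite inE => /orP[/eqP<-|h] /=; first by rewrite addr0 subrr.
by rewrite !IH // subrr.
Qed.

Lemma md_sub (E : zmodType) (l : seq E) (f g : E -> R) x :
  md l (fun x => f x - g x) x = md l f x - md l g x.
Proof. by elim: l x => //= v l IH x; rewrite !IH; ring. Qed.

Lemma md_shift (E : zmodType) (l : seq E) (f : E -> R) x v :
  md l (fun x => f (x + v)) x = md l f (x + v).
Proof. by elim: l x => //= w l IH x; rewrite !IH addrAC. Qed.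

(** The binomial expansion. The coefficients stay abstract except for r = 0, the only term that
    survives in [md_kempe]. *)
Lemma md_nseq_expand (E : lmodType R) m : exists2 c : nat -> R, c 0%N = (-1) ^+ m &
  forall (f : E -> R) a x,
    md (nseq m a) f x = \sum_(r < m.+1) c r * f (x + r%:R *: a).
Proof.
elim: m => [|m [c c0 hc]].
  exists (fun=> 1) => // f a x.
  by rewrite big_ord_recl big_ord0 /= mul1r scale0r !addr0.
exists (fun r => (if r is r'.+1 then c r' else 0) - (if (r <= m)%N then c r else 0)).
  by rewrite sub0r /= c0 exprS mulN1r.
move=> f a x /=; rewrite !hc.
under [RHS]eq_bigr do rewrite mulrBl.
rewrite sumrB; congr (_ - _).
  rewrite [RHS]big_ord_recl /= mul0r add0r; apply: eq_bigr => i _.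
  rewrite /bump /= add1n; congr (_ * f _).
  by rewrite -addrA -[in RHS]natr1 scalerDl scale1r [a + _]addrC.
rewrite [RHS]big_ord_recr /= ltnn mul0r addr0; apply: eq_bigr => i _.
by rewrite -ltnS ltn_ord.
Qed.

Section Kemperman.
Variables (E : lmodType R) (f : E -> R) (x : E).

(** A signed sum over the subsets of l: a chosen step v at position j shifts the base point by v and
    the common step of the pure m-fold difference by -v/j. *)
Fixpoint kempe (m : nat) (l : seq E) (j : nat) (a b : E) : R :=
  if l is v :: l' then kempe m l' j.+1 a b - kempe m l' j.+1 (a - j%:R^-1 *: v) (b + v)
  else md (nseq m a) f (x + b).

(** [kempe] with the pure difference replaced by its r-th evaluation point. A chosen v then moves
    this point by (1 - r/j) v in total, which is the origin of [rescale]. *)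
Fixpoint kempe_term (r : nat) (l : seq E) (j : nat) (a b : E) : R :=
  if l is v :: l' then
    kempe_term r l' j.+1 a b - kempe_term r l' j.+1 (a - j%:R^-1 *: v) (b + v)
  else f (x + b + r%:R *: a).

Fixpoint rescale (r : nat) (l : seq E) (j : nat) : seq E :=
  if l is v :: l' then (1 - r%:R / j%:R) *: v :: rescale r l' j.+1 else [::].

Lemma kempe_termE r l j a b :
  kempe_term r l j a b = (-1) ^+ size l * md (rescale r l j) f (x + b + r%:R *: a).
Proof.
elim: l j a b => [|v l IH] j a b /=; first by rewrite expr0 mul1r.
rewrite !IH exprS.
rewrite (_ : x + (b + v) + r%:R *: (a - j%:R^-1 *: v) =
  x + b + r%:R *: a + (1 - r%:R / j%:R) *: v); first by ring.
rewrite scalerBr scalerBl scale1r scalerA !addrA; congr (_ - _).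
by rewrite -!addrA; congr (_ + (_ + _)); rewrite addrC.
Qed.

Lemma kempe_expand m (c : nat -> R) :
  (forall (f : E -> R) a x, md (nseq m a) f x = \sum_(r < m.+1) c r * f (x + r%:R *: a)) ->
  forall l j a b, kempe m l j a b = \sum_(r < m.+1) c r * kempe_term r l j a b.
Proof.
move=> hc; elim=> [|v l IH] j a b /=; first by rewrite hc.
by rewrite !IH -sumrB; apply: eq_bigr => i _; rewrite mulrBr.
Qed.

Lemma rescale0 l j : rescale 0 l j = l.
Proof. by elim: l j => //= v l IH j; rewrite IH mul0r subr0 scale1r. Qed.

Lemma mem_rescale r l j : (0 < j)%N -> (j <= r < j + size l)%N -> 0 \in rescale r l j.
Proof.
elim: l j => [|v l IH] j j0 /=; first by rewrite addn0 leqNgt => /andP[/negP].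
move=> /andP[jr rj]; have [<-|rj'] := eqVneq j r.
  by rewrite divff ?subrr ?scale0r ?inE ?eqxx // pnatr_eq0 -lt0n.
by rewrite inE IH ?orbT // ltn_neqAle rj' jr /= addSn -addnS.
Qed.

(* Kemperman's identity: the r-th term of the expansion of [kempe] is a mixed
   difference whose r-th step is 0, so only r = 0 contributes. *)
Lemma md_kempe l : md l f x = kempe (size l) l 1 0 0.
Proof.
have [c c0 hc] := md_nseq_expand E (size l).
rewrite (kempe_expand hc) big_ord_recl big1 ?addr0 => [|i _].
  rewrite kempe_termE /= rescale0 c0 scaler0 !addr0 mulrA -exprMn mulrNN mulr1.
  by rewrite expr1n mul1r.
rewrite kempe_termE md0 ?mulr0 //; apply: mem_rescale => //=.
by rewrite /bump /= add1n ltnS ltn_ord.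
Qed.

End Kemperman.

(** Induction on p, applied to u -> g (u + h) - g u; each difference adds at most one step h to the
    position of the intermediate point. *)
Lemma md_nseq_mean p (g : R -> R) t h : scurve g ->
  exists2 th : R, 0 <= th <= 1 & md (nseq p h) g t = h ^+ p * g^`(p) (t + th * (p%:R * h)).
Proof.
elim: p g t => [|p IH] g t sg.
  by exists 0; rewrite ?lexx ?ler01 // expr0 mul1r mul0r addr0.
have sgh : scurve (fun u => g (u + h)).
  apply: (@scurve_comp _ _ g (fun u => u + h)) => //.
  by apply: scurve_add; [exact: scurve_id|exact: scurve_cst].
have -> : md (nseq p.+1 h) g t = md (nseq p h) (fun u => g (u + h) - g u) t.
  by rewrite md_sub md_shift.
have [th /andP[th0 th1] ->] := IH _ t (scurve_sub sgh sg).
rewrite derive_n_sub //; set s := t + _.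
have -> : (fun u => g (u + h))^`(p) s = g^`(p) (s + h).
  have := derive_n_comp_affine p 1 h s sg; rewrite expr1n scale1r mul1r => <-.
  by congr derive1n; apply/funext => u; rewrite mul1r.
have [th' /andP[th'0 th'1]] := scurve_MVT s (s + h) (scurve_derive_n p sg).
rewrite (_ : s + h - s = h); last by ring.
move=> ->; rewrite -derive1nS.
have p0 : 0 < p.+1%:R :> R by rewrite ltr0n.
exists ((th * p%:R + th') / p.+1%:R).
  apply/andP; split; first by rewrite divr_ge0 ?addr_ge0 ?mulr_ge0 // ltW.
  by rewrite ler_pdivrMr // mul1r -natr1 lerD // ler_piMl.
rewrite exprSr -mulrA [h * _]mulrC; congr (_ * (g^`(_) _ * _)).
by rewrite /s -addrA; congr (_ + _); field; rewrite gt_eqF.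
Qed.

End Differences.

(** * Functions that are smooth along smooth curves *)

Section Boman.
Local Open Scope ring_scope.
Local Open Scope classical_set_scope.
Context {R : realType} {n : nat}.
Local Notation E := 'rV[R]_n.
Implicit Types (f g : E -> R) (x y u v : E).

Lemma row_delta_sum (x : E) : x = \sum_i x 0 i *: delta_mx 0 i.
Proof. by rewrite {1}[x]row_sum_delta. Qed.

Lemma scurve_coord_row (c : R -> E) : (forall i, scurve (fun t => c t 0 i)) -> scurve c.
Proof.
move=> h; rewrite (_ : c = fun t => \sum_i c t 0 i *: delta_mx 0 i).
  by apply: scurve_sum => i; apply: scurve_scale => //; exact: scurve_cst.
by apply/funext => t; exact: row_delta_sum.
Qed.

Lemma near_normP (V : normedModType R) (x : V) (P : set V) :
  nbhs x P <-> exists2 d : R, 0 < d & forall y : V, `|y - x| < d -> P y.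
Proof.
split=> [/nbhs_ballP[d d0 dP]|[d d0 dP]].
  by exists d => // y yd; apply: dP; rewrite -ball_normE /= distrC.
by apply/nbhs_ballP; exists d => // y; rewrite -ball_normE /= distrC; exact: dP.
Qed.

Lemma continuous_normP (V V' : normedModType R) (f : V -> V') (x : V) :
  (forall e : R, 0 < e ->
    exists2 d : R, 0 < d & forall y : V, `|y - x| < d -> `|f y - f x| <= e) <->
  {for x, continuous f}.
Proof.
split=> [h|cf e e0].
  apply/(@cvgrPdist_le _ _ _ _ (nbhs_filter x)) => e e0; have [d d0 dP] := h e e0.
  by apply/near_normP; exists d => // y yd; rewrite distrC; exact: dP.
have /(@cvgrPdist_le _ _ _ _ (nbhs_filter x))/(_ _ e0)/near_normP[d d0 dP] := cf.
by exists d => // y yd; rewrite distrC; exact: dP.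
Qed.

Lemma coord_norm_le (x : E) i : `|x 0 i| <= `|x|.
Proof.
rewrite /Num.norm /= mx_normrE.
exact: (le_bigmax (0 : R) (fun ij : 'I_1 * 'I_n => `|x ij.1 ij.2|) (0, i)).
Qed.

Lemma row_norm_le (x : E) (r : R) : 0 <= r -> (forall i, `|x 0 i| <= r) -> `|x| <= r.
Proof.
move=> r0 h; rewrite /Num.norm /= mx_normrE; apply: bigmax_le => // -[i j] _ /=.
by rewrite ord1.
Qed.

Definition dline (p : nat) v f x : R := (fun t : R => f (x + t *: v))^`(p) 0.

Definition smooth_lines f : Prop := forall x v, scurve (fun t : R => f (x + t *: v)).

(** The class on which Boman's argument runs. It is closed under directional derivatives
    ([line_bounded_dline]) and its members are continuous, so they have continuous partial
    derivatives of all orders. *)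
Definition line_bounded f : Prop :=
  smooth_lines f /\
  forall x p, exists2 r : R, 0 < r & exists C : R,
    forall y v, `|y - x| < r -> `|v| <= 1 -> `|dline p v f y| <= C.

Lemma dlineE p v f x (t : R) : smooth_lines f ->
  (fun t : R => f (x + t *: v))^`(p) t = dline p v f (x + t *: v).
Proof.
move=> sf; have := derive_n_comp_affine p 1 t 0 (sf x v).
rewrite expr1n scale1r mulr0 add0r => <-; congr (derive1n p _ 0).
by apply/funext => s; rewrite mul1r scalerDl -addrA [_ *: v + _]addrC.
Qed.

Lemma md_line p (h t : R) v f x :
  md (nseq p h) (fun s : R => f (x + s *: v)) t = md (nseq p (h *: v)) f (x + t *: v).
Proof. by elim: p t => //= p IH t; rewrite !IH scalerDl addrA. Qed.

Lemma md_dline p (h : R) v f x : smooth_lines f ->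
  exists2 th : R, 0 <= th <= 1 &
    md (nseq p (h *: v)) f x = h ^+ p * dline p v f (x + (th * (p%:R * h)) *: v).
Proof.
move=> sf; have [th h1 h2] := md_nseq_mean p 0 h (sf x v); exists th => //.
by move: h2; rewrite md_line scale0r addr0 dlineE // add0r.
Qed.

Lemma unit_decomp (a : E) : exists2 v : E, `|v| <= 1 & a = `|a| *: v.
Proof.
have [->|a0] := eqVneq a 0; first by exists 0; rewrite ?normr0 ?scaler0 ?ler01.
have na : `|a| != 0 by rewrite normr_eq0.
exists (`|a|^-1 *: a); last by rewrite scalerA divff // scale1r.
by rewrite normrZ normfV normr_id mulVf.
Qed.

(** There are 2^(size l) terms. Every step changes [a] and [b] by at most k, because 1/j <= 1, so
    both remain of norm at most A. *)
Lemma kempe_bound f x (k B A : R) m l j a b :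
  (0 < j)%N -> (forall v, v \in l -> `|v| <= k) ->
  `|a| + (size l)%:R * k <= A -> `|b| + (size l)%:R * k <= A ->
  (forall a b : E, `|a| <= A -> `|b| <= A -> `|md (nseq m a) f (x + b)| <= B) ->
  `|kempe f x m l j a b| <= 2 ^+ size l * B.
Proof.
move=> j0 + + + hB; elim: l j j0 a b => [|v l IH] j j0 a b hl ha hb /=.
  by rewrite expr0 mul1r; apply: hB; move: ha hb; rewrite /= !mul0r !addr0.
have hv : `|v| <= k by apply: hl; rewrite inE eqxx.
have hl' w : w \in l -> `|w| <= k by move=> wl; apply: hl; rewrite inE wl orbT.
have k0 : 0 <= k by apply: le_trans hv.
move: ha hb; rewrite /= -natr1 mulrDl mul1r => ha hb.
have jv : `|j%:R^-1 *: v| <= k.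
  rewrite normrZ; apply: le_trans hv; rewrite ler_piMl // normfV normr_nat invf_le1 ?ltr0n //.
  by rewrite ler1n.
rewrite exprS (_ : 2 * _ * B = 2 ^+ size l * B + 2 ^+ size l * B); last by ring.
apply: le_trans (ler_normB _ _) _; apply: lerD; apply: IH => //.
- by apply: le_trans ha; lra.
- by apply: le_trans hb; lra.
- have := ler_normB a (j%:R^-1 *: v); lra.
- have := ler_normD b v; lra.
Qed.

(** By Kemperman's identity a mixed difference is a sum of 2^m pure m-fold differences with steps of
    norm at most m k, and each of these is governed by a line derivative of order m. *)
Lemma md_bound f x0 m : line_bounded f ->
  exists2 r : R, 0 < r & exists2 C : R, 0 <= C & forall y (l : seq E) (k : R),
    `|y - x0| < r -> size l = m -> (forall v, v \in l -> `|v| <= k) -> 0 <= k <= r ->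
    `|md l f y| <= C * k ^+ m.
Proof.
move=> [sf /(_ x0 m) [r0 r00 [C0 hC]]].
have C00 : 0 <= C0 by apply: le_trans (hC x0 0 _ _); rewrite ?subrr ?normr0 ?ler01.
pose M : R := m%:R; have M0 : 0 <= M by [].
have D0 : 0 < 1 + M + M * M by rewrite -addrA ltr_pwDl // addr_ge0 // mulr_ge0.
(* The intermediate point of [md_dline] is displaced from y by at most M k through [b] and M (M k)
   along the line; together with the distance of y from x0 this must stay below r0. *)
exists (r0 / (1 + M + M * M)); first by rewrite divr_gt0.
exists (2 ^+ m * (M ^+ m * C0)).
  by rewrite mulr_ge0 ?exprn_ge0 // mulr_ge0 ?exprn_ge0.
move=> y l k yr sl hl /andP[k0 kr].
rewrite md_kempe sl -mulrA.
rewrite (_ : M ^+ m * C0 * k ^+ m = (M * k) ^+ m * C0); last by rewrite exprMn; ring.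
rewrite -{2}sl; apply: (@kempe_bound _ _ k _ (M * k)) => //.
- by rewrite normr0 add0r sl.
- by rewrite normr0 add0r sl.
move=> a b ha hb.
have [v hv av] := unit_decomp a.
rewrite av; have [th /andP[th0 th1] ->] := md_dline m `|a| v (y + b) sf.
rewrite normrM normrX normr_id; apply: ler_pM => //.
  by apply: lerXn2r; rewrite ?nnegrE // mulr_ge0.
apply: hC => //.
have h1 : `|(th * (m%:R * `|a|)) *: v| <= M * (M * k).
  rewrite normrZ -[leRHS]mulr1; apply: ler_pM => //.
  rewrite ger0_norm; last by rewrite mulr_ge0 // mulr_ge0.
  rewrite -[leRHS]mul1r; apply: ler_pM => //.
  by apply: ler_wpM2l.
have : k * (1 + M + M * M) <= r0 by rewrite -ler_pdivlMr.
have : `|y - x0| * (1 + M + M * M) < r0 by rewrite -ltr_pdivlMr.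
rewrite (_ : y + b + _ - x0 = (y - x0) + b + (th * (m%:R * `|a|)) *: v); last first.
  by rewrite addrAC; congr (_ + _); rewrite addrAC.
move: (ler_normD (y - x0 + b) ((th * (m%:R * `|a|)) *: v)) (ler_normD (y - x0) b) yr kr h1 hb.
rewrite !ltr_pdivlMr // !ler_pdivlMr //.
have := normr_ge0 (y - x0); set d := `|y - x0| => d0.
have : 0 <= d * M + d * (M * M) by rewrite addr_ge0 // mulr_ge0 // mulr_ge0.
have : 0 <= M * k by rewrite mulr_ge0.
have : 0 <= M * (M * k) by rewrite mulr_ge0 // mulr_ge0.
rewrite !mulrDr !mulr1 (mulrC k M) (mulrC k (M * M)) -(mulrA M M k).
have [kd|dk] := leP k d; last lra.
have := ler_wpM2l M0 kd; have := ler_wpM2l M0 (ler_wpM2l M0 kd).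
rewrite !(mulrC d) -mulrA; lra.
Qed.

(** Steps of the form h / (N + 1) are used so that a whole number of them covers h, as the
    telescoping in [dline_lipschitz] requires. *)
Lemma md_to_dline p v (h : R) f x : smooth_lines f -> h != 0 ->
  (fun N : nat => (h / N.+1%:R) ^- p * md (nseq p ((h / N.+1%:R) *: v)) f x) @ \oo
    --> dline p v f x.
Proof.
move=> sf h0.
have /choice[th hth] : forall N : nat, exists th : R, 0 <= th <= 1 /\
  md (nseq p ((h / N.+1%:R) *: v)) f x =
    (h / N.+1%:R) ^+ p * dline p v f (x + (th * (p%:R * (h / N.+1%:R))) *: v).
  by move=> N; have [th h1 h2] := md_dline p (h / N.+1%:R) v x sf; exists th.
rewrite (_ : (fun N => _) = (fun N => dline p v f (x + (th N * (p%:R * (h / N.+1%:R))) *: v))).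
  have cv : (fun N : nat => th N * (p%:R * (h / N.+1%:R))) @ \oo --> (0 : R).
    apply/cvgr0Pnorm_le => e e0.
    have hc : (fun N : nat => p%:R * `|h| * (N.+1%:R^-1 : R)) @ \oo --> (0 : R).
      by rewrite -(mulr0 (p%:R * `|h|)); apply: cvgMr; exact: cvg_harmonic.
    move/cvgr0Pnorm_le: hc => /(_ _ e0); apply: filterS => N.
    apply: le_trans; have [/andP[t0 t1] _] := hth N.
    rewrite normrM ger0_norm // -[leRHS]mul1r; apply: ler_pM => //.
    by rewrite !normrM normr_id mulrA.
  under eq_fun do rewrite -dlineE //.
  apply: (@cvg_comp _ _ _ _ (fun s : R => f (x + s *: v))^`(p) _ (nbhs (0 : R)) _ cv).
  exact: scurve_continuous (scurve_derive_n p (sf x v)) (0 : R).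
apply/funext => N; have [_ ->] := hth N.
rewrite mulKf // expf_neq0 // mulf_neq0 // invr_eq0 pnatr_eq0.
Qed.

(** Both line derivatives are limits of scaled p-fold differences with step k = h / (N + 1). Going
    from y to y + h u in N + 1 steps of length k turns their difference into N + 1 mixed differences
    of order p + 1, each O(|k|^(p+1)) by [md_bound]. *)
Lemma dline_lipschitz f x0 p : line_bounded f ->
  exists2 r : R, 0 < r & exists2 C : R, 0 <= C & forall y u v (h : R),
    `|y - x0| < r -> `|u| <= 1 -> `|v| <= 1 -> `|h| <= r ->
    `|dline p v f (y + h *: u) - dline p v f y| <= C * `|h|.
Proof.
move=> lf; have [r0 r00 [C C0 hC]] := md_bound x0 p.+1 lf; have [sf _] := lf.
exists (r0 / 2); first by rewrite divr_gt0.
exists C => // y u v h yr hu hv hr.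
have [->|h0] := eqVneq h 0; first by rewrite scale0r addr0 subrr normr0 mulr0.
have c1 := @md_to_dline p v h f (y + h *: u) sf h0.
have c2 := @md_to_dline p v h f y sf h0.
have c3 : (fun N : nat =>
    (h / N.+1%:R) ^- p * md (nseq p ((h / N.+1%:R) *: v)) f (y + h *: u) -
    (h / N.+1%:R) ^- p * md (nseq p ((h / N.+1%:R) *: v)) f y) @ \oo -->
    dline p v f (y + h *: u) - dline p v f y by exact: cvgB c1 c2.
apply: (lim_norm_le c3); apply: nearW => N.
set k := h / N.+1%:R.
have k0 : k != 0 by rewrite mulf_neq0 // invr_eq0 pnatr_eq0.
have kN : N.+1%:R * k = h by rewrite mulrC divfK // pnatr_eq0.
rewrite -mulrBr normrM normfV normrX ler_pdivrMl ?exprn_gt0 ?normr_gt0 //.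
have -> : md (nseq p (k *: v)) f (y + h *: u) - md (nseq p (k *: v)) f y =
  \sum_(i < N.+1) md (nseq p (k *: v) ++ [:: k *: u]) f (y + (i%:R * k) *: u).
  have cat_md l z w : md (l ++ [:: w]) f z = md l f (z + w) - md l f z.
    by elim: l z => [//|w' l IH] z; rewrite /= !IH (addrAC z w w'); ring.
  rewrite -[in LHS]kN; elim: N.+1 => [|j IH].
    by rewrite big_ord0 mul0r scale0r addr0 subrr.
  rewrite big_ord_recr /= -IH cat_md.
  rewrite (_ : y + (j%:R * k) *: u + k *: u = y + (j.+1%:R * k) *: u); first by ring.
  by rewrite -addrA -scalerDl -natr1 mulrDl mul1r.
apply: le_trans (ler_norm_sum _ _ _) _.
have kh : `|k| <= `|h|.
  by rewrite /k normrM normfV normr_nat ler_pdivrMr // ler_peMr // ler1n.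
apply: (@le_trans _ _ (\sum_(i < N.+1) C * `|k| ^+ p.+1)).
  apply: ler_sum => i _; apply: hC.
  - have ih : `|(i%:R * k) *: u| <= `|h|.
      rewrite normrZ -[leRHS]mulr1; apply: ler_pM => //.
      rewrite -kN !normrM !normr_nat; apply: ler_wpM2r => //.
      by rewrite ler_nat ltnW.
    rewrite addrAC; apply: le_lt_trans (ler_normD _ _) _; lra.
  - by rewrite size_cat size_nseq addn1.
  - move=> w; rewrite mem_cat mem_nseq inE => /orP[/andP[_ /eqP->]|/eqP->];
      by rewrite normrZ ler_piMr.
  - by rewrite normr_ge0 /= (le_trans kh) // (le_trans hr) // ler_pdivrMr // ler_peMr ?ler1n // ltW.
rewrite sumr_const card_ord -mulr_natl -kN [`|N.+1%:R * k|]normrM normr_nat exprS.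
by rewrite le_eqVlt; apply/orP; left; apply/eqP; ring.
Qed.

(** The derivative along u is the limit of the difference quotients [q N], whose line derivatives of
    every order are locally bounded by [dline_lipschitz]; [limit_scurve] and its convergence of
    derivatives give the rest. *)
Lemma line_bounded_dline u f : `|u| <= 1 -> line_bounded f -> line_bounded (dline 1 u f).
Proof.
move=> hu lf; have [sf bf] := lf.
pose q (N : nat) x : R := N.+1%:R * (f (x + N.+1%:R^-1 *: u) - f x).
have sq N x v : scurve (fun t : R => q N (x + t *: v)).
  apply: scurve_mul; first exact: scurve_cst.
  apply: scurve_sub; last exact: sf.
  rewrite (_ : (fun t => _) = (fun t : R => f (x + N.+1%:R^-1 *: u + t *: v))); first exact: sf.
  by apply/funext => t; rewrite addrAC.
have cq x : (fun N => q N x) @ \oo --> dline 1 u f x.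
  have := @md_to_dline 1 u 1 f x sf (oner_neq0 _).
  by under eq_fun do rewrite /= expr1 div1r invrK.
have dq N p v x : dline p v (q N) x =
    N.+1%:R * (dline p v f (x + N.+1%:R^-1 *: u) - dline p v f x).
  rewrite /dline; have s1 : scurve (fun t : R => f (x + N.+1%:R^-1 *: u + t *: v)) by exact: sf.
  have E1 := congr1 (fun g : R -> R => g 0) (derive_n_sub p s1 (sf x v)).
  rewrite /= in E1; rewrite -E1.
  have /= <- := congr1 (fun g : R -> R => g 0) (derive_n_scale p N.+1%:R (scurve_sub s1 (sf x v))).
  by congr (derive1n p _ 0); apply/funext => t; rewrite /q addrAC.
have bq x0 p : exists2 r : R, 0 < r & exists2 C : R, 0 <= C & \forall N \near \oo, forall y v,
    `|y - x0| < r -> `|v| <= 1 -> `|dline p v (q N) y| <= C.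
  have [r r0 [C C0 hC]] := dline_lipschitz x0 p lf; exists r => //; exists C => //.
  have : (fun N : nat => N.+1%:R^-1 : R) @ \oo --> (0 : R) by exact: cvg_harmonic.
  move=> /cvgr0Pnorm_le /(_ _ r0); apply: filterS => N Nr y v yr hv.
  rewrite dq normrM normr_nat -ler_pdivlMl // mulrC.
  have := hC y u v N.+1%:R^-1 yr hu hv Nr; rewrite [`|N.+1%:R^-1|]ger0_norm //.
have lim x v : `|v| <= 1 -> scurve (fun t : R => dline 1 u f (x + t *: v)) /\
    forall m t, (fun N => (fun t : R => q N (x + t *: v))^`(m) t) @ \oo -->
      (fun t : R => dline 1 u f (x + t *: v))^`(m) t.
  move=> hv; apply: (@limit_scurve R (fun N (t : R) => q N (x + t *: v))) => //.
  move=> m t0; have [r r0 [C C0 hC]] := bq (x + t0 *: v) m.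
  exists r => //; exists C; apply: filterS hC => N hN t tr.
  rewrite dlineE; last by move=> y w; exact: sq.
  apply: hN => //; rewrite opprD addrACA subrr add0r -scalerBl normrZ.
  by apply: le_lt_trans tr; rewrite ler_piMr.
split.
  move=> x v; have [w hw ->] := unit_decomp v.
  have [h _] := lim x w hw.
  rewrite (_ : (fun t => _) = (fun t : R => dline 1 u f (x + (t * `|v|) *: w))).
    apply: (@scurve_comp _ _ (fun s : R => dline 1 u f (x + s *: w)) (fun t => t * `|v|)) => //.
    by apply: scurve_mul; [exact: scurve_id|exact: scurve_cst].
  by apply/funext => t; rewrite scalerA.
move=> x0 p; have [r r0 [C C0 hC]] := bq x0 p; exists r => //; exists C => y v yr hv.
have [_ /(_ p 0) h] := lim y v hv.
by apply: lim_norm_le h _; apply: filterS hC => N; exact.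
Qed.

Lemma dline1_deriv f x v : smooth_lines f -> is_derive x v f (dline 1 v f x).
Proof.
move=> sf; have := scurve_der 0 (sf x v).
rewrite -derive1n1 -/(dline 1 v f x) => -[d1 d2].
have E1 : (fun h : R => h^-1 *: (((fun t : R => f (x + t *: v)) \o shift 0) (h *: 1) - f (x + 0 *: v))) =
          (fun h : R => h^-1 *: ((f \o shift x) (h *: v) - f x)).
  apply/funext => h /=; rewrite addr0 scale0r addr0 [x + _]addrC.
  by rewrite (_ : h *: 1 = h) //; exact: mulr1.
split; first by move: d1; rewrite /derivable E1.
by move: d2; rewrite /derive E1.
Qed.

Lemma line_bounded_continuous f : line_bounded f -> continuous f.
Proof.
move=> [sf bf] x; apply/continuous_normP => e e0.
have [r r0 [C hC]] := bf x 1.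
have C0 : 0 <= C by apply: le_trans (hC x 0 _ _); rewrite ?subrr ?normr0 ?ler01.
exists (Num.min r (e / (C + 1))); first by rewrite lt_min r0 divr_gt0 // ltr_wpDl.
move=> y; rewrite lt_min => /andP[yr /ltW ye].
have [v hv yv] := unit_decomp (y - x).
have yE : y = x + `|y - x| *: v by rewrite -yv addrC subrK.
have [th /andP[th0 th1]] := scurve_MVT 0 `|y - x| (sf x v).
rewrite scale0r addr0 -yE subr0 add0r -derive1n1 dlineE // => E1.
rewrite E1 normrM normr_id.
apply: (@le_trans _ _ (C * (e / (C + 1)))); last first.
  by rewrite mulrA ler_pdivrMr ?ltr_wpDl // mulrDr mulr1 mulrC lerDl ltW.
apply: ler_pM => //; apply: hC => //.
rewrite addrAC subrr add0r normrZ normrM normr_id ger0_norm //.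
apply: le_lt_trans yr; rewrite -[leRHS]mulr1; apply: ler_pM => //; first by rewrite mulr_ge0.
by rewrite ler_piMl.
Qed.

Lemma norm_delta_mx_le1 (i : 'I_n) : `|delta_mx 0 i : E| <= 1.
Proof.
by apply: row_norm_le => // j; rewrite mxE eqxx /=; case: (_ == _); rewrite ?normr1 ?normr0.
Qed.

Lemma line_bounded_pderiv i f : line_bounded f -> line_bounded (pderiv i f).
Proof.
move=> lf; have -> : pderiv i f = dline 1 (delta_mx 0 i) f.
  by apply/funext => x; have [_ h] := dline1_deriv x (delta_mx 0 i) (proj1 lf); exact: h.
exact: line_bounded_dline (norm_delta_mx_le1 i) lf.
Qed.

Lemma line_bounded_smooth f : line_bounded f -> smooth_on setT f.
Proof.
move=> lf l x _; have {}lf : line_bounded (pderivs l f).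
  by elim: l => //= i l IH; exact: line_bounded_pderiv.
split; first exact: line_bounded_continuous.
by move=> i; have [] := dline1_deriv x (delta_mx 0 i) (proj1 lf).
Qed.

Lemma arc_smooth_line_bounded f :
  (forall c : R -> E, scurve c -> scurve (fun t => f (c t))) -> line_bounded f.
Proof.
move=> af.
have sf : smooth_lines f.
  move=> x v; apply: (af (fun t => x + t *: v)); apply: scurve_add; first exact: scurve_cst.
  by apply: scurve_scale; [exact: scurve_id|exact: scurve_cst].
split=> // x p; apply: contrapT => hn.
have p2 j : 0 < 2 ^+ j :> R by rewrite exprn_gt0.
(* The curve will follow the k-th bad line with speed 2^k rho k, so a line derivative above B k
   makes the p-th derivative along the curve exceed k. *)
pose B k : R := k%:R / (2 ^+ k * rho k) ^+ p.
have /choice[yv hyv] : forall k : nat, exists yv : E * E,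
    [/\ `|yv.1 - x| < rho k, `|yv.2| <= 1 & B k < `|dline p yv.2 f yv.1|].
  move=> k; apply: contrapT => hk; apply: hn; exists (rho k); first exact: rho_gt0.
  exists (B k) => y v yr hv; rewrite leNgt; apply/negP => Bk.
  by apply: hk; exists (y, v).
(* [bumpf] switches on the displacement to the base point of a bad line, [gam1] the motion along
   it. *)
pose gam1 (s : R) : R := s * bumpf s.
have sgam1 : scurve gam1 by apply: scurve_mul; [exact: scurve_id|exact: scurve_bump].
have gam0 s : 1 / 4 < `|s| -> @bumpf R s = 0 by move=> /ltW; exact: bump0.
have gam10 s : 1 / 4 < `|s| -> gam1 s = 0 by move=> /gam0; rewrite /gam1 => ->; rewrite mulr0.

have /choice[g hg] : forall i : 'I_n, exists g : R -> R, scurve g /\ forall t j,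
    `|2 ^+ j * t - 1| <= 1 / 4 -> g t = ((yv j).1 - x) 0 i * bumpf (2 ^+ j * t - 1).
  move=> i; have [k|g sg hg] := @special_sum R bumpf (fun k => ((yv k).1 - x) 0 i) scurve_bump gam0.
    by apply: le_trans (coord_norm_le _ _) _; have [/ltW] := hyv k.
  by exists g.
have /choice[g1 hg1] : forall i : 'I_n, exists g : R -> R, scurve g /\ forall t j,
    `|2 ^+ j * t - 1| <= 1 / 4 -> g t = (rho j * (yv j).2 0 i) * gam1 (2 ^+ j * t - 1).
  move=> i; have [k|g' sg hg'] := @special_sum R gam1 (fun k => rho k * (yv k).2 0 i) sgam1 gam10.
    rewrite normrM (gtr0_norm (rho_gt0 k)) ler_piMr //; first exact: ltW (rho_gt0 k).
    by apply: le_trans (coord_norm_le _ _) _; have [] := hyv k.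
  by exists g'.
pose c (t : R) : E := \row_i (x 0 i + g i t + g1 i t).
have sc : scurve c.
  apply: scurve_coord_row => i; rewrite (_ : (fun t => _) = (fun t => x 0 i + g i t + g1 i t)).
    apply: scurve_add; last by have [] := hg1 i.
    by apply: scurve_add; [exact: scurve_cst|have [] := hg i].
  by apply/funext => t; rewrite mxE.
(* On the plateau of the j-th bump the curve runs along the j-th bad line and meets its base point
   at time 2^-j. *)
have cE j (t : R) : `|2 ^+ j * t - 1| <= 1 / 8 ->
    c t = (yv j).1 + ((2 ^+ j * rho j) * t - rho j) *: (yv j).2.
  move=> ht; apply/rowP => i; rewrite !mxE.
  have ht4 : `|2 ^+ j * t - 1| <= 1 / 4 by apply: le_trans ht _; lra.
  have [_ hgi] := hg i; have [_ hg1i] := hg1 i; rewrite (hgi _ j) // (hg1i _ j) //.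
  rewrite /gam1 bump1 // !mxE; ring.
have big k : k%:R < `|(fun t => f (c t))^`(p) (2^-1 ^+ k)|.
  rewrite (@derive_n_near _ _ p _ (fun t : R => f ((yv k).1 + ((2 ^+ k * rho k) * t - rho k) *: (yv k).2))).
    have := derive_n_comp_affine p (2 ^+ k * rho k) (- rho k) (2^-1 ^+ k) (sf (yv k).1 (yv k).2).
    rewrite /= => ->; rewrite mulrAC -exprMn divff // expr1n mul1r subrr.
    have [_ _] := hyv k; rewrite /B -/(dline p (yv k).2 f (yv k).1).
    have D0 : 0 < (2 ^+ k * rho k : R) ^+ p by rewrite exprn_gt0 // mulr_gt0 // rho_gt0.
    by rewrite ltr_pdivrMr // normrM (gtr0_norm D0) mulrC.
  have cc : continuous (fun t : R => 2 ^+ k * t - 1).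
    move=> t; apply: cvgB; last exact: cvg_cst.
    by apply: cvgMr; exact: cvg_id.
  have /cvgrPdist_lt /(_ (1 / 8)) := cc (2^-1 ^+ k).
  rewrite -exprMn divff // expr1n subrr => /(_ _) h.
  have : 0 < (1 / 8 : R) by lra.
  by move=> /h; apply: filterS => t; rewrite sub0r normrN => /ltW ht; rewrite (cE k).
(* Continuity at 0 bounds this derivative along the times 2^-k, contradicting [big]. *)
have sfc : scurve (fun t => f (c t))^`(p) by apply: scurve_derive_n; exact: af.
have /cvgrPdist_lt /(_ 1 ltr01) := scurve_continuous sfc (0 : R).
set M := `|(fun t => f (c t))^`(p) 0| => h.
have pw : (fun k : nat => 2^-1 ^+ k : R) @ \oo --> (0 : R).
  by apply: cvg_expr; rewrite ger0_norm ?invr_ge0 // invf_lt1 // ltr1n.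
have pwh : \forall k \near \oo,
  `|(fun t => f (c t))^`(p) 0 - (fun t => f (c t))^`(p) (2^-1 ^+ k)| < 1 by exact: (pw _ h).
have [k [/= hk1 hk2]] := @filter_ex _ \oo _ _ (filterI pwh (nbhs_infty_ger (M + 1))).
have hk3 := big k.
have := ler_normB ((fun t => f (c t))^`(p) 0)
  ((fun t => f (c t))^`(p) 0 - (fun t => f (c t))^`(p) (2^-1 ^+ k)).
rewrite subKr -/M; lra.
Qed.

End Boman.

Arguments line_bounded_continuous {R n f} lf x [A] : rename.

(** The test by globally defined curves that stay in U, as in the definitions of smooth kernels and
    of the basic space. Locked for the same reason as [scurve]. *)
HB.lock Definition asmooth (R : realType) (V : normedModType R) (n : nat)
    (U : set 'rV[R]_n) (f : 'rV[R]_n -> V) : Prop :=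
  forall c : R -> 'rV[R]_n, scurve c -> (forall t, U (c t)) -> scurve (fun t => f (c t)).

(** * The curve test on open sets compared with partial derivatives *)

Section ArcSmooth.
Local Open Scope ring_scope.
Local Open Scope classical_set_scope.
Context {R : realType} {n : nat}.
Local Notation E := 'rV[R]_n.
Implicit Types (V : normedModType R) (U : set E).

Lemma asmoothP V U (f : E -> V) : asmooth U f <->
  forall c : R -> E, scurve c -> (forall t, U (c t)) -> scurve (fun t => f (c t)).
Proof. by rewrite asmooth.unlock. Qed.

(** A reparametrization that is the identity near t0 and never leaves the d-neighbourhood of t0. It
    confines a curve to an open set, so that the curve test becomes a local condition. *)
Lemma scurve_cut_time (t0 d : R) : 0 < d ->
  exists2 s : R -> R, scurve s & (forall t, `|s t - t0| < d) /\ \near t0, s t0 = t0.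
Proof.
move=> d0; exists (fun t => t0 + (t - t0) * bumpf (d^-1 * t + - (d^-1 * t0))).
  have h : scurve (fun t : R => d^-1 * t - d^-1 * t0).
    apply: scurve_sub; last exact: scurve_cst.
    by apply: scurve_mul; [exact: scurve_cst|exact: scurve_id].
  apply: scurve_add; first exact: scurve_cst.
  apply: scurve_mul; first by apply: scurve_sub; [exact: scurve_id|exact: scurve_cst].
  by apply: scurve_comp => //; exact: scurve_bump.
have nE t : `|d^-1 * t - d^-1 * t0| = `|t - t0| / d.
  by rewrite -mulrBr normrM gtr0_norm ?invr_gt0 // mulrC.
split=> [t|].
  rewrite addrAC subrr add0r normrM.
  have [h|h] := lerP (1 / 4) `|d^-1 * t - d^-1 * t0|.
    by rewrite bump0 // normr0 mulr0.
  rewrite (ger0_norm (bump_ge0 _)); apply: le_lt_trans (_ : `|t - t0| < d).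
    by rewrite ler_piMr // bump_le1.
  by move: h; rewrite nE ltr_pdivrMr //; lra.
apply/near_normP; exists (d / 8) => [|t td]; first by rewrite divr_gt0.
rewrite bump1 ?mulr1; first by rewrite addrC subrK.
by rewrite nE ler_pdivrMr //; lra.
Qed.

Lemma near_comp_continuous (W : topologicalType) (V : topologicalType) (c : W -> V) (P : set V) t :
  {for t, continuous c} -> nbhs (c t) P -> \near t, P (c t).
Proof. by move=> ct; exact: ct. Qed.

Lemma scurve_near_open (c : R -> E) U t : scurve c -> open U -> U (c t) -> \near t, U (c t).
Proof.
move=> sc oU Ut; apply: near_comp_continuous; first exact: scurve_continuous.
exact: open_nbhs_nbhs.
Qed.

Lemma asmooth_curve_local V U (f : E -> V) (c : R -> E) t0 : open U -> asmooth U f ->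
  scurve c -> U (c t0) -> exists2 c0, scurve c0 & \near t0, f (c t0) = c0 t0.
Proof.
move=> oU /asmoothP sf sc Ut; have /near_normP[d d0 dU] := scurve_near_open sc oU Ut.
have [s ss [sd ns]] := scurve_cut_time t0 d0.
exists (fun t => f (c (s t))); last by apply: filterS ns => t ->.
apply: (sf (fun t => c (s t))); first exact: scurve_comp.
by move=> t; apply: dU; exact: sd.
Qed.

Lemma asmooth_local V U (f : E -> V) : open U ->
  (forall x, U x -> exists2 g : E -> V, asmooth setT g & \near x, f x = g x) -> asmooth U f.
Proof.
move=> oU h; apply/asmoothP => c sc cU; apply: scurve_local => t0.
have [g sg fg] := h _ (cU t0); exists (fun t => g (c t)); first by move/asmoothP: sg; exact.
by apply: (@near_comp_continuous _ _ c) fg; exact: scurve_continuous.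
Qed.

Lemma asmoothW V U U' (f : E -> V) : U `<=` U' -> asmooth U' f -> asmooth U f.
Proof. by move=> h /asmoothP sf; apply/asmoothP => c sc cU; apply: sf => // t; exact: h. Qed.

Lemma asmooth_ext V U (f g : E -> V) : (forall x, U x -> f x = g x) -> asmooth U f -> asmooth U g.
Proof.
move=> fg /asmoothP sf; apply/asmoothP => c sc cU.
rewrite (_ : (fun t => _) = (fun t => f (c t))); first exact: sf.
by apply/funext => t; rewrite fg.
Qed.

Lemma asmooth_cst V U (v : V) : asmooth U (fun=> v).
Proof. by apply/asmoothP => c _ _; exact: scurve_cst. Qed.

Lemma asmooth_add V U (f g : E -> V) : asmooth U f -> asmooth U g -> asmooth U (fun x => f x + g x).
Proof.
by move=> /asmoothP sf /asmoothP sg; apply/asmoothP => c sc cU; apply: scurve_add; [exact: sf|exact: sg].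
Qed.

Lemma asmooth_opp V U (f : E -> V) : asmooth U f -> asmooth U (fun x => - f x).
Proof. by move=> /asmoothP sf; apply/asmoothP => c sc cU; apply: scurve_opp; exact: sf. Qed.

Lemma asmooth_sub V U (f g : E -> V) : asmooth U f -> asmooth U g -> asmooth U (fun x => f x - g x).
Proof. by move=> sf sg; apply: asmooth_add => //; exact: asmooth_opp. Qed.

Lemma asmooth_scale V U (a : E -> R) (f : E -> V) :
  asmooth U a -> asmooth U f -> asmooth U (fun x => a x *: f x).
Proof.
by move=> /asmoothP sf /asmoothP sg; apply/asmoothP => c sc cU; apply: scurve_scale; [exact: sf|exact: sg].
Qed.

Lemma asmooth_mul U (a f : E -> R) :
  asmooth U a -> asmooth U f -> asmooth U (fun x => a x * f x).
Proof. exact: asmooth_scale. Qed.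

Lemma asmooth_sum V U (I : Type) (r : seq I) (f : I -> E -> V) :
  (forall i, asmooth U (f i)) -> asmooth U (fun x => \sum_(i <- r) f i x).
Proof.
move=> h; apply/asmoothP => c sc cU.
by apply: (@scurve_sum _ _ _ r (fun i t => f i (c t))) => i; have /asmoothP := h i; exact.
Qed.

Lemma asmooth_prod U (I : Type) (r : seq I) (f : I -> E -> R) :
  (forall i, asmooth U (f i)) -> asmooth U (fun x => \prod_(i <- r) f i x).
Proof.
move=> h; apply/asmoothP => c sc cU.
by apply: (@scurve_prod _ _ r (fun i t => f i (c t))) => i; have /asmoothP := h i; exact.
Qed.

Lemma asmooth_lin V V' U (p : {linear V -> V'}) (f : E -> V) : continuous p ->
  asmooth U f -> asmooth U (fun x => p (f x)).
Proof.
by move=> cp /asmoothP sf; apply/asmoothP => c sc cU; apply: scurve_lin => //; exact: sf.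
Qed.

Lemma asmooth_scurve U (g : R -> R) (f : E -> R) : scurve g -> asmooth U f ->
  asmooth U (fun x => g (f x)).
Proof.
by move=> sg /asmoothP sf; apply/asmoothP => c sc cU; apply: scurve_comp => //; exact: sf.
Qed.

Lemma der_coord (c : R -> E) t d i : der c t d -> der (fun t => c t 0 i) t (d 0 i).
Proof.
move=> /der_cvgP hc; apply/der_cvgP.
have -> : (fun h => h^-1 *: (c (h + t) 0 i - c t 0 i)) =
          (fun x : E => x 0 i) \o (fun h => h^-1 *: (c (h + t) - c t)).
  by apply/funext => h /=; rewrite !mxE.
by apply: cvg_comp hc _; exact: coord_continuous.
Qed.

Lemma scurve_coord (c : R -> E) i : scurve c -> scurve (fun t => c t 0 i).
Proof.
move=> /scurve_cn hc; apply/scurve_cn => k; move/(_ k): hc.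
elim: k c => // k IH c [d hd kd]; exists (fun t => d t 0 i); last exact: IH.
by move=> t; exact: der_coord.
Qed.

Lemma asmooth_coord U i : asmooth U (fun x : E => x 0 i).
Proof. by apply/asmoothP => c sc _; exact: scurve_coord. Qed.

Lemma asmooth_bump (x0 : E) (r : R) : 0 < r -> exists2 chi : E -> R, asmooth setT chi &
  [/\ forall x, 0 <= chi x <= 1, forall x, r / 4 < `|x - x0| -> chi x = 0 &
      forall x, `|x - x0| <= r / 8 -> chi x = 1].
Proof.
move=> r0; exists (fun x => \prod_(i < n) bumpf (r^-1 * (x 0 i - x0 0 i))).
  apply: asmooth_prod => i; apply: asmooth_scurve; first exact: scurve_bump.
  apply: asmooth_mul; first exact: asmooth_cst.
  by apply: asmooth_sub; [exact: asmooth_coord|exact: asmooth_cst].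
split=> x.
- elim/big_rec: _ => [|i y _ /andP[y0 y1]]; first by rewrite ler01 lexx.
  by rewrite mulr_ge0 ?bump_ge0 //= mulr_ile1 ?bump_ge0 ?bump_le1.
- move=> hx; have [i hi] : exists i, r / 4 < `|(x - x0) 0 i|.
    apply: contrapT => hn; move: hx; rewrite ltNge => /negP; apply.
    apply: row_norm_le => [|i]; first by rewrite divr_ge0 // ltW.
    by rewrite leNgt; apply/negP => h; apply: hn; exists i.
  rewrite (bigD1 i) //= bump0 ?mul0r //.
  rewrite normrM gtr0_norm ?invr_gt0 // ler_pdivlMl //.
  by move: hi; rewrite !mxE; lra.
- move=> hx; apply: big1 => i _; rewrite bump1 //.
  rewrite normrM gtr0_norm ?invr_gt0 // ler_pdivrMl //.
  have := coord_norm_le (x - x0) i; rewrite !mxE; lra.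
Qed.

(** Multiplication by a bump supported in U. It carries statements about functions that are smooth
    on the whole space, such as [arc_smooth_line_bounded], over to open sets. *)
Lemma asmooth_localize V U (f : E -> V) x0 : open U -> asmooth U f -> U x0 ->
  exists2 g : E -> V, asmooth setT g & \near x0, f x0 = g x0.
Proof.
move=> oU sf Ux; have /near_normP[r r0 rU] : nbhs x0 U by exact: open_nbhs_nbhs.
have [chi schi [_ chi0 chi1]] := asmooth_bump x0 r0.
exists (fun x => if `[< U x >] then chi x *: f x else 0); last first.
  apply/near_normP; exists (r / 8) => [|x xr]; first by rewrite divr_gt0.
  case: asboolP => [_|]; first by rewrite chi1 ?scale1r // ltW.
  by case; apply: rU; lra.
apply/asmoothP => c sc _; apply: scurve_local => t0.
have [h|h] := ltP `|c t0 - x0| r.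
  have Ut := rU _ h; have [c0 sc0 n0] := asmooth_curve_local oU sf sc Ut.
  exists (fun t => chi (c t) *: c0 t).
    by apply: scurve_scale => //; move/asmoothP: schi; exact.
  have nU := scurve_near_open sc oU Ut.
  by apply: filterS2 n0 nU => t ft Uct; case: asboolP => // _; rewrite ft.
exists (fun=> 0); first exact: scurve_cst.
have /continuous_normP/(_ (r / 2)) := scurve_continuous sc t0.
rewrite divr_gt0 // => /(_ isT)[d d0 hd]; apply/near_normP; exists d => // t td.
case: asboolP => // _; rewrite chi0 ?scale0r //.
have := hd _ td; have := ler_normD (c t - x0) (c t0 - c t).
by rewrite addrC addrA subrK [`|c t0 - c t|]distrC; lra.
Qed.

Lemma near_pderivs V (f g : E -> V) (x : E) l : (\forall y \near x, f y = g y) ->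
  \forall y \near x, pderivs l f y = pderivs l g y.
Proof.
move=> fg; elim: l => //= i l IH; have := near_join IH; apply: filterS => y hy.
exact: near_eq_derive.
Qed.

Lemma pderivs_eq_on V U (f g : E -> V) : open U -> (forall x, U x -> f x = g x) ->
  forall l x, U x -> pderivs l f x = pderivs l g x.
Proof.
move=> oU fg l x Ux; apply: (@nbhs_singleton _ x (fun x => pderivs l f x = pderivs l g x)).
apply: near_pderivs; have : nbhs x U by exact: open_nbhs_nbhs.
by apply: filterS.
Qed.

Lemma smooth_on_local V U (f : E -> V) :
  (forall x, U x -> exists2 g : E -> V, smooth_on setT g & \near x, f x = g x) -> smooth_on U f.
Proof.
move=> h l x Ux; have [g sg fg] := h x Ux; have [cg dg] := sg l x I.
have nfg := near_pderivs l fg; split.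
  move=> A; rewrite (nbhs_singleton nfg) => /cg; rewrite /nbhs /=.
  by apply: filterS2 nfg => y; rewrite /= => ->.
by move=> i; apply: near_eq_derivable (dg i); apply: filterS nfg => y ->.
Qed.

Lemma asmooth_smooth_R U (f : E -> R) : open U -> asmooth U f -> smooth_on U f.
Proof.
move=> oU sf; apply: smooth_on_local => x Ux; have [g sg fg] := asmooth_localize oU sf Ux.
exists g => //; apply: line_bounded_smooth; apply: arc_smooth_line_bounded.
by move=> c sc; move/asmoothP: sg; exact.
Qed.

Lemma smooth_on_pderiv V U (f : E -> V) i : smooth_on U f -> smooth_on U (pderiv i f).
Proof.
move=> sf l x Ux; have := sf (rcons l i) x Ux.
by rewrite /pderivs -cats1 foldr_cat.
Qed.

Lemma MVT_der (g dg : R -> R) (h : R) : (forall t, `|t| <= `|h| -> der g t (dg t)) ->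
  exists2 th : R, 0 <= th <= 1 & g h - g 0 = h * dg (th * h).
Proof.
have main (g' dg' : R -> R) (k : R) : 0 < k -> (forall t, `|t| <= `|k| -> der g' t (dg' t)) ->
    exists2 th : R, 0 <= th <= 1 & g' k - g' 0 = k * dg' (th * k).
  move=> k0 hg; have [||x xk] := @MVT R g' dg' 0 k k0.
  - move=> x; rewrite in_itv /= => /andP[x0 xk]; apply: hg.
    by rewrite !gtr0_norm // ltW.
  - apply: derivable_within_continuous => x; rewrite in_itv /= => /andP[x0 xk].
    by apply: der_derivable (hg x _); rewrite !ger0_norm // ltW.
  rewrite subr0 => ->; exists (x / k); last by rewrite divfK ?gt_eqF // mulrC.
  move: xk; rewrite in_itv /= => /andP[x0 xk].
  by rewrite divr_ge0 ?ler_pdivrMr ?mul1r // ltW.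
move=> hg; have [h0|h0|h0] := ltgtP 0 h; first exact: main.
  have [||th hth] := main (fun t => g (- t)) (fun t => - dg (- t)) (- h).
  - by rewrite oppr_gt0.
  - move=> t; rewrite normrN => th.
    have := @der_comp _ _ g (fun t => - t) t (-1) (dg (- t)).
    rewrite (_ : - dg _ = -1 *: dg (- t)); last by rewrite scaleN1r.
    have dm : der (fun u : R => - u) t (-1) := der_opp (der_id t).
    by apply => //; apply: hg; rewrite normrN.
  rewrite (mulrN th) !opprK oppr0 mulrNN => E1.
  by exists th.
by exists 0; rewrite ?lexx ?ler01 // -h0 subrr mul0r.
Qed.

(** The coordinates of x are replaced by those of y one at a time, with a one-variable mean value
    step for each. In the sup norm none of the intermediate points is farther from x than y is. *)
Lemma telescope_pderiv (f : E -> R) x (r : R) :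
  (forall y i, `|y - x| < r -> derivable f y (delta_mx 0 i)) ->
  forall y, `|y - x| < r -> exists2 xi : 'I_n -> E, forall k, `|xi k - x| <= `|y - x| &
    f y - f x = \sum_k (y - x) 0 k * pderiv k f (xi k).
Proof.
move=> df y yr.
pose z (k : nat) : E := \row_i (if (i < k)%N then y 0 i else x 0 i).
have zE (k : 'I_n) : z k.+1 = z k + (y - x) 0 k *: delta_mx 0 k.
  apply/rowP => i; rewrite !mxE eqxx /= ltnS.
  have [->|ik] := eqVneq i k; first by rewrite leqnn ltnn mulr1 addrC subrK.
  by rewrite mulr0 addr0 leq_eqVlt -val_eqE /= in ik *; rewrite (negbTE ik).
have zn (k : 'I_n) (s : R) : `|s| <= `|(y - x) 0 k| -> `|z k + s *: delta_mx 0 k - x| <= `|y - x|.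
  move=> hs; apply: row_norm_le => // i; rewrite !mxE eqxx /=.
  have [->|ik] := eqVneq i k.
    by rewrite ltnn mulr1 addrAC subrr add0r; apply: le_trans hs (coord_norm_le _ _).
  rewrite mulr0 addr0; case: ifP => _; last by rewrite subrr normr0.
  by have := coord_norm_le (y - x) i; rewrite !mxE.
have step (k : 'I_n) : exists2 xi : E, `|xi - x| <= `|y - x| &
    f (z k.+1) - f (z k) = (y - x) 0 k * pderiv k f xi.
  have [t ht|th /andP[th0 th1]] := @MVT_der (fun s : R => f (z k + s *: delta_mx 0 k))
     (fun s => pderiv k f (z k + s *: delta_mx 0 k)) ((y - x) 0 k).
    have d := df (z k + t *: delta_mx 0 k) k (le_lt_trans (zn _ _ ht) yr).
    have := derivableP d; rewrite -/(pderiv k f _) => -[d1 d2].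
    have E1 : (fun h : R => h^-1 *: (((fun s : R => f (z k + s *: delta_mx 0 k)) \o shift t) (h *: 1)
         - f (z k + t *: delta_mx 0 k))) =
       (fun h : R => h^-1 *: ((f \o shift (z k + t *: delta_mx 0 k)) (h *: delta_mx 0 k)
         - f (z k + t *: delta_mx 0 k))).
      apply/funext => h /=; rewrite (_ : h *: 1 = h); last exact: mulr1.
      by rewrite scalerDl addrCA.
    split; first by move: d1; rewrite /derivable E1.
    by move: d2; rewrite /derive E1.
  rewrite -zE scale0r addr0 => E1; exists (z k + (th * (y - x) 0 k) *: delta_mx 0 k) => //.
  by apply: zn; rewrite normrM ger0_norm // ler_piMl.
have {step} /choice[xi hxi] : forall k : 'I_n, exists xi : E, `|xi - x| <= `|y - x| /\
    f (z k.+1) - f (z k) = (y - x) 0 k * pderiv k f xi.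
  by move=> k; have [xi] := step k; exists xi.
exists xi; first by move=> k; have [] := hxi k.
under eq_bigr => k _ do rewrite -(proj2 (hxi k)).
have -> : y = z n by apply/rowP => i; rewrite mxE ltn_ord.
have -> : x = z 0%N by apply/rowP => i; rewrite mxE ltn0.
have := @telescope_sumr _ 0 n (fun k => f (z k)) (leq0n n).
by rewrite big_mkord => <-.
Qed.

Lemma cvg_bigsum (T : Type) (F : set_system T) {FF : Filter F} (I : Type) (s : seq I)
    (V : normedModType R) (u : I -> T -> V) (l : I -> V) : (forall i, u i @ F --> l i) ->
  (fun x => \sum_(i <- s) u i x) @ F --> \sum_(i <- s) l i.
Proof.
move=> h; elim: s => [|i s IH].
  by under eq_fun do rewrite big_nil; rewrite big_nil; exact: cvg_cst.
by under eq_fun do rewrite big_cons; rewrite big_cons; exact: cvgD.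
Qed.

(** [telescope_pderiv] expresses the increment by partial derivatives at points that tend to c t,
    where these derivatives are continuous. *)
Lemma C1_chain (f : E -> R) (c : R -> E) (t : R) (d : E) :
  (\forall y \near c t, forall i, derivable f y (delta_mx 0 i)) ->
  (forall i, {for c t, continuous (pderiv i f)}) ->
  der c t d -> der (fun t => f (c t)) t (\sum_i d 0 i * pderiv i f (c t)).
Proof.
move=> /near_normP[r r0 df] cf hc.
have /choice[xi hxi] : forall h : R, exists xi : 'I_n -> E, `|c (h + t) - c t| < r ->
    (forall k, `|xi k - c t| <= `|c (h + t) - c t|) /\
    f (c (h + t)) - f (c t) = \sum_k (c (h + t) - c t) 0 k * pderiv k f (xi k).
  move=> h; have [hr|hr] := ltP `|c (h + t) - c t| r; last by exists (fun=> 0).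
  have [|xi h1 h2] := @telescope_pderiv f (c t) r _ (c (h + t)) hr; last by exists xi.
  by move=> y i yr; exact: df.
have cc := der_cvg hc.

apply/der_cvgP.
have nr : \forall h \near (0 : R)^', `|c (h + t) - c t| < r.
  by have /cvgrPdist_lt /(_ _ r0) := cc; apply: filterS => h; rewrite distrC.
apply: (@cvg_trans _ ((fun h : R => \sum_k (h^-1 *: (c (h + t) - c t)) 0 k * pderiv k f (xi h k)) @ 0^')).
  apply: near_eq_cvg; apply: filterS nr => h hr.
  have [_ ->] := hxi h hr; rewrite (_ : h^-1 *: _ = h^-1 * \sum_k (c (h + t) - c t) 0 k * pderiv k f (xi h k)) //.
  by rewrite mulr_sumr; apply: eq_bigr => k _; rewrite !mxE mulrA.
apply: cvg_bigsum => k; apply: cvgM.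
  have := der_coord k hc => /der_cvgP.
  rewrite (_ : (fun h : R => h^-1 *: (c (h + t) 0 k - c t 0 k)) =
    (fun h => (h^-1 *: (c (h + t) - c t)) 0 k)) //.
  by apply/funext => h; rewrite !mxE.
have : xi ^~ k @ 0^' --> c t.
  apply/cvgrPdist_lt => e e0; have /cvgrPdist_lt /(_ _ e0) := cc.
  apply: filterS2 nr => h hr; rewrite distrC => h1; rewrite distrC.
  by apply: le_lt_trans h1; have [h2 _] := hxi h hr; exact: h2.
by move=> hx; apply: (@cvg_comp _ _ _ (xi ^~ k) (pderiv k f) _ (nbhs (c t))) => //; exact: cf.
Qed.

Lemma smooth_chain_R U (f : E -> R) (c : R -> E) t d : open U -> smooth_on U f -> U (c t) ->
  der c t d -> der (fun t => f (c t)) t (\sum_i d 0 i * pderiv i f (c t)).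
Proof.
move=> oU sf Uct; apply: C1_chain.
  have : nbhs (c t) U by exact: open_nbhs_nbhs.
  by apply: filterS => y Uy i; have [_] := sf [::] y Uy; exact.
by move=> i; have [] := sf [:: i] _ Uct.
Qed.

Lemma smooth_asmooth_R U (f : E -> R) : open U -> smooth_on U f -> asmooth U f.
Proof.
move=> oU sf; apply/asmoothP => c sc cU; apply/scurve_cn => k.
elim: k f sf => // k IH f sf.
exists (fun t => \sum_i (c^`() t) 0 i * pderiv i f (c t)).
  by move=> t; exact: smooth_chain_R oU sf (cU t) (scurve_der t sc).
elim: (index_enum _) => [|i s IHs].
  under eq_fun do rewrite big_nil.
  by have /scurve_cn := @scurve_cst R R 0; exact.
under eq_fun do rewrite big_cons.
apply: cn_add => //; apply: cn_scale; last exact: IH (smooth_on_pderiv i sf).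
by have /scurve_cn := scurve_coord i (scurve_derive sc); exact.
Qed.

End ArcSmooth.

(** * Symmetry of second derivatives *)

Section Schwarz.
Local Open Scope ring_scope.
Local Open Scope classical_set_scope.
Context {R : realType} {n : nat}.
Local Notation E := 'rV[R]_n.

Lemma mixed_difference_mean (f : E -> R) (u v x : E) (h : R) :
  line_bounded f -> `|u| <= 1 -> `|v| <= 1 ->
  exists2 z : E, `|z - x| <= 2 * `|h| &
    f (x + h *: u + h *: v) - f (x + h *: u) - f (x + h *: v) + f x =
    h ^+ 2 * dline 1 v (dline 1 u f) z.
Proof.
move=> lf hu hv; have [sf _] := lf; have lu := line_bounded_dline hu lf.
have s1 : scurve (fun s : R => f (x + h *: v + s *: u) - f (x + s *: u)).
  by apply: scurve_sub; exact: sf.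
have [th /andP[th0 th1]] := scurve_MVT 0 h s1.
rewrite /= !scale0r !addr0 subr0 add0r; set w := th * h.
have -> : (fun s : R => f (x + h *: v + s *: u) - f (x + s *: u))^`() w =
    dline 1 u f (x + h *: v + w *: u) - dline 1 u f (x + w *: u).
  have E1 := congr1 (fun g : R -> R => g w) (derive_n_sub 1 (sf (x + h *: v) u) (sf x u)).
  by rewrite -derive1n1 E1 (dlineE 1 u (x + h *: v) w sf) (dlineE 1 u x w sf).
have [th' /andP[th'0 th'1]] := scurve_MVT 0 h ((proj1 lu) (x + w *: u) v).
rewrite !scale0r !addr0 subr0 add0r -derive1n1 dlineE; last exact: (proj1 lu).
rewrite [x + h *: v + w *: u]addrAC => -> E1.
exists (x + w *: u + (th' * h) *: v).
  rewrite (_ : _ - x = w *: u + (th' * h) *: v); last first.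
    by rewrite addrAC (addrAC x) subrr add0r.
  apply: le_trans (ler_normD _ _) _.
  have le_h (a : R) (y : E) : 0 <= a -> a <= 1 -> `|y| <= 1 -> `|(a * h) *: y| <= `|h|.
    move=> a0 a1 y1; rewrite normrZ -[leRHS]mulr1; apply: ler_pM => //.
    by rewrite normrM ger0_norm // ler_piMl.
  rewrite (_ : 2 * `|h| = `|h| + `|h|); last by rewrite mulr_natl.
  by apply: lerD; apply: le_h.
rewrite [x + h *: u + _]addrAC (mulrC (h ^+ 2)) expr2 mulrA -[RHS]E1 opprB addrA.
exact: addrAC.
Qed.

(** The second mixed difference is symmetric in u and v. By [mixed_difference_mean] it equals h^2
    times either iterated derivative at a point within 2 |h| of x, and both derivatives are
    continuous at x. *)
Lemma dline_swap (f : E -> R) (u v x : E) : line_bounded f -> `|u| <= 1 -> `|v| <= 1 ->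
  dline 1 u (dline 1 v f) x = dline 1 v (dline 1 u f) x.
Proof.
move=> lf hu hv; have luv := line_bounded_dline hu (line_bounded_dline hv lf).
have lvu := line_bounded_dline hv (line_bounded_dline hu lf).
apply/eqP; rewrite -subr_eq0 -normr_le0; apply/ler_addgt0Pr => e e0; rewrite add0r.
have e2 : 0 < e / 2 by rewrite divr_gt0.
have /continuous_normP /(_ _ e2) [d1 d10 h1] := line_bounded_continuous luv x.
have /continuous_normP /(_ _ e2) [d2 d20 h2] := line_bounded_continuous lvu x.
pose h : R := Num.min d1 d2 / 4.
have m0 : 0 < Num.min d1 d2 by rewrite lt_min d10.
have h0 : 0 < h by rewrite divr_gt0.
have hd1 : 2 * `|h| < d1.
  rewrite gtr0_norm //; apply: lt_le_trans (_ : Num.min d1 d2 <= _); last by rewrite ge_min lexx.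
  by rewrite /h; lra.
have hd2 : 2 * `|h| < d2.
  rewrite gtr0_norm //; apply: lt_le_trans (_ : Num.min d1 d2 <= _); last by rewrite ge_min lexx orbT.
  by rewrite /h; lra.
have [z1 z1x E1] := mixed_difference_mean x h lf hu hv.
have [z2 z2x E2] := mixed_difference_mean x h lf hv hu.
have E3 : dline 1 v (dline 1 u f) z1 = dline 1 u (dline 1 v f) z2.
  have hh : h ^+ 2 != 0 by rewrite expf_neq0 // gt_eqF.
  apply: (mulfI hh); rewrite -[LHS]E1 -[RHS]E2 (addrAC x (h *: v)).
  by congr (_ + _); exact: addrAC.
have := h2 z1 (le_lt_trans z1x hd2); have := h1 z2 (le_lt_trans z2x hd1).
rewrite -E3; set A := dline 1 v (dline 1 u f) z1; set B := dline 1 v _ x; set C := dline 1 u _ x.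
clearbody A B C => a1 a2; rewrite (_ : C - B = (A - B) - (A - C)); last by ring.
by apply: le_trans (ler_normB _ _) _; rewrite [leRHS]splitr lerD.
Qed.

Lemma pderiv_swap_R U (f : E -> R) i j x : open U -> asmooth U f -> U x ->
  pderiv i (pderiv j f) x = pderiv j (pderiv i f) x.
Proof.
move=> oU sf Ux; have [g sg fg] := asmooth_localize oU sf Ux.
have lg : line_bounded g.
  by apply: arc_smooth_line_bounded => c sc; move/asmoothP: sg; exact.
have pE k (k' : E -> R) : line_bounded k' -> pderiv k k' = dline 1 (delta_mx 0 k) k'.
  move=> lk; apply/funext => y.
  by have [_ h] := dline1_deriv y (delta_mx 0 k) (proj1 lk); exact: h.
have := @near_pderivs _ _ _ f g x [:: i; j] fg => /nbhs_singleton /= ->.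
have := @near_pderivs _ _ _ f g x [:: j; i] fg => /nbhs_singleton /= ->.
have lj := line_bounded_pderiv j lg; have li := line_bounded_pderiv i lg.
rewrite (pE _ _ lj) (pE _ _ li) (pE _ _ lg) (pE _ _ lg).
by apply: dline_swap => //; exact: norm_delta_mx_le1.
Qed.

End Schwarz.

(** * Vector-valued functions through coordinates *)

Section FiniteCoordinates.
Local Open Scope ring_scope.
Local Open Scope classical_set_scope.
Context {R : realType}.
Implicit Types V : normedModType R.

(** A finite-dimensional target, given by continuous coordinate functionals. Results for real
    functions thereby extend at once to both kinds of scalars and to row vectors. *)
Definition fincoord V : Prop := exists (d : nat) (p : 'I_d -> {linear V -> R}) (e : 'I_d -> V),
  (forall j, continuous (p j)) /\ forall v, v = \sum_j p j v *: e j.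

Lemma fincoord_real : fincoord (R : normedModType R).
Proof.
exists 1%N, (fun=> idfun), (fun=> 1); split=> [j|v]; first by move=> x; exact: cvg_id.
by rewrite big_ord1 /=; rewrite [_ *: _]mulr1.
Qed.

Lemma fst_linear : linear (fst : R * R -> R). Proof. by []. Qed.
Lemma snd_linear : linear (snd : R * R -> R). Proof. by []. Qed.

Lemma fincoord_pair : fincoord ((R * R)%type : normedModType R).
Proof.
pose fl := GRing.isLinear.Build R (R * R)%type R _ fst fst_linear.
pose sl := GRing.isLinear.Build R (R * R)%type R _ snd snd_linear.
pose fstl : {linear (R * R)%type -> R} := HB.pack (fst : R * R -> R) fl.
pose sndl : {linear (R * R)%type -> R} := HB.pack (snd : R * R -> R) sl.
exists 2%N, (fun j : 'I_2 => if j == 0 then fstl else sndl),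
  (fun j : 'I_2 => if j == 0 then (1, 0) else (0, 1)); split=> [j|v].
  by case: (j == 0) => x; [exact: cvg_fst|exact: cvg_snd].
rewrite big_ord_recl big_ord1 /=; case: v => a b.
change ((a, b) = (a * 1 + b * 0, a * 0 + b * 1)).
by rewrite !mulr1 !mulr0 addr0 add0r.
Qed.

Lemma fincoord_scalar s : fincoord (scalar_of R s).
Proof. by case: s; [exact: fincoord_real|exact: fincoord_pair]. Qed.

Lemma coord_linear n (i : 'I_n) : linear (fun x : 'rV[R]_n => x 0 i).
Proof. by move=> a x y; rewrite !mxE. Qed.

Lemma fincoord_row n : fincoord ('rV[R]_n : normedModType R).
Proof.
pose cl i := GRing.isLinear.Build R 'rV[R]_n R _ (fun x : 'rV[R]_n => x 0 i) (@coord_linear n i).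
pose c i : {linear 'rV[R]_n -> R} := HB.pack (fun x : 'rV[R]_n => x 0 i) (cl i).
exists n, c, (fun j => delta_mx 0 j); split=> [j x|v]; first exact: coord_continuous.
exact: row_delta_sum.
Qed.

End FiniteCoordinates.

Section VectorValued.
Local Open Scope ring_scope.
Local Open Scope classical_set_scope.
Context {R : realType} {n : nat}.
Local Notation E := 'rV[R]_n.
Implicit Types (V : normedModType R) (U : set E).

Lemma is_derive_lin (W V V' : normedModType R) (p : {linear V -> V'}) (f : W -> V) x v d :
  continuous p -> is_derive x v f d -> is_derive x v (fun x => p (f x)) (p d).
Proof.
move=> cp [df dE]; have hc : (fun h : R => h^-1 *: ((f \o shift x) (h *: v) - f x)) @ 0^' --> d.
  by rewrite -dE; exact: df.
have hp : (fun h : R => h^-1 *: (((fun x => p (f x)) \o shift x) (h *: v) - p (f x))) @ 0^' --> p d.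
  have -> : (fun h : R => h^-1 *: (((fun x => p (f x)) \o shift x) (h *: v) - p (f x))) =
          p \o (fun h => h^-1 *: ((f \o shift x) (h *: v) - f x)).
    by apply/funext => h /=; rewrite linearZ -linearB.
  by apply: cvg_comp hc _; exact: cp.
split; first by apply/cvg_ex; exists (p d).
exact: cvg_lim hp.
Qed.

Lemma pderivs_lin V (p : {linear V -> R}) U (f : E -> V) l : continuous p -> open U ->
  smooth_on U f -> forall x, U x -> pderivs l (fun x => p (f x)) x = p (pderivs l f x).
Proof.
move=> cp oU sf; elim: l => [//|i l IH] x Ux /=.
rewrite (_ : pderiv i _ x = pderiv i (fun x => p (pderivs l f x)) x).
  have [_ /(_ i) d] := sf l x Ux; have /derivableP d' := d.
  by have [_] := is_derive_lin cp d'.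
exact: (@pderivs_eq_on _ _ _ U _ _ oU IH [:: i] x Ux).
Qed.

Lemma smooth_on_via V U (f : E -> V) : open U ->
  (forall l, exists g : E -> V, forall x, U x ->
    [/\ pderivs l f x = g x, {for x, continuous g} & forall i, derivable g x (delta_mx 0 i)]) ->
  smooth_on U f.
Proof.
move=> oU h l x Ux; have [g hg] := h l; have [_ cg dg] := hg x Ux.
have ng : \forall y \near x, pderivs l f y = g y.
  have : nbhs x U by exact: open_nbhs_nbhs.
  by apply: filterS => y Uy; have [] := hg y Uy.
split.
  move=> A; rewrite (nbhs_singleton ng) => /cg; rewrite /nbhs /=.
  by apply: filterS2 ng => y; rewrite /= => ->.
by move=> i; apply: near_eq_derivable (dg i); apply: filterS ng => y ->.
Qed.

Lemma smooth_on_lin V (p : {linear V -> R}) U (f : E -> V) : continuous p -> open U ->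
  smooth_on U f -> smooth_on U (fun x => p (f x)).
Proof.
move=> cp oU sf; apply: smooth_on_via => // l; exists (fun x => p (pderivs l f x)) => x Ux.
have [cf df] := sf l x Ux; split.
- exact: (@pderivs_lin _ p U f l cp oU sf x Ux).
- by apply: continuous_comp cf _; exact: cp.
- by move=> i; have /derivableP d := df i; have [] := is_derive_lin cp d.
Qed.

Lemma smooth_on_lincomb V (d : nat) (a : 'I_d -> E -> R) (e : 'I_d -> V) U : open U ->
  (forall j, smooth_on U (a j)) -> smooth_on U (fun x => \sum_j a j x *: e j).
Proof.
move=> oU sa.
have der_sum (b : 'I_d -> E -> R) x v : (forall j, derivable (b j) x v) ->
    is_derive x v (fun x => \sum_j b j x *: e j) (\sum_j 'D_v (b j) x *: e j).
  move=> db; have := @is_derive_sum R E V d (fun j x => b j x *: e j) x v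
    (fun j => 'D_v (b j) x *: e j) _.
  rewrite (_ : \sum_i (fun x0 => b i x0 *: e i) = (fun x => \sum_j b j x *: e j)).
    apply=> j.
    have lin : linear (fun a : R => a *: e j).
      by move=> c u w; rewrite scalerDl scalerA.
    pose q : {linear R -> V} := HB.pack (fun a : R => a *: e j)
      (GRing.isLinear.Build R R V _ (fun a : R => a *: e j) lin).
    have /derivableP hb := db j.
    by apply: (@is_derive_lin _ _ _ q _ _ _ _ _ hb); exact: scalel_continuous.
  by apply/funext => y; rewrite fct_sumE.
have pE l x : U x -> pderivs l (fun x => \sum_j a j x *: e j) x = \sum_j pderivs l (a j) x *: e j.
  elim: l x => [//|i l IH] x Ux.
  apply: (etrans (@pderivs_eq_on _ _ _ U (pderivs l (fun x => \sum_j a j x *: e j)) _ oU IH [:: i] x Ux)).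
  have [|_ /= h] := der_sum (fun j => pderivs l (a j)) x (delta_mx 0 i); last exact: h.
  by move=> j; have [_] := sa j l x Ux; exact.
apply: smooth_on_via => // l; exists (fun x => \sum_j pderivs l (a j) x *: e j) => x Ux.
split; first exact: pE.
- apply: (@cvg_bigsum _ _ (nbhs x) _ _ _ _ (fun j x => pderivs l (a j) x *: e j)) => j.
  apply: (@continuous_comp _ _ _ (pderivs l (a j)) (fun b : R => b *: e j)).
    by have [] := sa j l x Ux.
  exact: scalel_continuous.
- move=> i; have [|h _] := der_sum (fun j => pderivs l (a j)) x (delta_mx 0 i); last exact: h.
  by move=> j; have [_] := sa j l x Ux; exact.
Qed.

(** Boman's theorem in the form used below: the left side serves constructions and compositions, the
    right side derivatives and estimates. *)
Lemma asmooth_smooth V U (f : E -> V) : fincoord V -> open U -> asmooth U f <-> smooth_on U f.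
Proof.
move=> [d [p [e [cp pe]]]] oU.
have fE : f = fun x => \sum_j p j (f x) *: e j by apply/funext => x; rewrite -pe.
split=> sf; rewrite fE.
  by apply: smooth_on_lincomb => // j; apply: asmooth_smooth_R => //; exact: asmooth_lin.
apply: asmooth_sum => j; apply: asmooth_scale; last exact: asmooth_cst.
by apply: smooth_asmooth_R => //; exact: smooth_on_lin.
Qed.

Lemma asmooth_pderiv V U (f : E -> V) i : fincoord V -> open U ->
  asmooth U f -> asmooth U (pderiv i f).
Proof.
by move=> fV oU /(asmooth_smooth _ fV oU) sf; apply/(asmooth_smooth _ fV oU); exact: smooth_on_pderiv.
Qed.

Lemma asmooth_pderivs V U (f : E -> V) l : fincoord V -> open U ->
  asmooth U f -> asmooth U (pderivs l f).
Proof. by move=> fV oU sf; elim: l => //= i l IH; exact: asmooth_pderiv. Qed.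

Lemma asmooth_continuous V U (f : E -> V) x : fincoord V -> open U ->
  asmooth U f -> U x -> {for x, continuous f}.
Proof. by move=> fV oU /(asmooth_smooth _ fV oU) sf Ux; have [] := sf [::] x Ux. Qed.

Lemma asmooth_chain V U (f : E -> V) (c : R -> E) t d : fincoord V -> open U -> asmooth U f ->
  U (c t) -> der c t d -> der (fun t => f (c t)) t (\sum_i d 0 i *: pderiv i f (c t)).
Proof.
move=> fV oU sf Uct hd; have sf' : smooth_on U f by apply/(asmooth_smooth _ fV oU).
move: fV => [m [p [e [cp pe]]]].
have fE : (fun t => f (c t)) = fun t => \sum_j p j (f (c t)) *: e j.
  by apply/funext => u; rewrite -pe.
have dj j : der (fun t => p j (f (c t))) t (\sum_i d 0 i * p j (pderiv i f (c t))).
  have := smooth_chain_R oU (smooth_on_lin (cp j) oU sf') Uct hd.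
  have E1 i : pderiv i (fun x => p j (f x)) (c t) = p j (pderiv i f (c t)).
    exact: (@pderivs_lin _ (p j) U f [:: i] (cp j) oU sf' _ Uct).
  by under eq_bigr do rewrite E1.
have -> : \sum_i d 0 i *: pderiv i f (c t) =
    \sum_j (\sum_i d 0 i * p j (pderiv i f (c t))) *: e j.
  under [RHS]eq_bigr do rewrite scaler_suml.
  rewrite exchange_big /=; apply: eq_bigr => i _.
  rewrite [in LHS](pe (pderiv i f (c t))) scaler_sumr; apply: eq_bigr => j _.
  by rewrite scalerA.
rewrite fE; have : forall s : seq 'I_m, der (fun t => \sum_(j <- s) p j (f (c t)) *: e j) t
    (\sum_(j <- s) (\sum_i d 0 i * p j (pderiv i f (c t))) *: e j).
  elim=> [|j s IH].
    by under eq_fun do rewrite big_nil; rewrite big_nil; exact: der_cst.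
  under eq_fun do rewrite big_cons; rewrite big_cons; apply: der_add => //.
  have := der_scale (dj j) (der_cst (e j) t); by rewrite scaler0 addr0.
exact.
Qed.

Lemma der_line (x v : E) (t : R) : der (fun t : R => x + t *: v) t v.
Proof.
have := der_add (der_cst x t) (der_scale (der_id t) (der_cst v t)).
by rewrite scaler0 addr0 add0r scale1r.
Qed.

Lemma scurve_line (x v : E) : scurve (fun t : R => x + t *: v).
Proof.
apply: scurve_add; first exact: scurve_cst.
by apply: scurve_scale; [exact: scurve_id|exact: scurve_cst].
Qed.

Lemma der_line_derive V (f : E -> V) x v d : der (fun t : R => f (x + t *: v)) 0 d <->
  is_derive x v f d.
Proof.
have E1 : (fun h : R => h^-1 *: (((fun t : R => f (x + t *: v)) \o shift 0) (h *: 1) - f (x + 0 *: v))) =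
          (fun h : R => h^-1 *: ((f \o shift x) (h *: v) - f x)).
  apply/funext => h /=; rewrite addr0 scale0r addr0 [x + _]addrC.
  by rewrite (_ : h *: 1 = h) //; exact: mulr1.
by split=> -[d1 d2]; split; [move: d1; rewrite /derivable E1|move: d2; rewrite /derive E1
  |rewrite /derivable E1|rewrite /derive E1].
Qed.

Lemma pderiv_der V (f : E -> V) i x d : der (fun t : R => f (x + t *: delta_mx 0 i)) 0 d ->
  pderiv i f x = d.
Proof. by move=> /der_line_derive [_]. Qed.

Lemma derive_dir V U (f : E -> V) x v : fincoord V -> open U -> asmooth U f -> U x ->
  der (fun t : R => f (x + t *: v)) 0 (\sum_i v 0 i *: pderiv i f x).
Proof.
move=> fV oU sf Ux; have Ux' : U (x + (0 : R) *: v) by rewrite scale0r addr0.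
by have := asmooth_chain fV oU sf Ux' (der_line x v 0); rewrite scale0r addr0.
Qed.

Lemma pderiv_swap V U (f : E -> V) i j x : fincoord V -> open U -> asmooth U f -> U x ->
  pderiv i (pderiv j f) x = pderiv j (pderiv i f) x.
Proof.
move=> fV oU sf Ux; have /(asmooth_smooth _ fV oU) sf' := sf.
move: fV => [m [p [e [cp pe]]]].
have inj v w : (forall k, p k v = p k w) -> v = w.
  by move=> h; rewrite (pe v) (pe w); apply: eq_bigr => k _; rewrite h.
apply: inj => k; have h l := esym (@pderivs_lin V (p k) U f l (cp k) oU sf' x Ux).
apply: (etrans (h [:: i; j])); apply: etrans (esym (h [:: j; i])).
by apply: pderiv_swap_R oU _ Ux; exact: asmooth_lin.
Qed.

Lemma pderiv_cst V (v : V) i (x : E) : pderiv i (fun=> v) x = 0.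
Proof. by apply: pderiv_der; exact: der_cst. Qed.

End VectorValued.

(** * Derivatives of compositions *)

Section Directional.
Local Open Scope ring_scope.
Local Open Scope classical_set_scope.
Context {R : realType} {n : nat}.
Local Notation E := 'rV[R]_n.
Implicit Types (V : normedModType R) (U : set E).

(** Arbitrary directions are allowed because d_{x+y} is a derivative in a diagonal direction of the
    space of pairs (x, y). *)
Definition ddir V (v : E) (f : E -> V) : E -> V := fun x => 'D_v f x.

Definition ddirs V (l : seq E) (f : E -> V) : E -> V := foldr (@ddir V) f l.

Lemma ddir_der V (f : E -> V) v x d : der (fun t : R => f (x + t *: v)) 0 d -> ddir v f x = d.
Proof. by move=> /der_line_derive [_]. Qed.

Lemma ddirE V U (f : E -> V) v x : fincoord V -> open U -> asmooth U f -> U x ->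
  ddir v f x = \sum_i v 0 i *: pderiv i f x.
Proof. by move=> fV oU sf Ux; apply: ddir_der; exact: derive_dir fV oU sf Ux. Qed.

Lemma der_ddir V U (f : E -> V) v x : fincoord V -> open U -> asmooth U f -> U x ->
  der (fun t : R => f (x + t *: v)) 0 (ddir v f x).
Proof.
by move=> fV oU sf Ux; rewrite (ddirE v fV oU sf Ux); exact: derive_dir fV oU sf Ux.
Qed.

Lemma asmooth_ddir V U (f : E -> V) v : fincoord V -> open U ->
  asmooth U f -> asmooth U (ddir v f).
Proof.
move=> fV oU sf; apply: (@asmooth_ext _ _ _ _ (fun x => \sum_i v 0 i *: pderiv i f x)).
  by move=> x Ux; apply/esym; exact: ddirE fV oU sf Ux.
apply: asmooth_sum => i; apply: asmooth_scale; first exact: asmooth_cst.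
exact: asmooth_pderiv.
Qed.

Lemma asmooth_ddirs V U (f : E -> V) l : fincoord V -> open U ->
  asmooth U f -> asmooth U (ddirs l f).
Proof. by move=> fV oU sf; elim: l => //= i l IH; exact: asmooth_ddir. Qed.

Lemma ddirs_eq_on V U (f g : E -> V) : open U -> (forall x, U x -> f x = g x) ->
  forall l x, U x -> ddirs l f x = ddirs l g x.
Proof.
move=> oU fg; elim=> [|v l IH] x Ux; first exact: fg.
apply: near_eq_derive; have : nbhs x U by exact: open_nbhs_nbhs.
by apply: filterS.
Qed.

Lemma ddir_eq_on V U (f g : E -> V) v x : open U -> (forall x, U x -> f x = g x) -> U x ->
  ddir v f x = ddir v g x.
Proof. by move=> oU fg Ux; exact: (ddirs_eq_on oU fg [:: v] Ux). Qed.

Lemma ddir_scale V U (a : E -> R) (f : E -> V) v x : fincoord V -> open U ->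
  asmooth U a -> asmooth U f -> U x ->
  ddir v (fun x => a x *: f x) x = ddir v a x *: f x + a x *: ddir v f x.
Proof.
move=> fV oU sa sf Ux; apply: ddir_der.
have := der_scale (der_ddir v fincoord_real oU sa Ux) (der_ddir v fV oU sf Ux).
by rewrite scale0r addr0.
Qed.

Lemma ddir_add V U (f g : E -> V) v x : fincoord V -> open U ->
  asmooth U f -> asmooth U g -> U x ->
  ddir v (fun x => f x + g x) x = ddir v f x + ddir v g x.
Proof.
move=> fV oU sf sg Ux; apply: ddir_der.
by have := der_add (der_ddir v fV oU sf Ux) (der_ddir v fV oU sg Ux).
Qed.

Lemma ddir_cst V (w : V) v (x : E) : ddir v (fun=> w) x = 0.
Proof. by apply: ddir_der; exact: der_cst. Qed.

Lemma ddir_sum V U (I : Type) (s : seq I) (f : I -> E -> V) v x : fincoord V -> open U ->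
  (forall j, asmooth U (f j)) -> U x ->
  ddir v (fun x => \sum_(j <- s) f j x) x = \sum_(j <- s) ddir v (f j) x.
Proof.
move=> fV oU sf Ux; elim: s => [|j s IH].
  by under eq_fun do rewrite big_nil; rewrite big_nil ddir_cst.
under eq_fun do rewrite big_cons; rewrite big_cons -IH.
by apply: (ddir_add v fV oU _ _ Ux) => //; exact: asmooth_sum.
Qed.

Lemma ddir_swap V U (f : E -> V) u v x : fincoord V -> open U -> asmooth U f -> U x ->
  ddir u (ddir v f) x = ddir v (ddir u f) x.
Proof.
move=> fV oU sf Ux.
have main a b : ddir a (ddir b f) x =
    \sum_i \sum_j (a 0 i * b 0 j) *: pderiv i (pderiv j f) x.
  rewrite (@ddir_eq_on _ _ _ (fun y => \sum_j b 0 j *: pderiv j f y) a x oU); last exact: Ux.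
    rewrite (@ddir_sum _ U) //; last first.
      by move=> j; apply: asmooth_scale; [exact: asmooth_cst|exact: asmooth_pderiv].
    rewrite exchange_big /=; apply: eq_bigr => j _.
    rewrite (@ddir_scale _ U) //; [|exact: asmooth_cst|exact: asmooth_pderiv].
    rewrite ddir_cst scale0r add0r (@ddirE _ U) //; last exact: asmooth_pderiv.
    rewrite scaler_sumr; apply: eq_bigr => i _; by rewrite scalerA mulrC.
  by move=> y Uy; exact: ddirE fV oU sf Uy.
rewrite !main exchange_big; apply: eq_bigr => i _; apply: eq_bigr => j _.
by rewrite (mulrC (u 0 j)) (pderiv_swap j i fV oU sf Ux).
Qed.

Lemma ddirs_front V U (f : E -> V) l1 v l2 x : fincoord V -> open U -> asmooth U f -> U x ->
  ddirs (l1 ++ v :: l2) f x = ddirs (v :: l1 ++ l2) f x.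
Proof.
move=> fV oU sf; elim: l1 x => [//|w l1 IH] x Ux.
apply: (etrans (@ddirs_eq_on _ U (ddirs (l1 ++ v :: l2) f) _ oU IH [:: w] x Ux)).
by apply: ddir_swap Ux => //; exact: asmooth_ddirs.
Qed.

Lemma ddirs_back V U (f : E -> V) l1 v l2 x : fincoord V -> open U -> asmooth U f -> U x ->
  ddirs (l1 ++ v :: l2) f x = ddirs (l1 ++ l2) (ddir v f) x.
Proof.
move=> fV oU sf Ux; have -> : ddirs (l1 ++ l2) (ddir v f) x = ddirs ((l1 ++ l2) ++ [:: v]) f x.
  exact: (congr1 (fun h : E -> V => h x) (esym (@foldr_cat _ _ (@ddir V) f (l1 ++ l2) [:: v]))).
by rewrite !(@ddirs_front _ U) // cats0.
Qed.

Lemma ddirs_perm V U (f : E -> V) l l' : fincoord V -> open U -> asmooth U f ->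
  perm_eq l l' -> forall x, U x -> ddirs l f x = ddirs l' f x.
Proof.
move=> fV oU sf; elim: l l' => [|v l IH] l' ll' x Ux.
  by move: ll'; rewrite perm_sym => /perm_nilP ->.
have : v \in l' by rewrite -(perm_mem ll') inE eqxx.
move=> vl'; case/splitPr: vl' ll' => l1 l2 ll'.
rewrite (ddirs_front _ _ _ fV oU sf Ux); apply: (@ddirs_eq_on _ U (ddirs l f) _ oU _ [:: v] x Ux).
by apply: IH; rewrite -(perm_cons v) (permPl ll') perm_catC /= perm_cons perm_catC.
Qed.

Lemma pderivs_perm V U (f : E -> V) l l' : fincoord V -> open U -> asmooth U f ->
  perm_eq l l' -> forall x, U x -> pderivs l f x = pderivs l' f x.
Proof.
move=> fV oU sf ll' x Ux.
have pE (q : seq 'I_n) : pderivs q f = ddirs [seq delta_mx 0 i | i <- q] f by elim: q => //= i q ->.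
by rewrite !pE; exact: ddirs_perm fV oU sf (perm_map _ ll') x Ux.
Qed.

End Directional.

Section Composition.
Local Open Scope ring_scope.
Local Open Scope classical_set_scope.
Context {R : realType} {n m : nat}.
Local Notation E := 'rV[R]_n.
Local Notation E' := 'rV[R]_m.
Implicit Types (V : normedModType R).
Variables (U : set E') (W : set E) (nu : E' -> E).
Hypotheses (oU : open U) (oW : open W) (snu : asmooth U nu) (nuW : forall y, U y -> W (nu y)).

Lemma asmooth_comp V (g : E -> V) : asmooth W g -> asmooth U (fun y => g (nu y)).
Proof.
move=> /asmoothP sg; apply/asmoothP => c sc cU.
by apply: (sg (fun t => nu (c t))) => [|t]; [move/asmoothP: snu; exact|exact: nuW].
Qed.

Lemma asmooth_nu_coord v i : asmooth U (fun y => ddir v nu y 0 i).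
Proof.
have /asmoothP h := asmooth_ddir v (@fincoord_row R n) oU snu.
by apply/asmoothP => c sc cU; apply: scurve_coord; exact: h.
Qed.

Lemma ddir_comp V (g : E -> V) v y : fincoord V -> asmooth W g -> U y ->
  ddir v (fun y => g (nu y)) y = \sum_i ddir v nu y 0 i *: pderiv i g (nu y).
Proof.
move=> fV sg Uy; apply: ddir_der.
have hd := der_ddir v (@fincoord_row R n) oU snu Uy.
have := asmooth_chain fV oW sg _ hd.
by rewrite scale0r addr0; apply; exact: nuW.
Qed.

End Composition.

Section CompositionWords.
Local Open Scope ring_scope.
Local Open Scope classical_set_scope.
Context {R : realType} {n : nat}.
Local Notation E := 'rV[R]_n.
Variables (U W : set E) (nu : E -> E) (j : E -> R).
Hypotheses (oU : open U) (oW : open W) (snu : asmooth U nu) (nuW : forall y, U y -> W (nu y)).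
Hypothesis (sj : asmooth U j).

(** The iterated chain rule. The index type, the coefficients and the words are chosen before g and
    even before its codomain; this makes the estimates for families of kernels uniform. *)
Lemma pderivs_comp (l : seq 'I_n) : exists (I : finType) (c : I -> E -> R) (w : I -> seq 'I_n),
  (forall k, asmooth U (c k) /\ (size (w k) <= size l)%N) /\
  forall (V : normedModType R) (g : E -> V), fincoord V -> asmooth W g -> forall y, U y ->
    pderivs l (fun y => j y *: g (nu y)) y = \sum_k c k y *: pderivs (w k) g (nu y).
Proof.
elim: l => [|i l [I [c [w [h1 h2]]]]].
  exists unit, (fun=> j), (fun=> [::]); split=> // V g fV sg y Uy.
  by rewrite big_const card_unit /= addr0.
(* In the left summands the new derivative falls on the coefficient, in the right ones the chain
   rule applies. *)
exists (I + I * 'I_n)%type,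
  (fun k => match k with inl k => pderiv i (c k)
                       | inr (k, q) => fun y => c k y * ddir (delta_mx 0 i) nu y 0 q end),
  (fun k => match k with inl k => w k | inr (k, q) => q :: w k end); split.
  move=> [k|[k q]]; have [s1 s2] := h1 k; split=> //.
  - by apply: asmooth_pderiv => //; exact: fincoord_real.
  - exact: leqW.
  - by apply: asmooth_mul => //; exact: asmooth_nu_coord.
move=> V g fV sg y Uy; have sgk k : asmooth W (pderivs (w k) g) by exact: asmooth_pderivs.
have sgn k : asmooth U (fun y => pderivs (w k) g (nu y)) by exact: asmooth_comp (sgk k).
apply: (etrans (@pderivs_eq_on _ _ _ U _ _ oU (h2 V g fV sg) [:: i] y Uy)).
transitivity (\sum_k (pderiv i (c k) y *: pderivs (w k) g (nu y) +
  \sum_q (c k y * ddir (delta_mx 0 i) nu y 0 q) *: pderivs (q :: w k) g (nu y))); last first.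
  rewrite big_split /= big_sumType; congr (_ + _).
  by rewrite pair_big; apply: eq_bigr => -[k q].
apply: (etrans (@ddir_sum _ _ _ U _ _ _ _ _ fV oU _ Uy)).
  by move=> k; apply: asmooth_scale => //; have [] := h1 k.
apply: eq_bigr => k _; rewrite (@ddir_scale _ _ _ U) //; last by have [] := h1 k.
congr (_ + _); rewrite (@ddir_comp _ _ _ U W) // scaler_sumr.
by apply: eq_bigr => q _; rewrite scalerA.
Qed.

End CompositionWords.

(** * Words of derivatives and multi-indices *)

Section MultiIndices.
Context {R : realType} {n : nat}.

(** Derivatives commute, so a word matters only through its letter counts. The proofs use words, the
    definitions multi-indices. *)
Definition mindex_of (l : seq 'I_n) : mindex n := [ffun i => count_mem i l].

Lemma count_mseq (a : mindex n) i : count_mem i (mseq a) = a i.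
Proof.
rewrite /mseq count_flatten -map_comp.
rewrite (eq_map (_ : _ =1 (fun k => (k == i) * a k)%N)); last first.
  by move=> k /=; rewrite count_nseq.
rewrite sumnE big_map big_enum /= (bigD1 i) //= eqxx mul1n big1 ?addn0 // => k ki.
by rewrite (negbTE ki).
Qed.

Lemma perm_mindex_of (l : seq 'I_n) : perm_eq l (mseq (mindex_of l)).
Proof. by apply/allP => i _ /=; rewrite count_mseq ffunE. Qed.

Lemma size_mseq (a : mindex n) : size (mseq a) = mlen a.
Proof.
rewrite /mseq size_flatten /shape -map_comp sumnE big_map big_enum /=.
by apply: eq_bigr => i _; rewrite size_nseq.
Qed.

Lemma mlen_mindex_of (l : seq 'I_n) : mlen (mindex_of l) = size l.
Proof. by rewrite -size_mseq (perm_size (perm_mindex_of l)). Qed.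

Lemma pderivs_mderiv (V : normedModType R) (U : set 'rV[R]_n) (f : 'rV[R]_n -> V) l x :
  fincoord V -> open U -> asmooth U f -> U x -> pderivs l f x = mderiv (mindex_of l) f x.
Proof. by move=> fV oU sf Ux; exact: pderivs_perm fV oU sf (perm_mindex_of l) x Ux. Qed.

End MultiIndices.

(** * From local bounds to bounds on compact sets *)

Section Compactness.
Local Open Scope ring_scope.
Local Open Scope classical_set_scope.
Context {R : realType} {n : nat}.
Local Notation E := 'rV[R]_n.

(** Finite subcovers packaged as an induction principle on sets. It serves boundedness, O-estimates,
    LSK1 and LSK2 alike. *)
Lemma compact_local_ind (L : set E) (P : set E -> Prop) : compact L ->
  P set0 -> (forall A B, P A -> P B -> P (A `|` B)) -> (forall A B, A `<=` B -> P B -> P A) ->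
  (forall x, L x -> exists2 r : R, 0 < r & P [set y | `|y - x| < r]) -> P L.
Proof.
move=> cL P0 PU PS hloc.
have /choice[r hr] : forall x, exists r : R, L x -> 0 < r /\ P [set y | `|y - x| < r].
  move=> x; have [Lx|nLx] := pselect (L x); last by exists 1.
  by have [r r0 hP] := hloc x Lx; exists r.
pose f (x : E) : set E := if `[< L x >] then ball x (r x) else set0.
have fP x : L x -> P (f x).
  move=> Lx; rewrite /f asboolT //; have [_] := hr x Lx; apply: PS => y.
  by rewrite -ball_normE /= distrC.
have : cover_compact L by rewrite -compact_cover.
move=> /(_ E L f) [||D DL LD].
- by move=> x Lx; rewrite /f asboolT //; apply: ball_open; have [] := hr x Lx.
- move=> x Lx; exists x => //; rewrite /f asboolT //; apply: ballxx; by have [] := hr x Lx.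
apply: (PS _ _ LD).
have key (s : seq E) : (forall x, x \in s -> L x) -> P (\bigcup_(x in [set` s]) f x).
  elim: s => [|x s IH] hs; first by apply: PS P0 => y [z].
  apply: (PS _ (f x `|` \bigcup_(x in [set` s]) f x)).
    move=> y [z /=]; rewrite inE => /orP[/eqP->|zs] fy; first by left.
    by right; exists z.
  apply: PU; first by apply: fP; apply: hs; rewrite inE eqxx.
  by apply: IH => z zs; apply: hs; rewrite inE zs orbT.
by apply: (key (finmap.enum_fset D)) => x xD; have := DL x xD; rewrite inE.
Qed.

Lemma closed_norm_ball (x0 : E) (r : R) : closed [set y | `|y - x0| <= r].
Proof.
have := @preimage_closed E R (fun y => `|y - x0|) [set z | z <= r].
apply; last exact: closed_le.
move=> y _; apply/continuous_normP => e e0; exists e => // z /ltW zy.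
apply: le_trans (ler_dist_dist _ _) _.
by rewrite opprB addrA subrK.
Qed.

Lemma compact_norm_ball (x0 : E) (r : R) : compact [set y | `|y - x0| <= r].
Proof.
apply: bounded_closed_compact; last exact: closed_norm_ball.
exists (`|x0| + r); split; first exact: num_real.
move=> M hM y /= hy; apply: le_trans (ltW hM).
by rewrite -{1}(subrK x0 y) addrC; apply: le_trans (ler_normD _ _) _; rewrite lerD2l.
Qed.

Lemma open_ball_inside (W : set E) (x0 : E) : open W -> W x0 ->
  exists2 r : R, 0 < r & forall y, `|y - x0| <= r -> W y.
Proof.
move=> oW Wx; have /near_normP[d d0 dW] : nbhs x0 W by exact: open_nbhs_nbhs.
by exists (d / 2) => [|y yd]; [rewrite divr_gt0|apply: dW; lra].
Qed.

Lemma open_interior (W : set E) : open W -> W° = W.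
Proof. by move=> oW; apply/seteqP; split=> x; [exact: interior_subset|move=> Wx; exact: open_nbhs_nbhs]. Qed.

Lemma cpt_inside_ball (W : set E) (x0 : E) (r : R) : open W ->
  (forall y, `|y - x0| <= r -> W y) -> cpt_inside [set y | `|y - x0| <= r] W.
Proof.
by move=> oW h; split; [exact: compact_norm_ball|rewrite open_interior // => y; exact: h].
Qed.

Lemma compact_image (W L : set E) (f : E -> E) : open W -> asmooth W f -> compact L -> L `<=` W ->
  compact (f @` L).
Proof.
move=> oW sf cL LW; apply: continuous_compact => //.
apply: continuous_in_subspaceT => x; rewrite inE => Lx.
exact: asmooth_continuous (@fincoord_row R n) oW sf (LW _ Lx).
Qed.

Lemma asmooth_bounded (V : normedModType R) (W L : set E) (f : E -> V) : fincoord V ->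
  open W -> asmooth W f -> compact L -> L `<=` W ->
  exists2 C : R, 0 < C & forall x, L x -> `|f x| <= C.
Proof.
move=> fV oW sf cL LW.
apply: (@compact_local_ind L (fun A => exists2 C : R, 0 < C & forall x, A x -> `|f x| <= C)) => //.
- by exists 1.
- move=> A B [C C0 hC] [D D0 hD]; exists (C + D) => [|x [Ax|Bx]]; first exact: addr_gt0.
    by apply: le_trans (hC x Ax) _; rewrite lerDl ltW.
  by apply: le_trans (hD x Bx) _; rewrite lerDr ltW.
- by move=> A B AB [C C0 hC]; exists C => // x Ax; exact/hC/AB.
move=> x Lx; have cf := asmooth_continuous fV oW sf (LW _ Lx).
have /continuous_normP /(_ _ ltr01) [d d0 hd] := cf.
exists d => //; exists (`|f x| + 1) => [|y /= yd]; first by rewrite ltr_wpDl.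
by rewrite -{1}(subrK (f x) (f y)) addrC; apply: le_trans (ler_normD _ _) _; rewrite lerD2l hd.
Qed.

Lemma uniform_bigO_local (L : set E) (f : R -> E -> R) (g : R -> R) :
  compact L -> (forall eps, 0 < eps <= 1 -> 0 <= g eps) ->
  (forall x, L x -> exists2 r : R, 0 < r & uniform_bigO [set y | `|y - x| <= r] f g) ->
  uniform_bigO L f g.
Proof.
move=> cL g0 h; apply: (@compact_local_ind L (fun A => uniform_bigO A f g)) => //.
- by exists 1 => //; exists 1.
- move=> A B [e1 e10 [C1 C10 h1]] [e2 e20 [C2 C20 h2]].
  exists (Num.min e1 e2); first by rewrite lt_min e10.
  exists (C1 + C2); first exact: addr_gt0.
  move=> eps eps1; rewrite le_min => /andP[ee1 ee2] x [Ax|Bx].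
    by apply: le_trans (h1 _ eps1 ee1 x Ax) _; rewrite mulrDl lerDl mulr_ge0 ?g0 // ltW.
  by apply: le_trans (h2 _ eps1 ee2 x Bx) _; rewrite mulrDl lerDr mulr_ge0 ?g0 // ltW.
- move=> A B AB [e1 e10 [C1 C10 h1]]; exists e1 => //; exists C1 => // eps e1' e2' x Ax.
  exact/h1/AB.
move=> x Lx; have [r r0 [e1 e10 [C1 C10 h1]]] := h x Lx; exists r => //.
by exists e1 => //; exists C1 => // eps e1' e2' y /= /ltW yr; exact: h1.
Qed.

End Compactness.

Section ScalarModulus.
Local Open Scope ring_scope.
Context {R : realType}.
Variable s : scalars.
Local Notation K := (scalar_of R s).

(** Modulus and sup norm are equivalent with factor 2: estimates are made in the norm and converted
    where the definitions speak of [sabs]. *)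
Lemma norm_le_sabs (z : K) : `|z| <= sabs z.
Proof.
case: s z => [z //|[a b]]; rewrite prod_normE /= ge_max -!sqrtr_sqr !ler_sqrt;
  by rewrite ?addr_ge0 ?sqr_ge0 // ?lerDl ?lerDr ?sqr_ge0.
Qed.

Lemma sabs_le_norm (z : K) : sabs z <= 2 * `|z|.
Proof.
case: s z => [z|[a b]]; first by rewrite /= ler_peMl // ler1n.
rewrite prod_normE /=; set M := Num.max _ _.
have aM : `|a| <= M by rewrite le_max lexx.
have bM : `|b| <= M by rewrite le_max lexx orbT.
have M0 : 0 <= M by apply: le_trans aM.
rewrite -[leRHS]ger0_norm ?mulr_ge0 // -sqrtr_sqr ler_sqrt ?sqr_ge0 //.
rewrite -[a ^+ 2]real_normK ?num_real // -[b ^+ 2]real_normK ?num_real //.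
have a2 : `|a| ^+ 2 <= M ^+ 2 by apply: lerXn2r.
have b2 : `|b| ^+ 2 <= M ^+ 2 by apply: lerXn2r.
have := sqr_ge0 M; rewrite exprMn; move: a2 b2; nra.
Qed.

End ScalarModulus.

(** * Push-forward of test functions *)

Section Jacobian.
Local Open Scope ring_scope.
Local Open Scope classical_set_scope.
Context {R : realType} {n : nat}.
Local Notation E := 'rV[R]_n.

(** Row k holds the derivatives in direction k, since matrices act on row vectors from the right.
    [jacobianE] identifies it with the matrix of the total differential, which occurs in
    [push_test]. *)
Definition jac (f : E -> E) (x : E) : 'M[R]_n :=
  \matrix_(k, m) pderiv k (fun y => f y 0 m) x.

Lemma asmooth_comp_coord (p q : nat) (U : set 'rV[R]_p) (f : 'rV[R]_p -> 'rV[R]_q) m :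
  asmooth U f -> asmooth U (fun y => f y 0 m).
Proof. by move=> /asmoothP h; apply/asmoothP => c sc cU; apply: scurve_coord; exact: h. Qed.

Lemma pderiv_coord (p q : nat) (U : set 'rV[R]_p) (f : 'rV[R]_p -> 'rV[R]_q) k m x :
    open U -> asmooth U f -> U x ->
  pderiv k (fun y => f y 0 m) x = ddir (delta_mx 0 k) f x 0 m.
Proof.
move=> oU sf Ux; apply: pderiv_der.
exact: der_coord (der_ddir (delta_mx 0 k) (@fincoord_row R q) oU sf Ux).
Qed.

Lemma norm_mulmx_le (A : 'M[R]_n) : exists2 C : R, 0 < C & forall h : E, `|h *m A| <= C * `|h|.
Proof.
exists (1 + \sum_k \sum_m `|A k m|) => [|h].
  by rewrite ltr_pwDl // sumr_ge0 // => k _; rewrite sumr_ge0.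
have S0 : 0 <= \sum_k \sum_m `|A k m| by rewrite sumr_ge0 // => k _; rewrite sumr_ge0.
apply: row_norm_le => [|m]; first by rewrite mulr_ge0 // addr_ge0.
rewrite mxE; apply: le_trans (ler_norm_sum _ _ _) _.
rewrite mulrDl mul1r mulr_suml -[leLHS]add0r lerD //.
apply: ler_sum => k _; rewrite normrM mulrC; apply: ler_pM => //; last exact: coord_norm_le.
by rewrite (bigD1 m) //= lerDl sumr_ge0.
Qed.

Lemma smooth_jac (U : set E) (f : E -> E) x : open U -> asmooth U f -> U x ->
  forall e : R, 0 < e -> exists2 d : R, 0 < d & forall y, `|y - x| < d ->
    `|f y - f x - (y - x) *m jac f x| <= e * `|y - x|.
Proof.
move=> oU sf Ux e e0.
have [r r0 rU] := open_ball_inside oU Ux.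
have sfm m : smooth_on U (fun y => f y 0 m).
  by apply: asmooth_smooth_R => //; exact: asmooth_comp_coord.
(* There are n summands; n + 1 avoids a division by 0. *)
have e1 : 0 < e / n.+1%:R by rewrite divr_gt0.
have /choice[d hd] : forall km : 'I_n * 'I_n, exists d : R, 0 < d /\ forall y, `|y - x| < d ->
    `|pderiv km.1 (fun y => f y 0 km.2) y - pderiv km.1 (fun y => f y 0 km.2) x| <= e / n.+1%:R.
  move=> [k m]; have [c _] := sfm m [:: k] x Ux.
  by have /continuous_normP /(_ _ e1) [d d0 h] := c; exists d.
pose D := \big[Num.min/r]_km d km.
have D0 : 0 < D by apply: lt_bigmin => // km _; have [] := hd km.
exists D => // y yD.
have yr : `|y - x| < r by apply: lt_le_trans yD _; exact: bigmin_le_id.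
apply: row_norm_le => [|m]; first by rewrite mulr_ge0 // ltW.
have df z i : `|z - x| < r -> derivable (fun y => f y 0 m) z (delta_mx 0 i).
  by move=> zr; have [_ h] := sfm m [::] z (rU _ (ltW zr)); exact: h.
have [xi hxi hE] := telescope_pderiv df yr.
rewrite !mxE hE -sumrB; apply: le_trans (ler_norm_sum _ _ _) _.
apply: (@le_trans _ _ (\sum_(k < n) e / n.+1%:R * `|y - x|)).
  apply: ler_sum => k _; rewrite !mxE -mulrBr normrM mulrC.
  apply: ler_pM => //; last by have := coord_norm_le (y - x) k; rewrite !mxE.
  have [_ h] := hd (k, m); apply: h; apply: le_lt_trans (hxi k) _.
  by apply: lt_le_trans yD _; exact: bigmin_le_cond.
rewrite sumr_const card_ord -[_ *+ n]mulr_natl mulrA; apply: ler_wpM2r => //.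
by rewrite mulrCA ler_piMr ?(ltW e0) // ler_pdivrMr ?ltr0n // mul1r ler_nat leqnSn.
Qed.

Lemma jacobianE (U : set E) (f : E -> E) x : open U -> asmooth U f -> U x ->
  jacobian f x = jac f x.
Proof.
move=> oU sf Ux.
have cA : continuous (mulmxr (jac f x) : E -> E).
  move=> z; apply/continuous_normP => e e0; have [C C0 hC] := norm_mulmx_le (jac f x).
  exists (e / C) => [|y yz]; first exact: divr_gt0.
  rewrite /= -mulmxBl; apply: le_trans (hC _) _.
  by rewrite -ler_pdivlMl // mulrC ltW.
have dE : 'd f x = mulmxr (jac f x) :> (E -> E).
  apply: diff_unique => //; apply/eqaddoP => e e0.
  have [d d0 h] := smooth_jac oU sf Ux e0.
  apply/near_normP; exists d => // y; rewrite subr0 => yd.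
  have := h (y + x); rewrite addrK => /(_ yd).
  by rewrite /= !fctE /= opprD addrA.
apply/matrixP => i j; rewrite /jacobian /lin1_mx !mxE dE /= -rowE.
by rewrite !mxE.
Qed.

Lemma asmooth_det (U : set E) (A : E -> 'M[R]_n) :
  (forall i j, asmooth U (fun x => A x i j)) -> asmooth U (fun x => \det (A x)).
Proof.
move=> h; apply: (@asmooth_sum _ _ _ _ _ (index_enum _)
   (fun (s : {perm 'I_n}) x => (-1) ^+ s * \prod_i A x i (s i))) => s.
by apply: asmooth_mul; [exact: asmooth_cst|exact: asmooth_prod].
Qed.

Lemma asmooth_jac (U : set E) (f : E -> E) i j : open U -> asmooth U f ->
  asmooth U (fun x => jac f x i j).
Proof.
move=> oU sf; apply: (@asmooth_ext _ _ _ _ (pderiv i (fun y => f y 0 j))).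
  by move=> x _; rewrite mxE.
by apply: asmooth_pderiv => //; [exact: fincoord_real|exact: asmooth_comp_coord].
Qed.

(** A nowhere vanishing g has locally constant sign, so its absolute value is locally a constant
    multiple of g. *)
Lemma scurve_abs (g : R -> R) : scurve g -> (forall t, g t != 0) -> scurve (fun t => `|g t|).
Proof.
move=> sg g0; apply: scurve_local => t0; exists (fun t => Num.sg (g t0) * g t).
  by apply: scurve_mul => //; exact: scurve_cst.
have /continuous_normP /(_ (`|g t0| / 2)) := scurve_continuous sg t0.
rewrite divr_gt0 ?normr_gt0 // => /(_ isT)[d d0 hd]; apply/near_normP; exists d => // t /hd.
have [h0|h0|h0] := ltgtP 0 (g t0); last by have := g0 t0; rewrite -h0 eqxx.
  rewrite (gtr0_sg h0) mul1r (gtr0_norm h0) ler_norml => /andP[h1 _].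
  by rewrite gtr0_norm //; lra.
rewrite (ltr0_sg h0) mulN1r (ltr0_norm h0) ler_norml => /andP[_ h1].
by rewrite ltr0_norm //; lra.
Qed.

Lemma asmooth_abs (U : set E) (g : E -> R) : asmooth U g -> (forall x, U x -> g x != 0) ->
  asmooth U (fun x => `|g x|).
Proof.
move=> /asmoothP sg g0; apply/asmoothP => c sc cU; apply: (@scurve_abs (fun t => g (c t))) => [|t].
  exact: sg.
exact: g0.
Qed.

Lemma mul_jac (U W : set E) (f g : E -> E) x : open U -> open W -> asmooth U f -> asmooth W g ->
  (forall y, U y -> W (f y)) -> (forall y, U y -> g (f y) = y) -> U x ->
  jac f x *m jac g (f x) = 1%:M.
Proof.
move=> oU oW sf sg fW gfK Ux; apply/matrixP => k m; rewrite !mxE.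
have sgm := asmooth_comp_coord m sg.
have := @ddir_comp R n n U W f oU oW sf fW R (fun y => g y 0 m) (delta_mx 0 k) x fincoord_real sgm Ux.
have -> : ddir (delta_mx 0 k) (fun y => g (f y) 0 m) x = (k == m)%:R.
  rewrite (@ddir_eq_on _ _ _ U _ (fun y : E => y 0 m) _ _ oU) //; last by move=> y Uy; rewrite gfK.
  rewrite (@ddirE _ _ _ setT) //; [|exact: fincoord_real|exact: openT|exact: asmooth_coord].
  rewrite (bigD1 k) //= big1 ?addr0.
    rewrite mxE !eqxx scale1r; apply: pderiv_der.
    have := der_coord m (der_line x (delta_mx 0 k) 0).
    by rewrite mxE eqxx /= eq_sym.
  by move=> i ik; rewrite mxE eqxx /= (negbTE ik) scale0r.
move=> ->; apply: eq_bigr => i _; rewrite !mxE.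
by rewrite (pderiv_coord k i oU sf Ux).
Qed.

End Jacobian.

Section TestFunctions.
Local Open Scope ring_scope.
Local Open Scope classical_set_scope.
Context {R : realType} {s : scalars} {n : nat}.
Local Notation E := 'rV[R]_n.
Local Notation K := (scalar_of R s).
Implicit Types (W : set E) (phi : E -> K).

Lemma test_funP W phi : test_fun W phi <-> asmooth setT phi /\ cpt_inside (supp phi) W.
Proof.
by split=> -[h1 h2]; split=> //; apply/(asmooth_smooth _ (@fincoord_scalar R s) (@openT _)).
Qed.

Lemma supp_closed phi : closed (supp phi).
Proof. exact: closed_closure. Qed.

Lemma off_supp phi y : ~ supp phi y -> \forall z \near y, phi z = 0.
Proof.
move=> h; have : nbhs y (~` supp phi).
  by apply: open_nbhs_nbhs; split => //; apply: closed_openC; exact: supp_closed.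
apply: filterS => z hz; apply: contrapT => hn; apply: hz; apply: subset_closure.
exact/eqP.
Qed.

Lemma pderivs_near0 (V : normedModType R) (f : E -> V) l y : (\forall z \near y, f z = 0) ->
  pderivs l f y = 0.
Proof.
move=> h; rewrite (@nbhs_singleton _ _ (fun z => pderivs l f z = pderivs l (fun=> 0 : V) z));
  last exact: near_pderivs h.
elim: l y {h} => //= i l IH y.
rewrite (_ : pderivs l _ = (fun=> 0)); first exact: pderiv_cst.
by apply/funext.
Qed.

Lemma pderivs_off_supp phi l y : ~ supp phi y -> pderivs l phi y = 0.
Proof. by move=> /off_supp; exact: pderivs_near0. Qed.

Lemma supp_sub phi (C : set E) : closed C -> (forall y, phi y != 0 -> C y) -> supp phi `<=` C.
Proof. by move=> cC h; rewrite /supp closureE => y; apply; split. Qed.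

Lemma asmooth_glue (V : normedModType R) (U C : set E) (f : E -> V) : open U -> closed C -> C `<=` U ->
  asmooth U f -> (forall y, ~ C y -> f y = 0) -> asmooth setT f.
Proof.
move=> oU cC CU sf f0; apply: asmooth_local; first exact: openT.
move=> x _; have [Cx|nCx] := pselect (C x); first exact: asmooth_localize oU sf (CU _ Cx).
exists (fun=> 0); first exact: asmooth_cst.
have : nbhs x (~` C) by apply: open_nbhs_nbhs; split => //; exact: closed_openC.
by apply: filterS => y; exact: f0.
Qed.

(** There are finitely many words of length at most m, so the sum of their constants serves them
    all. *)
Lemma words_bound (P : seq 'I_n -> R -> Prop) : (forall l C D, C <= D -> P l C -> P l D) ->
  (forall l, exists2 C : R, 0 < C & P l C) ->
  forall m : nat, exists2 C : R, 0 < C & forall l, (size l <= m)%N -> P l C.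
Proof.
move=> mono h m.
have /choice[C hC] : forall l, exists C : R, 0 < C /\ P l C by move=> l; have [C] := h l; exists C.
have C0 l : 0 <= C l by apply: ltW; have [] := hC l.
exists (1 + \sum_(k < m.+1) \sum_(t : k.-tuple 'I_n) C t).
  by rewrite ltr_pwDl // sumr_ge0 // => k _; rewrite sumr_ge0.
move=> l lm; have [_] := hC l; apply: mono.
have lm' : (size l < m.+1)%N by [].
rewrite (bigD1 (Ordinal lm')) //= (bigD1 (in_tuple l)) //=.
set A := \sum_(i | _) _; set B := \sum_(i | _) _.
have A0 : 0 <= A by rewrite sumr_ge0.
have B0 : 0 <= B by rewrite sumr_ge0 // => k _; rewrite sumr_ge0.
lra.
Qed.

End TestFunctions.

Section PushForward.
Local Open Scope ring_scope.
Local Open Scope classical_set_scope.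
Context {R : realType} (s : scalars) {n : nat}.
Local Notation E := 'rV[R]_n.
Local Notation K := (scalar_of R s).
Variables (W W' : set E) (mu : diffeo W W').
Hypotheses (oW : open W) (oW' : open W').
Local Notation nu := (diffeo_inv mu).

Definition jdet (y : E) : R := `|\det (jacobian nu y)|.

Lemma asmooth_diffeo : asmooth W (diffeo_fun mu).
Proof. by apply/(asmooth_smooth _ (@fincoord_row R n)) => //; exact: diffeo_fun_smooth. Qed.

Lemma asmooth_diffeo_inv : asmooth W' nu.
Proof. by apply/(asmooth_smooth _ (@fincoord_row R n)) => //; exact: diffeo_inv_smooth. Qed.

Lemma det_jacobian_neq0 y : W' y -> \det (jac nu y) != 0.
Proof.
move=> Wy; have := mul_jac oW' oW asmooth_diffeo_inv asmooth_diffeo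
  (@diffeo_inv_in _ _ _ _ mu) (@diffeo_invK _ _ _ _ mu) Wy.
move=> /(congr1 determinant); rewrite det_mulmx det1 => h.
by apply/eqP => h0; move/eqP: h; rewrite h0 mul0r eq_sym oner_eq0.
Qed.

Lemma asmooth_jdet : asmooth W' jdet.
Proof.
apply: (@asmooth_ext _ _ _ _ (fun y => `|\det (jac nu y)|)).
  by move=> y Wy; rewrite /jdet (jacobianE oW' asmooth_diffeo_inv Wy).
apply: asmooth_abs; last exact: det_jacobian_neq0.
by apply: asmooth_det => i j; apply: asmooth_jac => //; exact: asmooth_diffeo_inv.
Qed.

Lemma push_testE (phi : E -> K) y : W' y -> push_test mu phi y = jdet y *: phi (nu y).
Proof. by move=> Wy; rewrite /push_test patchT ?inE. Qed.

Lemma push_test0 (phi : E -> K) y : ~ W' y -> push_test mu phi y = 0.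
Proof. by move=> Wy; rewrite /push_test patchC // inE. Qed.

Lemma push_testD (phi psi : E -> K) :
  push_test mu (fun y => phi y + psi y) = (fun y => push_test mu phi y + push_test mu psi y).
Proof.
apply/funext => y; have [Wy|nWy] := pselect (W' y); last by rewrite !push_test0 // addr0.
by rewrite !push_testE // scalerDr.
Qed.

Lemma push_testZ (a : R) (phi : E -> K) :
  push_test mu (fun y => a *: phi y) = (fun y => a *: push_test mu phi y).
Proof.
apply/funext => y; have [Wy|nWy] := pselect (W' y); last by rewrite !push_test0 // scaler0.
by rewrite !push_testE // !scalerA mulrC.
Qed.

Lemma cpt_inside_image L : cpt_inside L W -> cpt_inside (diffeo_fun mu @` L) W'.
Proof.
rewrite /cpt_inside !open_interior // => -[cL LW]; split.
  exact: compact_image oW asmooth_diffeo cL LW.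
by move=> y [x Lx <-]; apply: diffeo_fun_in; exact: LW.
Qed.

Lemma push_test_nz (phi : E -> K) (L : set E) y : supp phi `<=` L ->
  push_test mu phi y != 0 -> (diffeo_fun mu @` L) y.
Proof.
move=> sL; have [Wy|nWy] := pselect (W' y); last by rewrite push_test0 // eqxx.
rewrite push_testE // => h; exists (nu y); last by rewrite diffeo_invK.
apply/sL/subset_closure; apply: contraNneq h => /= ->; by rewrite scaler0.
Qed.

Lemma supp_push_test (phi : E -> K) L : cpt_inside L W -> supp phi `<=` L ->
  supp (push_test mu phi) `<=` diffeo_fun mu @` L.
Proof.
move=> LW sL; apply: supp_sub => [|y]; last exact: push_test_nz.
apply: compact_closed; last by have [] := cpt_inside_image LW.
exact: norm_hausdorff.
Qed.

Lemma test_fun_push (phi : E -> K) : test_fun W phi -> test_fun W' (push_test mu phi).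
Proof.
move=> /test_funP[sphi cphi]; apply/test_funP.
have sub := supp_push_test cphi (fun y h => h); have [cI IW] := cpt_inside_image cphi.
rewrite open_interior // in IW; split; last first.
  rewrite /cpt_inside open_interior //; split; last by move=> y /sub; exact: IW.
  by apply: (subclosed_compact _ cI) => //; exact: supp_closed.
apply: (asmooth_glue oW' (@supp_closed _ _ _ (push_test mu phi))).
- by move=> y /sub; exact: IW.
- apply: (@asmooth_ext _ _ _ _ (fun y => jdet y *: phi (nu y))).
    by move=> y Wy; rewrite push_testE.
  apply: asmooth_scale; first exact: asmooth_jdet.
  by apply: (asmooth_comp asmooth_diffeo_inv _ sphi).
- by move=> y /off_supp /nbhs_singleton.
Qed.

(** The coefficients given by [pderivs_comp] for jdet * (phi o nu) are independent of phi and
    bounded on L, so the C^m norm on L is controlled by that of phi. *)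
Lemma push_test_bound L m : cpt_inside L W' ->
  exists2 C : R, 0 < C & forall l, (size l <= m)%N -> forall (phi : E -> K) (B : R),
    asmooth setT phi ->
    (forall w y, (size w <= m)%N -> `|pderivs w phi y| <= B) ->
    forall y, L y -> `|pderivs l (push_test mu phi) y| <= C * B.
Proof.
rewrite /cpt_inside open_interior // => -[cL LW].
pose P l (C : R) := (size l <= m)%N -> forall (phi : E -> K) (B : R), asmooth setT phi ->
    (forall w y, (size w <= m)%N -> `|pderivs w phi y| <= B) ->
    forall y, L y -> `|pderivs l (push_test mu phi) y| <= C * B.
have [|l|C C0 hC] := @words_bound R n P _ _ m; last by exists C => // l lm; exact: hC.
  move=> l C D CD h lm phi B sphi hB y Ly; apply: le_trans (h lm phi B sphi hB y Ly) _.
  by apply: ler_wpM2r => //; apply: le_trans (hB [::] 0 _).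
have [I [c [w [h1 h2]]]] := @pderivs_comp R n W' setT nu jdet oW' (@openT _)
  asmooth_diffeo_inv (fun _ _ => Logic.I) asmooth_jdet l.
have /choice[C hC] : forall k, exists C : R, 0 < C /\ forall y, L y -> `|c k y| <= C.
  move=> k; have [s1 _] := h1 k.
  by have [C] := asmooth_bounded fincoord_real oW' s1 cL LW; exists C.
exists (1 + \sum_k C k) => [|lm phi B sphi hB y Ly].
  by rewrite ltr_pwDl // sumr_ge0 // => k _; apply: ltW; have [] := hC k.
have B0 : 0 <= B by apply: le_trans (hB [::] 0 _).
rewrite (@pderivs_eq_on _ _ _ W' _ (fun y => jdet y *: phi (nu y)) oW') //; [|exact: push_testE|exact: LW].
rewrite h2 //; [|exact: fincoord_scalar|exact: LW].
rewrite mulrDl mul1r mulr_suml; apply: le_trans (ler_norm_sum _ _ _) _.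
rewrite -[leLHS]add0r lerD //; apply: ler_sum => k _; rewrite normrZ; apply: ler_pM => //.
  by have [_] := hC k; exact.
by apply: hB; have [_ /leq_trans] := h1 k; exact.
Qed.

Lemma test_seminorm_push (p : (E -> K) -> R) :
  test_seminorm W' p -> test_seminorm W (fun phi => p (push_test mu phi)).
Proof.
move=> [pD pZ pB]; split.
- by move=> phi psi tphi tpsi; rewrite push_testD; apply: pD; exact: test_fun_push.
- by move=> a phi tphi; rewrite push_testZ; apply: pZ; exact: test_fun_push.
move=> L LW; have LW' := cpt_inside_image LW.
have [m [C hC]] := pB _ LW'.
have [D D0 hD] := push_test_bound m LW'.
(* The factor 2 is the price of returning from the norm to the modulus. *)
exists m, (C * (2 * D)) => phi tphi sL B hB.
have [sphi _] := (iffLR (test_funP _ _) tphi).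
rewrite -mulrA; apply: hC; first exact: test_fun_push.
  exact: supp_push_test.
move=> a y am; have sub := supp_push_test LW sL.
have B0 : 0 <= B.
  apply: le_trans (hB [ffun=> 0%N] 0 _); last by rewrite /mlen big1 // => i _; rewrite ffunE.
  by apply: le_trans (norm_le_sabs _).
apply: le_trans (sabs_le_norm _) _; rewrite -mulrA; apply: ler_wpM2l => //.
have [Ly|nLy] := pselect ((diffeo_fun mu @` L) y); last first.
  rewrite /mderiv pderivs_off_supp ?normr0; first by rewrite mulr_ge0 // ltW.
  by move=> /sub.
apply: hD => //; first by rewrite size_mseq.
move=> w z wm; rewrite (@pderivs_mderiv _ _ _ setT) //; [|exact: fincoord_scalar|exact: openT].
by apply: le_trans (norm_le_sabs _) _; apply: hB; rewrite mlen_mindex_of.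
Qed.

Lemma smooth_test_curve_push (c : R -> E -> K) :
  smooth_test_curve W c -> smooth_test_curve W' (fun t => push_test mu (c t)).
Proof.
move=> [d [d0 dW dl]]; exists (fun k t => push_test mu (d k t)); split.
- by rewrite d0.
- by move=> k t; exact: test_fun_push.
move=> k t p hp; have := dl k t _ (test_seminorm_push hp).
have E1 (h : R) : push_test mu (fun y => h^-1 *: (d k (t + h) y - d k t y) - d k.+1 t y) =
    (fun y => h^-1 *: (push_test mu (d k (t + h)) y - push_test mu (d k t) y) - push_test mu (d k.+1 t) y).
  apply/funext => y.
  have [Wy|nWy] := pselect (W' y); last by rewrite !push_test0 // subrr scaler0 subrr.
  by rewrite !push_testE // scalerBr scalerA mulrC -scalerA scalerBr.
by under eq_fun do rewrite E1.
Qed.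

End PushForward.

(** * Evaluating smooth curves of test functions along smooth curves of points *)

Section EvaluateTestCurves.
Local Open Scope ring_scope.
Local Open Scope classical_set_scope.
Context {R : realType} (s : scalars) {n : nat}.
Local Notation E := 'rV[R]_n.
Local Notation K := (scalar_of R s).
Variables (W : set E).
Hypothesis (oW : open W).

(** [sup] has a default value on unbounded sets, so [le_supn] asks for a bound, which
    [test_fun_bounded] supplies. *)
Definition supn (f : E -> K) : R := sup (range (fun y => `|f y|)).

Lemma supn_le (f : E -> K) (B : R) : (forall y, `|f y| <= B) -> supn f <= B.
Proof.
by move=> h; apply: ge_sup => [|_ [y _ <-]]; [exists `|f 0|; exists 0|exact: h].
Qed.

Lemma le_supn (f : E -> K) (B : R) y : (forall y, `|f y| <= B) -> `|f y| <= supn f.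
Proof.
move=> h; apply: sup_upper_bound; last by exists y.
by split; [exists `|f 0|; exists 0|exists B => _ [z _ <-]; exact: h].
Qed.

Lemma test_fun_bounded (phi : E -> K) l : test_fun W phi ->
  exists B : R, forall y, `|pderivs l phi y| <= B.
Proof.
move=> /test_funP[sphi [cphi _]].
have [B B0 hB] := asmooth_bounded (@fincoord_scalar R s) (@openT _)
  (asmooth_pderivs l (@fincoord_scalar R s) (@openT _) sphi) cphi (fun _ _ => Logic.I).
exists B => y; have [sy|nsy] := pselect (supp phi y); first exact: hB.
by rewrite pderivs_off_supp // normr0 ltW.
Qed.

Lemma pderivs_add (V : normedModType R) (U : set E) (phi psi : E -> V) l y :
  fincoord V -> open U -> asmooth U phi -> asmooth U psi -> U y ->
  pderivs l (fun y => phi y + psi y) y = pderivs l phi y + pderivs l psi y.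
Proof.
move=> fV oU s1 s2; elim: l y => //= i l IH y Uy.
apply: (etrans (@ddir_eq_on _ _ _ _ _ (fun y => pderivs l phi y + pderivs l psi y) (delta_mx 0 i) _ oU IH Uy)).
by apply: (ddir_add _ fV oU _ _ Uy); exact: asmooth_pderivs.
Qed.

Lemma pderivsD (phi psi : E -> K) l y : asmooth setT phi -> asmooth setT psi ->
  pderivs l (fun y => phi y + psi y) y = pderivs l phi y + pderivs l psi y.
Proof. by move=> s1 s2; exact: pderivs_add (@fincoord_scalar R s) openT s1 s2 I. Qed.

Lemma pderivs_scale (a : R) (V : normedModType R) (U : set E) (phi : E -> V) l y :
  fincoord V -> open U -> asmooth U phi -> U y ->
  pderivs l (fun y => a *: phi y) y = a *: pderivs l phi y.
Proof.
move=> fV oU sphi; elim: l y => //= i l IH y Uy.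
have sl := asmooth_pderivs l fV oU sphi.
apply: (etrans (@ddir_eq_on _ _ _ _ _ (fun y => a *: pderivs l phi y) (delta_mx 0 i) _ oU IH Uy)).
apply: (etrans (ddir_scale _ fV oU (asmooth_cst U a) sl Uy)).
by rewrite ddir_cst scale0r add0r.
Qed.

Lemma pderivsZ (a : R) (phi : E -> K) l y : asmooth setT phi ->
  pderivs l (fun y => a *: phi y) y = a *: pderivs l phi y.
Proof. by move=> s1; exact: pderivs_scale (@fincoord_scalar R s) openT s1 I. Qed.

(** Through these seminorms, convergence in the space of test functions becomes uniform convergence
    of every derivative. *)
Lemma test_seminorm_supn l : test_seminorm W (fun phi => supn (pderivs l phi)).
Proof.
split.
- move=> phi psi tphi tpsi; have [B hB] := test_fun_bounded l tphi.
  have [C hC] := test_fun_bounded l tpsi.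
  apply: supn_le => y; rewrite pderivsD; [|by have /test_funP[] := tphi|by have /test_funP[] := tpsi].
  by apply: le_trans (ler_normD _ _) _; apply: lerD; apply: le_supn; eassumption.
- move=> a phi tphi; have [B hB] := test_fun_bounded l tphi.
  have E1 y : `|pderivs l (fun y => a *: phi y) y| = `|a| * `|pderivs l phi y|.
    by rewrite pderivsZ ?normrZ //; have /test_funP[] := tphi.
  apply/eqP; rewrite eq_le; apply/andP; split.
    by apply: supn_le => y; rewrite E1; apply: ler_wpM2l => //; apply: le_supn hB.
  have hb y : `|pderivs l (fun y => a *: phi y) y| <= `|a| * B by rewrite E1; apply: ler_wpM2l.
  have [a0|a0] := eqVneq a 0.
    by rewrite {1}a0 normr0 mul0r; apply: le_trans (le_supn 0 hb).
  rewrite -ler_pdivlMl ?normr_gt0 //; apply: supn_le => y.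
  rewrite ler_pdivlMl ?normr_gt0 // -E1; exact: le_supn hb.
- move=> L LW; exists (size l), 1 => phi tphi sL B hB; rewrite mul1r.
  apply: supn_le => y; rewrite (@pderivs_mderiv _ _ _ setT) //.
  + by apply: le_trans (norm_le_sabs _) _; apply: hB; rewrite mlen_mindex_of.
  + exact: fincoord_scalar.
  + exact: openT.
  + by have /test_funP[] := tphi.
Qed.

(** The increment is split: first the test function changes at the moved point, where uniform
    convergence is needed, then the point moves for a fixed test function, where the chain rule
    applies. *)
Lemma der_test_curve (d : nat -> R -> E -> K) (y : R -> E) k l t :
  (forall k t, test_fun W (d k t)) ->
  (forall k t p, test_seminorm W p ->
     (fun h : R => p (fun y => h^-1 *: (d k (t + h) y - d k t y) - d k.+1 t y)) @ 0^' --> (0 : R)) ->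
  scurve y ->
  der (fun t => pderivs l (d k t) (y t)) t
    (pderivs l (d k.+1 t) (y t) + \sum_i y^`() t 0 i *: pderivs (i :: l) (d k t) (y t)).
Proof.
move=> dW dl sy; have fK := @fincoord_scalar R s; have oT := @openT E.
have sd k' t' : asmooth setT (d k' t') by have /test_funP[] := dW k' t'.
have sdl k' t' : asmooth setT (pderivs l (d k' t')) by exact: asmooth_pderivs.
have /der_cvgP h2 := asmooth_chain fK oT (sdl k t) Logic.I (scurve_der t sy).
have h1 : (fun h : R => h^-1 *: (pderivs l (d k (h + t)) (y (h + t)) - pderivs l (d k t) (y (h + t))))
    @ 0^' --> pderivs l (d k.+1 t) (y t).
  have h3 : (fun h : R => pderivs l (d k.+1 t) (y (h + t))) @ 0^' --> pderivs l (d k.+1 t) (y t).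
    apply: (@cvg_comp _ _ _ (fun h : R => y (h + t)) (pderivs l (d k.+1 t)) _ (nbhs (y t))).
      exact: der_cvg (scurve_der t sy).
    exact: asmooth_continuous fK oT (sdl _ _) Logic.I.
  rewrite -[X in _ --> X]addr0.
  rewrite (_ : (fun h => _) = (fun h : R => pderivs l (d k.+1 t) (y (h + t)) +
     pderivs l (fun y => h^-1 *: (d k (t + h) y - d k t y) - d k.+1 t y) (y (h + t)))).
    apply: cvgD => //; apply/cvgr0Pnorm_lt => e e0.
    have /cvgr0Pnorm_lt /(_ _ e0) := dl k t _ (test_seminorm_supn l).
    apply: filterS => h; apply: le_lt_trans; apply: le_trans (ler_norm _).
    have td : test_fun W (fun y => h^-1 *: (d k (t + h) y - d k t y) - d k.+1 t y).
      have [_ [c1 w1]] := dW k (t + h); have [_ [c2 w2]] := dW k t; have [_ [c3 w3]] := dW k.+1 t.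
      apply/test_funP; split.
        apply: asmooth_sub => //; apply: asmooth_scale; first exact: asmooth_cst.
        exact: asmooth_sub.
      rewrite /cpt_inside open_interior // in w1 w2 w3 *.
      have cu : compact (supp (d k (t + h)) `|` supp (d k t) `|` supp (d k.+1 t)).
        by apply: compactU => //; exact: compactU.
      have sub : supp (fun y => h^-1 *: (d k (t + h) y - d k t y) - d k.+1 t y) `<=`
          supp (d k (t + h)) `|` supp (d k t) `|` supp (d k.+1 t).
        apply: supp_sub => [|z hz].
          by apply: closedU; [apply: closedU|]; exact: supp_closed.
        apply: contrapT => /not_orP[/not_orP[n1 n2] n3]; move/eqP: hz; apply.
        rewrite (nbhs_singleton (off_supp n1)) (nbhs_singleton (off_supp n2)).
        by rewrite (nbhs_singleton (off_supp n3)) subrr scaler0 subrr.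
      split; first by apply: subclosed_compact cu sub; exact: supp_closed.
      by move=> z /sub[[/w1|/w2]|/w3].
    by have [B hB] := test_fun_bounded l td; exact: le_supn hB.
  apply/funext => h; rewrite -(addrC t h).
  have sA : asmooth setT (fun y => h^-1 *: (d k (t + h) y - d k t y)).
    by apply: asmooth_scale; [exact: asmooth_cst|exact: asmooth_sub].
  have eqs : (fun y => h^-1 *: (d k (t + h) y - d k t y) - d k.+1 t y) =
      (fun y => (fun y => h^-1 *: (d k (t + h) y - d k t y)) y + (fun y => (-1) *: d k.+1 t y) y).
    by apply/funext => z; rewrite scaleN1r.
  rewrite eqs pderivsD //; last by apply: asmooth_scale => //; exact: asmooth_cst.
  rewrite pderivsZ //; last exact: asmooth_sub.
  have eqs2 : (fun y => d k (t + h) y - d k t y) =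
      (fun y => d k (t + h) y + (fun y => (-1) *: d k t y) y).
    by apply/funext => z; rewrite scaleN1r.
  rewrite eqs2 pderivsD //; last by apply: asmooth_scale => //; exact: asmooth_cst.
  by rewrite !pderivsZ // !scaleN1r [RHS]addrC subrK.
apply/der_cvgP; rewrite (_ : (fun h : R => _) = (fun h : R =>
  h^-1 *: (pderivs l (d k (h + t)) (y (h + t)) - pderivs l (d k t) (y (h + t))) +
  h^-1 *: (pderivs l (d k t) (y (h + t)) - pderivs l (d k t) (y t)))); first exact: cvgD.
by apply/funext => h; rewrite -scalerDr addrA subrK.
Qed.

Lemma smooth_test_curve_eval (c : R -> E -> K) (y : R -> E) :
  smooth_test_curve W c -> scurve y -> scurve (fun t => c t (y t)).
Proof.
move=> [d [d0 dW dl]] sy; apply/scurve_cn => j.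
(* Each differentiation raises either the time order k or the word l, so the induction runs over
   both. *)
suff h k l : cn j (fun t => pderivs l (d k t) (y t)) by have := h 0%N [::]; rewrite d0.
elim: j k l => // j IH k l.
exists (fun t => pderivs l (d k.+1 t) (y t) + \sum_i y^`() t 0 i *: pderivs (i :: l) (d k t) (y t)).
  by move=> t; exact: der_test_curve.
apply: cn_add; first exact: IH.
elim: (index_enum _) => [|i q IHq].
  under eq_fun do rewrite big_nil.
  by have /scurve_cn := @scurve_cst R K 0; exact.
under eq_fun do rewrite big_cons.
apply: cn_add => //; apply: cn_scale; last exact: IH.
by have /scurve_cn := scurve_coord i (scurve_derive sy); exact.
Qed.

End EvaluateTestCurves.

(** * Behaviour of kernels near the diagonal *)

Section LocalLipschitz.
Local Open Scope ring_scope.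
Local Open Scope classical_set_scope.
Context {R : realType} {n : nat}.
Local Notation E := 'rV[R]_n.

(** Two points of the r-ball are at most 2 r apart; the mean value step wants derivatives within 3 r
    of one of them, hence within 4 r of z0. *)
Lemma lipschitz_ball (V : normedModType R) (U : set E) (f : E -> V) z0 (r : R) : fincoord V ->
  open U -> asmooth U f -> 0 < r -> (forall y, `|y - z0| <= 4 * r -> U y) ->
  exists2 M : R, 0 < M & forall x y, `|x - z0| <= r -> `|y - z0| <= r -> `|f y - f x| <= M * `|y - x|.
Proof.
move=> fV oU sf r0 hU; move: (fV) => [d [p [e [cp pe]]]].
have B3 : [set y | `|y - z0| <= 4 * r] `<=` U by [].
have sp j : asmooth U (fun y => p j (f y)) by exact: asmooth_lin.
have /choice[C hC] : forall jk : 'I_d * 'I_n, exists C : R, 0 < C /\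
    forall y, `|y - z0| <= 4 * r -> `|pderiv jk.2 (fun y => p jk.1 (f y)) y| <= C.
  move=> [j k]; have [C C0 h] := asmooth_bounded fincoord_real oU
    (asmooth_pderiv k fincoord_real oU (sp j)) (@compact_norm_ball _ _ z0 (4 * r)) B3.
  by exists C.
have C0 j k : 0 <= C (j, k) by apply: ltW; have [] := hC (j, k).
exists (1 + \sum_j (\sum_k C (j, k)) * `|e j|).
  by rewrite ltr_pwDl // sumr_ge0 // => j _; rewrite mulr_ge0 // sumr_ge0.
move=> x y xr yr.
have yx : `|y - x| <= 2 * r.
  have := ler_normB (y - z0) (x - z0); rewrite opprB addrA subrK; lra.
rewrite [f y - f x]pe mulrDl mul1r mulr_suml -[leLHS]add0r lerD //.
apply: le_trans (ler_norm_sum _ _ _) _; apply: ler_sum => j _.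
rewrite normrZ mulrAC; apply: ler_wpM2r => //.
have yx3 : `|y - x| < 3 * r by lra.
have dz z i : `|z - x| < 3 * r -> derivable (fun y => p j (f y)) z (delta_mx 0 i).
  move=> zr; have Uz : U z.
    apply: hU; have := ler_normD (z - x) (x - z0); rewrite addrA subrK; lra.
  by have [_ h] := asmooth_smooth_R oU (sp j) [::] Uz; exact: h.
have [xi hxi hE] := telescope_pderiv dz yx3.
rewrite linearB hE; apply: le_trans (ler_norm_sum _ _ _) _.
rewrite mulr_suml; apply: ler_sum => k _; rewrite normrM mulrC; apply: ler_pM => //.
  have [_ h] := hC (j, k); apply: h.
  have := ler_normD (xi k - x) (x - z0); rewrite addrA subrK; have := hxi k; lra.
exact: coord_norm_le.
Qed.

End LocalLipschitz.

Section SupportShrinking.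
Local Open Scope ring_scope.
Local Open Scope classical_set_scope.
Context {R : realType} (s : scalars) {n : nat}.
Local Notation E := 'rV[R]_n.
Local Notation K := (scalar_of R s).
Implicit Types (W : set E) (ker : R -> E -> E -> K).

Lemma euclid_norm_ge (x : E) : `|x| <= euclid_norm x.
Proof.
apply: row_norm_le => [|i]; first exact: sqrtr_ge0.
rewrite -sqrtr_sqr ler_sqrt ?sumr_ge0 // => [|j _]; last exact: sqr_ge0.
by rewrite (bigD1 i) //= lerDl sumr_ge0 // => j _; exact: sqr_ge0.
Qed.

Lemma euclid_norm_le (x : E) : euclid_norm x <= n%:R * `|x|.
Proof.
rewrite -[leRHS]ger0_norm ?mulr_ge0 // -sqrtr_sqr ler_sqrt ?sqr_ge0 //.
apply: (@le_trans _ _ (\sum_(i < n) `|x| ^+ 2)).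
  apply: ler_sum => i _; rewrite -[x 0 i ^+ 2]real_normK ?num_real //.
  by apply: lerXn2r; rewrite ?nnegrE //; exact: coord_norm_le.
rewrite sumr_const card_ord -[_ *+ n]mulr_natl exprMn; apply: ler_wpM2r; first exact: sqr_ge0.
by rewrite -natrX ler_nat -mulnn; case: (n) => // k; rewrite leq_pmulr.
Qed.

(** LSK1 near one point and in the sup norm, the form in which it is transported by the
    diffeomorphism. *)
Definition local_support W ker : Prop := forall x0, W x0 ->
  exists2 r : R, 0 < r & exists2 eps0 : R, 0 < eps0 & exists2 C : R, 0 < C &
    forall x eps, `|x - x0| <= r -> 0 < eps <= 1 -> eps < eps0 ->
      forall y, supp (ker eps x) y -> `|y - x| <= C * eps.

Lemma LSK1_local W ker : open W -> LSK1 W ker <-> local_support W ker.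
Proof.
move=> oW; split=> [h x0 Wx|h L [cL LW]].
  have [r r0 rW] := open_ball_inside oW Wx; exists r => //.
  have [eps0 [C [e0 C0 hC]]] := h _ (cpt_inside_ball oW rW).
  exists eps0 => //; exists C => // x eps xr e1 e2 y sy.
  by apply: le_trans (euclid_norm_ge _) _; apply: ltW; exact: hC sy.
pose P (A : set E) := exists eps0 C : R, [/\ 0 < eps0, 0 < C &
  forall x (eps : R), A x -> 0 < eps <= 1 -> eps < eps0 -> forall y, supp (ker eps x) y -> `|y - x| <= C * eps].
have [||||eps0 [C [e0 C0 hC]]] := @compact_local_ind R n L P cL.
- by exists 1, 1.
- move=> A B [e1 [C1 [e10 C10 h1]]] [e2 [C2 [e20 C20 h2]]].
  exists (Num.min e1 e2), (C1 + C2); split; [by rewrite lt_min e10|exact: addr_gt0|].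
  move=> x eps AB ee; rewrite lt_min => /andP[l1 l2] y sy; case/andP: (ee) => ee0 _; case: AB => [Ax|Bx].
    by apply: le_trans (h1 x eps Ax ee l1 y sy) _; rewrite ler_wpM2r ?(ltW ee0) // lerDl ltW.
  by apply: le_trans (h2 x eps Bx ee l2 y sy) _; rewrite ler_wpM2r ?(ltW ee0) // lerDr ltW.
- by move=> A B AB [e1 [C1 [e10 C10 h1]]]; exists e1, C1; split=> // x eps /AB; exact: h1.
- move=> x Lx; have Wx : W x by have := LW x Lx; rewrite open_interior.
  have [r r0 [e0 e00 [C C0 hC]]] := h x Wx; exists r => //; exists e0, C; split=> // y eps /= /ltW; exact: hC.
(* The Euclidean norm is at most n times the sup norm; adding 1 yields the strict inequality of the
   ball and a positive constant also for n = 0. *)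
exists eps0, (n%:R * C + 1); split=> //; first by rewrite ltr_wpDl // mulr_ge0 // ltW.
move=> x eps Lx ee el y sy; rewrite /euclid_ball /=; apply: le_lt_trans (euclid_norm_le _) _.
have [ee0 _] := andP ee.
apply: (@le_lt_trans _ _ (n%:R * (C * eps))); first by apply: ler_wpM2l => //; exact: hC sy.
by rewrite mulrA ltr_pM2r // ltrDl.
Qed.

End SupportShrinking.

(** * Kernels as functions of the pair (x, y) *)

Section Uncurry.
Local Open Scope ring_scope.
Local Open Scope classical_set_scope.
Context {R : realType} {n : nat}.
Local Notation E := 'rV[R]_n.
Local Notation E2 := 'rV[R]_(n + n).

Definition unc (V : Type) (g : E -> E -> V) : E2 -> V := fun z => g (lsubmx z) (rsubmx z).

(** The directions of d_{x+y} ([dX]) and of d_y ([dY]) in the space of pairs. *)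
Definition dX (i : 'I_n) : E2 := row_mx (delta_mx 0 i) (delta_mx 0 i).
Definition dY (i : 'I_n) : E2 := row_mx 0 (delta_mx 0 i).

Lemma norm_row_mx (x y : E) (r : R) : `|x| <= r -> `|y| <= r -> `|row_mx x y| <= r.
Proof.
move=> xr yr; apply: row_norm_le => [|i]; first exact: le_trans xr.
rewrite mxE; case: splitP => j _.
  exact: le_trans (coord_norm_le x j) xr.
exact: le_trans (coord_norm_le y j) yr.
Qed.

Lemma norm_lsubmx (z : E2) : `|lsubmx z| <= `|z|.
Proof. by apply: row_norm_le => // i; rewrite mxE; exact: coord_norm_le. Qed.

Lemma norm_rsubmx (z : E2) : `|rsubmx z| <= `|z|.
Proof. by apply: row_norm_le => // i; rewrite mxE; exact: coord_norm_le. Qed.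

Lemma scurve_lsubmx (p q : nat) (c : R -> 'rV[R]_(p + q)) : scurve c -> scurve (fun t => lsubmx (c t)).
Proof.
move=> sc; apply: scurve_coord_row => i; rewrite (_ : (fun t => _) = (fun t => c t 0 (lshift q i))).
  exact: scurve_coord.
by apply/funext => t; rewrite mxE.
Qed.

Lemma scurve_rsubmx (p q : nat) (c : R -> 'rV[R]_(p + q)) : scurve c -> scurve (fun t => rsubmx (c t)).
Proof.
move=> sc; apply: scurve_coord_row => i; rewrite (_ : (fun t => _) = (fun t => c t 0 (rshift p i))).
  exact: scurve_coord.
by apply/funext => t; rewrite mxE.
Qed.

Lemma asmooth_unc_l (V : normedModType R) (U : set E) (O : set E2) (f : E -> V) :
  asmooth U f -> (forall z, O z -> U (lsubmx z)) -> asmooth O (fun z => f (lsubmx z)).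
Proof.
move=> /asmoothP sf h; apply/asmoothP => c sc cO.
by apply: (sf (fun t => lsubmx (c t))) => [|t]; [exact: scurve_lsubmx|exact: h].
Qed.

Lemma asmooth_unc_r (V : normedModType R) (U : set E) (O : set E2) (f : E -> V) :
  asmooth U f -> (forall z, O z -> U (rsubmx z)) -> asmooth O (fun z => f (rsubmx z)).
Proof.
move=> /asmoothP sf h; apply/asmoothP => c sc cO.
by apply: (sf (fun t => rsubmx (c t))) => [|t]; [exact: scurve_rsubmx|exact: h].
Qed.

Lemma open_lsub (U : set E) : open U -> open [set z : E2 | U (lsubmx z)].
Proof.
move=> oU; apply: (@open_comp _ _ (fun z : E2 => lsubmx z)) => // z _.
apply/continuous_normP => e e0; exists e => // y /ltW yz.
by rewrite -linearB; apply: le_trans (norm_lsubmx _) yz.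
Qed.

Lemma open_rsub (U : set E) : open U -> open [set z : E2 | U (rsubmx z)].
Proof.
move=> oU; apply: (@open_comp _ _ (fun z : E2 => rsubmx z)) => // z _.
apply/continuous_normP => e e0; exists e => // y /ltW yz.
by rewrite -linearB; apply: le_trans (norm_rsubmx _) yz.
Qed.

Lemma ddir_lincomb (m : nat) (V : normedModType R) (U : set 'rV[R]_m) (f : 'rV[R]_m -> V) (x : 'rV[R]_m)
    (I : Type) (q : seq I) (c : I -> R) (w : I -> 'rV[R]_m) : fincoord V -> open U -> asmooth U f -> U x ->
  ddir (\sum_(i <- q) c i *: w i) f x = \sum_(i <- q) c i *: ddir (w i) f x.
Proof.
move=> fV oU sf Ux; rewrite (ddirE _ fV oU sf Ux).
under [RHS]eq_bigr do rewrite (ddirE _ fV oU sf Ux) scaler_sumr.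
rewrite exchange_big /=; apply: eq_bigr => k _; rewrite summxE scaler_suml.
by apply: eq_bigr => i _; rewrite mxE scalerA.
Qed.

Lemma ddirD (m : nat) (V : normedModType R) (U : set 'rV[R]_m) (f : 'rV[R]_m -> V) (x v w : 'rV[R]_m) :
  fincoord V -> open U -> asmooth U f -> U x -> ddir (v + w) f x = ddir v f x + ddir w f x.
Proof.
move=> fV oU sf Ux; rewrite !(ddirE _ fV oU sf Ux) -big_split /=.
by apply: eq_bigr => i _; rewrite mxE scalerDl.
Qed.

Section Pd.
Variable s : scalars.
Local Notation K := (scalar_of R s).
Implicit Type g : E -> E -> K.

Lemma pdyE g i z : unc (pdy i g) z = ddir (dY i) (unc g) z.
Proof.
have E1 : (fun h : R => h^-1 *: ((unc g \o shift z) (h *: dY i) - unc g z)) =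
    (fun h : R => h^-1 *: ((g (lsubmx z) \o shift (rsubmx z)) (h *: delta_mx 0 i) - unc g z)).
  apply/funext => h /=; rewrite /unc !linearD !linearZ /= /dY row_mxKl row_mxKr.
  by rewrite scaler0 add0r.
by rewrite /ddir /derive E1.
Qed.

Lemma pdxE g i z : unc (pdx i g) z = ddir (row_mx (delta_mx 0 i) 0) (unc g) z.
Proof.
have E1 : (fun h : R => h^-1 *: ((unc g \o shift z) (h *: row_mx (delta_mx 0 i) 0) - unc g z)) =
    (fun h : R => h^-1 *: ((g ^~ (rsubmx z) \o shift (lsubmx z)) (h *: delta_mx 0 i) - unc g z)).
  apply/funext => h /=; rewrite /unc !linearD !linearZ /= row_mxKl row_mxKr.
  by rewrite scaler0 add0r.
by rewrite /ddir /derive E1.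
Qed.

(** The derivatives in x alone and in y alone have literally the same difference quotients as the
    directional ones. Smoothness on O enters where [dX] is split into its x and y parts. *)
Lemma pd_words g (O : set E2) (a b : seq 'I_n) : open O -> asmooth O (unc g) -> forall z, O z ->
  unc (foldr (@pdxy R s n) (foldr (@pdy R s n) g b) a) z = ddirs (map dX a ++ map dY b) (unc g) z.
Proof.
move=> oO sg; have fK := @fincoord_scalar R s.
have hb z : unc (foldr (@pdy R s n) g b) z = ddirs (map dY b) (unc g) z.
  elim: b z => //= i b IH z; rewrite pdyE; congr (ddir _ _ z); exact/funext.
elim: a => [|i a IH] z Oz; first exact: hb.
rewrite /= -(@ddir_eq_on _ _ _ _ _ (ddirs (map dX a ++ map dY b) (unc g)) _ _ oO IH Oz).
set G := foldr (@pdxy R s n) _ a in IH *.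
have sG : asmooth O (unc G).
  by apply: asmooth_ext (asmooth_ddirs (map dX a ++ map dY b) fK oO sg) => y Oy; rewrite IH.
rewrite (_ : dX i = row_mx (delta_mx 0 i) 0 + dY i); last by rewrite add_row_mx addr0 add0r.
by rewrite (ddirD _ _ fK oO sG Oz) -pdxE -pdyE.
Qed.

End Pd.

End Uncurry.

(* [ordN N m g]: near the diagonal, all words of length at most N in the operators
   dX = d_x + d_y and dY = d_y applied to g_eps are O(eps^(m - number of dY)).
   LSK2 says that kernels have order -n; smooth functions have order 0, and order 1
   if they vanish on the diagonal; orders add up under products. *)
Section DiagonalOrder.
Local Open Scope ring_scope.
Local Open Scope classical_set_scope.
Context {R : realType} {n : nat}.
Local Notation E := 'rV[R]_n.
Local Notation E2 := 'rV[R]_(n + n).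
Implicit Types (V : normedModType R).

Definition ordN V (A : R -> set E2) (N : nat) (m : int) (g : R -> E2 -> V) : Prop :=
  forall a b : seq 'I_n, (size a + size b <= N)%N ->
  exists2 eps0 : R, 0 < eps0 & exists2 C : R, 0 < C &
    forall eps, 0 < eps <= 1 -> eps <= eps0 -> forall z, A eps z ->
      `|ddirs (map (@dX R n) a ++ map (@dY R n) b) (g eps) z| <= C * eps ^ (m - (size b)%:Z).

Variables (O : set E2) (A : R -> set E2).
Hypotheses (oO : open O) (AO : forall eps z, A eps z -> O z).

Lemma ordN_eq V N m (g h : R -> E2 -> V) : (forall eps z, 0 < eps <= 1 -> O z -> g eps z = h eps z) ->
  ordN A N m g -> ordN A N m h.
Proof.
move=> gh og a b ab; have [e0 e00 [C C0 hC]] := og a b ab; exists e0 => //; exists C => // eps e1 e2 z Az.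
rewrite -(ddirs_eq_on oO (fun z Oz => gh eps z e1 Oz)); last exact: AO Az.
exact: hC.
Qed.

Lemma ordN_mono V N N' m (g : R -> E2 -> V) : (N <= N')%N -> ordN A N' m g -> ordN A N m g.
Proof. by move=> NN h a b ab; apply: h; exact: leq_trans NN. Qed.

Lemma ordN_dX V N m (g : R -> E2 -> V) i : fincoord V ->
  (forall eps, 0 < eps <= 1 -> asmooth O (g eps)) ->
  ordN A N.+1 m g -> ordN A N m (fun eps => ddir (dX i) (g eps)).
Proof.
move=> fV sg og a b ab; have [|e0 e00 [C C0 hC]] := og (rcons a i) b.
  by rewrite size_rcons addSn.
exists e0 => //; exists C => // eps e1 e2 z Az; have := hC eps e1 e2 z Az.
rewrite map_rcons cat_rcons (ddirs_back _ _ _ fV oO (sg eps e1)) //; exact: AO Az.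
Qed.

Lemma ordN_dY V N m (g : R -> E2 -> V) i : fincoord V ->
  (forall eps, 0 < eps <= 1 -> asmooth O (g eps)) ->
  ordN A N.+1 m g -> ordN A N (m - 1) (fun eps => ddir (dY i) (g eps)).
Proof.
move=> fV sg og a b ab; have [|e0 e00 [C C0 hC]] := og a (rcons b i).
  by rewrite size_rcons addnS.
exists e0 => //; exists C => // eps e1 e2 z Az; have := hC eps e1 e2 z Az.
rewrite map_rcons -cats1 catA (ddirs_back _ _ _ fV oO (sg eps e1)); last exact: AO Az.
by rewrite cats0 size_rcons (_ : m - 1 - (size b)%:Z = m - (size b).+1%:Z) //; lia.
Qed.

Lemma ordN0 V m (g : R -> E2 -> V) (e0 C : R) : 0 < e0 -> 0 < C ->
  (forall eps, 0 < eps <= 1 -> eps <= e0 -> forall z, A eps z -> `|g eps z| <= C * eps ^ m) ->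
  ordN A 0 m g.
Proof.
move=> e00 C0 h [|? ?] [|? ?] // _; exists e0 => //; exists C => // eps e1 e2 z Az.
by rewrite subr0; exact: h.
Qed.

(** Peels off the innermost letter of a word. Together with [ordN_dX] and [ordN_dY] it gives the
    induction step of the order estimates below. *)
Lemma ordN_intro V N m (g : R -> E2 -> V) : ordN A 0 m g ->
  (forall i, ordN A N m (fun eps => ddir (dX i) (g eps))) ->
  (forall i, ordN A N (m - 1) (fun eps => ddir (dY i) (g eps))) -> ordN A N.+1 m g.
Proof.
move=> h0 hX hY a b; case: (lastP b) => [|{}b i].
  case: (lastP a) => [|{}a i]; first by move=> _; exact: h0.
  rewrite size_rcons addSn ltnS => ab; have [e0 e00 [C C0 hC]] := hX i a [::] ab.
  exists e0 => //; exists C => // eps e1 e2 z Az; have := hC eps e1 e2 z Az.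
  by rewrite !cats0 map_rcons -cats1 /ddirs foldr_cat.
rewrite size_rcons addnS ltnS => ab; have [e0 e00 [C C0 hC]] := hY i a b ab.
exists e0 => //; exists C => // eps e1 e2 z Az; have := hC eps e1 e2 z Az.
rewrite map_rcons -cats1 catA /ddirs (@foldr_cat _ _ _ _ (map (@dX R n) a ++ map (@dY R n) b)) /=.
by rewrite (_ : m - 1 - (size b)%:Z = m - (size b).+1%:Z) //; lia.
Qed.

Lemma ordN_add V N m (g h : R -> E2 -> V) : fincoord V ->
  (forall eps, 0 < eps <= 1 -> asmooth O (g eps)) -> (forall eps, 0 < eps <= 1 -> asmooth O (h eps)) ->
  ordN A N m g -> ordN A N m h -> ordN A N m (fun eps z => g eps z + h eps z).
Proof.
move=> fV; elim: N m g h => [|N IH] m g h sg sh og oh.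
  have [e1 e10 [C1 C10 h1]] := og [::] [::] isT; have [e2 e20 [C2 C20 h2]] := oh [::] [::] isT.
  apply: (@ordN0 _ _ _ (Num.min e1 e2) (C1 + C2)); [by rewrite lt_min e10|exact: addr_gt0|].
  move=> eps ee; rewrite le_min => /andP[l1 l2] z Az; rewrite mulrDl.
  apply: le_trans (ler_normD _ _) _; have := h1 eps ee l1 z Az; have := h2 eps ee l2 z Az.
  by rewrite !subr0 => k1 k2; exact: lerD.
have o0 : ordN A 0 m (fun eps z => g eps z + h eps z).
  have og' : ordN A 0 m g by apply: ordN_mono og.
  have oh' : ordN A 0 m h by apply: ordN_mono oh.
  have [e1 e10 [C1 C10 h1]] := og' [::] [::] isT; have [e2 e20 [C2 C20 h2]] := oh' [::] [::] isT.
  apply: (@ordN0 _ _ _ (Num.min e1 e2) (C1 + C2)); [by rewrite lt_min e10|exact: addr_gt0|].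
  move=> eps ee; rewrite le_min => /andP[l1 l2] z Az; rewrite mulrDl.
  apply: le_trans (ler_normD _ _) _; have := h1 eps ee l1 z Az; have := h2 eps ee l2 z Az.
  by rewrite !subr0 => k1 k2; exact: lerD.
apply: ordN_intro => // i.
  apply: (@ordN_eq _ _ _ (fun eps z => ddir (dX i) (g eps) z + ddir (dX i) (h eps) z)).
    by move=> eps z ee Oz; rewrite (ddir_add _ fV oO (sg _ ee) (sh _ ee) Oz).
  apply: IH; [| |exact: ordN_dX|exact: ordN_dX].
    by move=> eps ee; apply: asmooth_ddir => //; exact: sg.
  by move=> eps ee; apply: asmooth_ddir => //; exact: sh.
apply: (@ordN_eq _ _ _ (fun eps z => ddir (dY i) (g eps) z + ddir (dY i) (h eps) z)).
  by move=> eps z ee Oz; rewrite (ddir_add _ fV oO (sg _ ee) (sh _ ee) Oz).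
apply: IH; [| |exact: ordN_dY|exact: ordN_dY].
  by move=> eps ee; apply: asmooth_ddir => //; exact: sg.
by move=> eps ee; apply: asmooth_ddir => //; exact: sh.
Qed.

Lemma ordN_zero V N m : ordN A N m (fun=> fun=> 0 : V).
Proof.
have z0 l z : ddirs l (fun=> 0 : V) z = 0.
  elim: l z => //= v l IH z; rewrite (_ : ddirs l _ = (fun=> 0)); first exact: ddir_cst.
  exact/funext.
move=> a b _; exists 1 => //; exists 1 => // eps /andP[e0 _] _ z _.
by rewrite z0 normr0 mul1r exprz_ge0 // ltW.
Qed.

Lemma ordN_sum V N m (I : Type) (q : seq I) (g : I -> R -> E2 -> V) : fincoord V ->
  (forall i eps, 0 < eps <= 1 -> asmooth O (g i eps)) -> (forall i, ordN A N m (g i)) ->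
  ordN A N m (fun eps z => \sum_(i <- q) g i eps z).
Proof.
move=> fV sg og; elim: q => [|i q IH].
  by under eq_fun do under eq_fun do rewrite big_nil; exact: ordN_zero.
under eq_fun do under eq_fun do rewrite big_cons.
apply: ordN_add => //; first exact: sg.
by move=> eps ee; apply: asmooth_sum => j; exact: sg.
Qed.

Lemma ordN_mul V N m m' (c : R -> E2 -> R) (g : R -> E2 -> V) : fincoord V ->
  (forall eps, 0 < eps <= 1 -> asmooth O (c eps)) -> (forall eps, 0 < eps <= 1 -> asmooth O (g eps)) ->
  ordN A N m c -> ordN A N m' g -> ordN A N (m + m') (fun eps z => c eps z *: g eps z).
Proof.
move=> fV; elim: N m m' c g => [|N IH] m m' c g sc sg oc og; last first.
  apply: ordN_intro.
  - move: (IH m m' c g sc sg (ordN_mono (leqnSn _) oc) (ordN_mono (leqnSn _) og)).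
    exact: ordN_mono.
  - move=> i; apply: (@ordN_eq _ _ _ (fun eps z =>
        ddir (dX i) (c eps) z *: g eps z + c eps z *: ddir (dX i) (g eps) z)).
      by move=> eps z ee Oz; rewrite (ddir_scale _ fV oO (sc _ ee) (sg _ ee) Oz).
    have sdc eps : 0 < eps <= 1 -> asmooth O (ddir (dX i) (c eps)).
      by move=> ee; apply: asmooth_ddir; [exact: fincoord_real|exact: oO|exact: sc].
    have sdg eps : 0 < eps <= 1 -> asmooth O (ddir (dX i) (g eps)).
      by move=> ee; apply: asmooth_ddir => //; exact: sg.
    apply: ordN_add => //.
    + by move=> eps ee; apply: asmooth_scale; [exact: sdc|exact: sg].
    + by move=> eps ee; apply: asmooth_scale; [exact: sc|exact: sdg].
    + by apply: IH => //; [exact: (ordN_dX i fincoord_real)|exact: ordN_mono og].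
    + by apply: IH => //; [exact: ordN_mono oc|exact: ordN_dX].
  - move=> i; apply: (@ordN_eq _ _ _ (fun eps z =>
        ddir (dY i) (c eps) z *: g eps z + c eps z *: ddir (dY i) (g eps) z)).
      by move=> eps z ee Oz; rewrite (ddir_scale _ fV oO (sc _ ee) (sg _ ee) Oz).
    have sdc eps : 0 < eps <= 1 -> asmooth O (ddir (dY i) (c eps)).
      by move=> ee; apply: asmooth_ddir; [exact: fincoord_real|exact: oO|exact: sc].
    have sdg eps : 0 < eps <= 1 -> asmooth O (ddir (dY i) (g eps)).
      by move=> ee; apply: asmooth_ddir => //; exact: sg.
    apply: ordN_add => //.
    + by move=> eps ee; apply: asmooth_scale; [exact: sdc|exact: sg].
    + by move=> eps ee; apply: asmooth_scale; [exact: sc|exact: sdg].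
    + rewrite -addrA (addrC m') addrA.
      by apply: IH => //; [exact: (ordN_dY i fincoord_real)|exact: ordN_mono og].
    + by rewrite -addrA; apply: IH => //; [exact: ordN_mono oc|exact: ordN_dY].
have [e1 e10 [C1 C10 h1]] := oc [::] [::] isT; have [e2 e20 [C2 C20 h2]] := og [::] [::] isT.
apply: (@ordN0 _ _ _ (Num.min e1 e2) (C1 * C2)); [by rewrite lt_min e10|exact: mulr_gt0|].
move=> eps ee; rewrite le_min => /andP[l1 l2] z Az; have [e0 _] := andP ee.
rewrite normrZ expfzDr ?gt_eqF // mulrACA.
by have := h1 eps ee l1 z Az; have := h2 eps ee l2 z Az; rewrite !subr0 => k1 k2; exact: ler_pM.
Qed.

End DiagonalOrder.

Section KernelOrder.
Local Open Scope ring_scope.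
Local Open Scope classical_set_scope.
Context {R : realType} (s : scalars) {n : nat}.
Local Notation E := 'rV[R]_n.
Local Notation E2 := 'rV[R]_(n + n).
Local Notation K := (scalar_of R s).
Implicit Types (W : set E) (ker : R -> E -> E -> K).

(** Joint smoothness in x and y, from evaluating a curve of test functions along a curve of points.
    The variable y is unrestricted because test functions are extended by zero. *)
Lemma kernel_smooth W ker eps : open W -> smooth_kernel W ker -> 0 < eps <= 1 ->
  asmooth [set z : E2 | W (lsubmx z)] (unc (ker eps)).
Proof.
move=> oW sk ee; apply/asmoothP => c sc cW.
have tc : smooth_test_curve W (fun t => ker eps (lsubmx (c t))).
  apply: (sk (fun=> eps) (fun t => lsubmx (c t))) => //.
    by rewrite -scurveE; exact: scurve_cst.
  by rewrite -scurveE; exact: scurve_lsubmx.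
have h := smooth_test_curve_eval oW tc (scurve_rsubmx sc).
exact: h.
Qed.

(** LSK2 for x near one point, in words instead of multi-indices. As in LSK2, y ranges over all of W
    and may be far from x. *)
Definition local_order W ker : Prop := forall x0, W x0 -> exists2 r : R, 0 < r &
  forall a b : seq 'I_n, exists2 eps0 : R, 0 < eps0 & exists2 C : R, 0 < C &
    forall eps, 0 < eps <= 1 -> eps <= eps0 -> forall z : E2, `|lsubmx z - x0| <= r -> W (rsubmx z) ->
      `|ddirs (map (@dX R n) a ++ map (@dY R n) b) (unc (ker eps)) z| <= C * eps ^ (- n%:Z - (size b)%:Z).

Lemma LSK2_local W ker : open W -> smooth_kernel W ker -> LSK2 W ker <-> local_order W ker.
Proof.
move=> oW sk; have fK := @fincoord_scalar R s; have oO := @open_lsub R n W oW.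
have sO eps := fun ee => @kernel_smooth W ker eps oW sk ee.
have powE (eps : R) k : eps ^- (n + k)%N = eps ^ (- n%:Z - k%:Z).
  by rewrite exprnN PoszD opprD.
split=> [h x0 Wx|h L [cL LW] a b].
  have [r r0 rW] := open_ball_inside oW Wx; exists r => // a b.
  have [e0 e00 [C C0 hC]] := h _ (cpt_inside_ball oW rW) (mindex_of a) (mindex_of b).
  exists e0 => //; exists C => // eps e1 e2 z zr Wz.
  rewrite -powE -mlen_mindex_of; apply: le_trans (hC eps e1 e2 (lsubmx z, rsubmx z) _) => //.
  have Oz : W (lsubmx z) by exact: rW.
  rewrite -[foldr _ _ _ _ _]/(unc (foldr (@pdxy R s n) (foldr (@pdy R s n) (ker eps)
    (mseq (mindex_of b))) (mseq (mindex_of a))) z).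
  rewrite (pd_words _ _ oO (sO eps e1) Oz).
  rewrite (@ddirs_perm _ _ _ _ _ _ (map (@dX R n) (mseq (mindex_of a)) ++
     map (@dY R n) (mseq (mindex_of b))) fK oO (sO eps e1) _ _ Oz); first exact: norm_le_sabs.
  by apply: perm_cat; apply: perm_map; exact: perm_mindex_of.
rewrite open_interior // in LW.
pose F eps (xy : E * E) := sabs (foldr (@pdxy R s n) (foldr (@pdy R s n) (ker eps) (mseq b)) (mseq a) xy.1 xy.2).
pose G (eps : R) := eps ^- (n + mlen b)%N.
have G0 eps : 0 < eps <= 1 -> 0 <= G eps.
  by move=> /andP[e0 _]; rewrite invr_ge0 exprn_ge0 // ltW.
apply: (@compact_local_ind R n L (fun A => uniform_bigO (A `*` W) F G)) => //.
- by exists 1 => //; exists 1 => // eps _ _ xy [].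
- move=> A B [e1 e10 [C1 C10 h1]] [e2 e20 [C2 C20 h2]].
  exists (Num.min e1 e2); first by rewrite lt_min e10.
  exists (C1 + C2); first exact: addr_gt0.
  move=> eps eps1; rewrite le_min => /andP[ee1 ee2] xy [[Ax|Bx] Wy].
    apply: le_trans (h1 _ eps1 ee1 xy _) _; first by split.
    by rewrite mulrDl lerDl mulr_ge0 ?G0 // ltW.
  apply: le_trans (h2 _ eps1 ee2 xy _) _; first by split.
  by rewrite mulrDl lerDr mulr_ge0 ?G0 // ltW.
- move=> A B AB [e1 e10 [C1 C10 h1]]; exists e1 => //; exists C1 => // eps e1' e2' xy [Ax Wy].
  by apply: h1 => //; split => //; exact: AB.
move=> x0 Lx; have [r r0 /(_ (mseq a) (mseq b))[e0 e00 [C C0 hC]]] := h x0 (LW _ Lx).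
have [r' r'0 r'W] := open_ball_inside oW (LW _ Lx).
exists (Num.min r r'); first by rewrite lt_min r0.
exists e0 => //; exists (2 * C) => [|eps e1 e2 [x y]]; first exact: mulr_gt0.
rewrite /setX /= lt_min => -[/andP[/ltW xr /ltW xr'] Wy].
have Oz : W (lsubmx (row_mx x y)) by rewrite row_mxKl; exact: r'W.
rewrite /F /= (_ : foldr _ _ _ x y = unc (foldr (@pdxy R s n) (foldr (@pdy R s n) (ker eps)
    (mseq b)) (mseq a)) (row_mx x y)); last by rewrite /unc row_mxKl row_mxKr.
rewrite (pd_words _ _ oO (sO eps e1) Oz); apply: le_trans (sabs_le_norm _) _.
rewrite -mulrA; apply: ler_wpM2l => //; rewrite /G powE -size_mseq.
by apply: hC => //; rewrite ?row_mxKl ?row_mxKr.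
Qed.

End KernelOrder.

(** * Orders under the substitution (x, y) -> (nu x, nu y) *)

Section CompositionOrder.
Local Open Scope ring_scope.
Local Open Scope classical_set_scope.
Context {R : realType} {n : nat}.
Local Notation E := 'rV[R]_n.
Local Notation E2 := 'rV[R]_(n + n).

Lemma der_coord_row (m : nat) (c : R -> 'rV[R]_m) (t : R) (d : 'rV[R]_m) :
  (forall i, der (fun t => c t 0 i) t (d 0 i)) -> der c t d.
Proof.
move=> h; rewrite (_ : c = fun t => \sum_i c t 0 i *: delta_mx 0 i); last first.
  by apply/funext => u; exact: row_delta_sum.
rewrite [d]row_delta_sum; elim: (index_enum _) => [|i q IH].
  by under eq_fun do rewrite big_nil; rewrite big_nil; exact: der_cst.
under eq_fun do rewrite big_cons; rewrite big_cons; apply: der_add => //.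
by have := der_scale (h i) (der_cst (delta_mx 0 i : 'rV[R]_m) t); rewrite scaler0 addr0.
Qed.

Lemma der_row_mx (p q : nat) (x : R -> 'rV[R]_p) (y : R -> 'rV[R]_q) t dx dy : der x t dx -> der y t dy ->
  der (fun t => row_mx (x t) (y t)) t (row_mx dx dy).
Proof.
move=> hx hy; apply: der_coord_row => i; rewrite mxE.
under eq_fun do rewrite mxE.
by case: splitP => j _; exact: der_coord.
Qed.

Lemma scurve_row_mx (p q : nat) (x : R -> 'rV[R]_p) (y : R -> 'rV[R]_q) :
  scurve x -> scurve y -> scurve (fun t => row_mx (x t) (y t)).
Proof.
move=> hx hy; apply: scurve_coord_row => i; under eq_fun do rewrite mxE.
by case: splitP => j _; exact: scurve_coord.
Qed.

Variables (U' : set E) (nu : E -> E) (O : set E2).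
Hypotheses (oU' : open U') (snu : asmooth U' nu) (oO : open O).

Definition square (U : set E) : set E2 := [set z | U (lsubmx z)] `&` [set z | U (rsubmx z)].
Local Notation O' := (square U').
Definition pairmap (z : E2) : E2 := row_mx (nu (lsubmx z)) (nu (rsubmx z)).
Hypothesis (PO : forall z, O' z -> O (pairmap z)).

Lemma open_square : open O'.
Proof. by apply: openI; [exact: open_lsub|exact: open_rsub]. Qed.

Lemma asmooth_pairmap : asmooth O' pairmap.
Proof.
apply/asmoothP => c sc cO; apply: scurve_row_mx.
  have /asmoothP h := snu; apply: (h (fun t => lsubmx (c t))); first exact: scurve_lsubmx.
  by move=> t; have [] := cO t.
have /asmoothP h := snu; apply: (h (fun t => rsubmx (c t))); first exact: scurve_rsubmx.
by move=> t; have [] := cO t.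
Qed.

Let coef j i (x : E) : R := ddir (delta_mx 0 j) nu x 0 i.

Lemma asmooth_coef j i : asmooth U' (coef j i).
Proof. exact: asmooth_nu_coord. Qed.

Lemma ddir_pairmap_dY (V : normedModType R) (g : E2 -> V) j z : fincoord V -> asmooth O g -> O' z ->
  ddir (dY j) (fun z => g (pairmap z)) z =
    \sum_i coef j i (rsubmx z) *: ddir (dY i) g (pairmap z).
Proof.
move=> fV sg Oz; rewrite (ddir_comp open_square oO asmooth_pairmap PO _ fV sg Oz).
apply: etrans (esym (ddirE _ fV oO sg (PO Oz))) _.
apply: etrans (ddir_lincomb _ _ _ fV oO sg (PO Oz)).
apply: (f_equal (fun v => ddir v g (pairmap z))).
apply: ddir_der; have [_ Ur] := Oz.
under eq_fun do rewrite /pairmap !linearD !linearZ /= row_mxKl row_mxKr scaler0 addr0.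
have -> : \sum_i coef j i (rsubmx z) *: dY i = row_mx 0 (ddir (delta_mx 0 j) nu (rsubmx z)).
  apply/rowP => k; rewrite summxE mxE; under eq_bigr do rewrite !mxE.
  case: splitP => m _; first by rewrite [RHS]mxE; apply: big1 => i _; rewrite mxE mulr0.
  under eq_bigr do rewrite mxE eqxx /=.
  rewrite (bigD1 m) //= eqxx mulr1 big1 ?addr0 // => i im.
  by rewrite eq_sym (negbTE im) mulr0.
by apply: der_row_mx; [exact: der_cst|exact: der_ddir (@fincoord_row R n) oU' snu Ur].
Qed.

Lemma ddir_pairmap_dX (V : normedModType R) (g : E2 -> V) j z : fincoord V -> asmooth O g -> O' z ->
  ddir (dX j) (fun z => g (pairmap z)) z =
    \sum_i coef j i (lsubmx z) *: ddir (dX i) g (pairmap z) +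
    \sum_i (coef j i (rsubmx z) - coef j i (lsubmx z)) *: ddir (dY i) g (pairmap z).
Proof.
move=> fV sg Oz; rewrite (ddir_comp open_square oO asmooth_pairmap PO _ fV sg Oz).
apply: etrans (esym (ddirE _ fV oO sg (PO Oz))) _.
have L I q c w := @ddir_lincomb R (n + n) V O g (pairmap z) I q c w fV oO sg (PO Oz).
apply: etrans (_ : _ = ddir (\sum_i coef j i (lsubmx z) *: dX i) g (pairmap z) +
  ddir (\sum_i (coef j i (rsubmx z) - coef j i (lsubmx z)) *: dY i) g (pairmap z)) _; last by rewrite !L.
apply: etrans (ddirD _ _ fV oO sg (PO Oz)).
apply: (f_equal (fun v => ddir v g (pairmap z))).
apply: ddir_der; have [Ul Ur] := Oz.
under eq_fun do rewrite /pairmap !linearD !linearZ /= row_mxKl row_mxKr.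
have -> : \sum_i coef j i (lsubmx z) *: dX i + \sum_i (coef j i (rsubmx z) - coef j i (lsubmx z)) *: dY i =
    row_mx (ddir (delta_mx 0 j) nu (lsubmx z)) (ddir (delta_mx 0 j) nu (rsubmx z)).
  rewrite -big_split /=; apply/rowP => k; rewrite summxE mxE; under eq_bigr do rewrite !mxE.
  case: splitP => m _; under eq_bigr do rewrite !mxE ?eqxx /=.
    rewrite (bigD1 m) //= eqxx mulr1 mulr0 addr0 big1 ?addr0 // => i im.
    by rewrite eq_sym (negbTE im) !mulr0 addr0.
  rewrite (bigD1 m) //= eqxx !mulr1 [coef j m (lsubmx z) + _]addrC subrK big1 ?addr0 // => i im.
  by rewrite eq_sym (negbTE im) !mulr0 addr0.
by apply: der_row_mx; [exact: der_ddir (@fincoord_row R n) oU' snu Ul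
                      |exact: der_ddir (@fincoord_row R n) oU' snu Ur].
Qed.

Variables (x0 : E) (r D : R).
Hypotheses (r0 : 0 < r) (D0 : 0 < D) (x0U : forall y, `|y - x0| <= 4 * r -> U' y).

(** Where a kernel with shrinking supports lives. The width D * eps is what turns vanishing on the
    diagonal into a factor eps. *)
Definition tube (eps : R) : set E2 := [set z |
  [/\ `|lsubmx z - x0| <= r, `|rsubmx z - x0| <= r & `|rsubmx z - lsubmx z| <= D * eps]].
Local Notation A := tube.

Let r4 : r <= 4 * r.
Proof. by rewrite ler_peMl ?(ltW r0) // ler1n. Qed.

Lemma square_ball (z : E2) : `|z - row_mx x0 x0| <= 4 * r -> O' z.
Proof.
move=> h; split; apply: x0U; apply: le_trans h.
  by have := norm_lsubmx (z - row_mx x0 x0); rewrite linearB /= row_mxKl.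
by have := norm_rsubmx (z - row_mx x0 x0); rewrite linearB /= row_mxKr.
Qed.

Lemma tube_ball eps z : A eps z -> `|z - row_mx x0 x0| <= r.
Proof.
move=> [h1 h2 _]; rewrite -[z]hsubmxK opp_row_mx add_row_mx; exact: norm_row_mx.
Qed.

Lemma tube_square eps z : A eps z -> O' z.
Proof. by move=> /tube_ball h; apply: square_ball; exact: le_trans h r4. Qed.

(** Bounded derivatives suffice, since eps^(-k) >= 1 for eps <= 1. *)
Lemma ordN_smooth (V : normedModType R) N (c : E2 -> V) : fincoord V -> asmooth O' c ->
  ordN A N 0 (fun=> c).
Proof.
move=> fV sc a b _; have B4 : [set z : E2 | `|z - row_mx x0 x0| <= 4 * r] `<=` O'.
  by move=> z; exact: square_ball.
have [C C0 hC] := asmooth_bounded fV open_square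
  (asmooth_ddirs (map (@dX R n) a ++ map (@dY R n) b) fV open_square sc)
  (@compact_norm_ball _ _ (row_mx x0 x0) (4 * r)) B4.
exists 1 => //; exists C => // eps /andP[e0 e1] _ z Az.
apply: le_trans (hC z _) _; first exact: le_trans (tube_ball Az) r4.
rewrite ler_peMr ?(ltW C0) // sub0r -exprnN invr_ge1 ?exprn_ile1 ?(ltW e0) //.
  by rewrite unitfE expf_neq0 // gt_eqF.
exact: exprn_gt0.
Qed.

(** [dX] is tangent to the diagonal and so preserves vanishing there; [dY] lowers the order to 0,
    where boundedness is enough. Without derivatives, compare with the diagonal point (x, x) by the
    Lipschitz bound. *)
Lemma ordN_vanish (V : normedModType R) N (c : E2 -> V) : fincoord V -> asmooth O' c ->
  (forall z, O' z -> lsubmx z = rsubmx z -> c z = 0) -> ordN A N 1 (fun=> c).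
Proof.
move=> fV; elim: N c => [|N IH] c sc c0; last first.
  apply: (@ordN_intro _ _ A).
  - apply: ordN_mono (IH c sc c0) => //.
  - move=> i; apply: IH; first exact: asmooth_ddir fV open_square sc.
    move=> z Oz lr; apply: ddir_der; apply: (@der_near _ _ (fun=> 0)); last exact: der_cst.
    have := scurve_near_open (@scurve_line R _ z (dX i)) open_square (t := 0).
    rewrite scale0r addr0 => /(_ Oz); apply: filterS => t Ot; rewrite c0 //.
    by rewrite !linearD !linearZ /= row_mxKl row_mxKr lr.
  - by move=> i; rewrite subrr; apply: ordN_smooth => //; exact: asmooth_ddir fV open_square sc.
have [M M0 hM] := lipschitz_ball fV open_square sc r0 (fun z => @square_ball z).
apply: (@ordN0 _ _ A _ _ _ 1 (M * D)) => //; first exact: mulr_gt0.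
move=> eps /andP[e0 e1] _ z Az; have Zz := tube_ball Az; have [h1 h2 h3] := Az.
have Zl : `|row_mx (lsubmx z) (lsubmx z) - row_mx x0 x0| <= r.
  by rewrite opp_row_mx add_row_mx; exact: norm_row_mx.
have := hM _ _ Zl Zz; rewrite (c0 (row_mx (lsubmx z) (lsubmx z))); last 2 first.
- by apply: square_ball; exact: le_trans Zl r4.
- by rewrite row_mxKl row_mxKr.
rewrite subr0 => h; apply: le_trans h _; rewrite -mulrA; apply: ler_wpM2l; first exact: ltW.
rewrite expr1z -{1}[z]hsubmxK opp_row_mx add_row_mx subrr; apply: norm_row_mx => //.
by rewrite normr0 mulr_ge0 // ltW.
Qed.

(** Induction on the word length: one derivative of the composite is a sum of coefficients times
    composites of single derivatives of g, which the induction hypothesis covers. No formula for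
    longer words arises. *)
Lemma ordN_comp (V : normedModType R) (B : R -> set E2) N m (g : R -> E2 -> V) : fincoord V ->
  (forall eps z, B eps z -> O z) ->
  (forall eps z, A eps z -> B eps (pairmap z)) ->
  (forall eps, 0 < eps <= 1 -> asmooth O (g eps)) ->
  ordN B N m g -> ordN A N m (fun eps z => g eps (pairmap z)).
Proof.
move=> fV BO AB; have AO := tube_square.
have base m' (h : R -> E2 -> V) : ordN B 0 m' h -> ordN A 0 m' (fun eps z => h eps (pairmap z)).
  move=> oh; have [e0 e00 [C C0 hC]] := oh [::] [::] isT.
  apply: (@ordN0 _ _ A _ _ _ e0 C) => // eps ee el z Az.
  by have := hC eps ee el _ (AB _ _ Az); rewrite subr0.
elim: N m g => [|N IH] m g sg og; first exact: base.
have oO' := open_square.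
have sX i eps : 0 < eps <= 1 -> asmooth O (ddir (dX i) (g eps)) by move=> ee; exact: asmooth_ddir (sg _ ee).
have sY i eps : 0 < eps <= 1 -> asmooth O (ddir (dY i) (g eps)) by move=> ee; exact: asmooth_ddir (sg _ ee).
have cX i eps : 0 < eps <= 1 -> asmooth O' (fun z => ddir (dX i) (g eps) (pairmap z)).
  by move=> ee; exact: asmooth_comp asmooth_pairmap PO _ _ (sX i eps ee).
have cY i eps : 0 < eps <= 1 -> asmooth O' (fun z => ddir (dY i) (g eps) (pairmap z)).
  by move=> ee; exact: asmooth_comp asmooth_pairmap PO _ _ (sY i eps ee).
have sl j i : asmooth O' (fun z => coef j i (lsubmx z)).
  by apply: (asmooth_unc_l (asmooth_coef j i)) => z [].
have sr j i : asmooth O' (fun z => coef j i (rsubmx z)).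
  by apply: (asmooth_unc_r (asmooth_coef j i)) => z [].
apply: ordN_intro.
- by apply: base; exact: ordN_mono og.
- move=> j; apply: (@ordN_eq _ _ O' A oO' AO _ _ _ (fun eps z =>
    \sum_i coef j i (lsubmx z) *: ddir (dX i) (g eps) (pairmap z) +
    \sum_i (coef j i (rsubmx z) - coef j i (lsubmx z)) *: ddir (dY i) (g eps) (pairmap z))).
    by move=> eps z ee Oz; rewrite (ddir_pairmap_dX j fV (sg eps ee) Oz).
  have sA eps : 0 < eps <= 1 -> asmooth O' (fun z =>
      \sum_i coef j i (lsubmx z) *: ddir (dX i) (g eps) (pairmap z)).
    by move=> ee; apply: asmooth_sum => i; apply: asmooth_scale => //; exact: cX.
  have sB eps : 0 < eps <= 1 -> asmooth O' (fun z =>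
      \sum_i (coef j i (rsubmx z) - coef j i (lsubmx z)) *: ddir (dY i) (g eps) (pairmap z)).
    move=> ee; apply: asmooth_sum => i; apply: asmooth_scale; last exact: cY.
    exact: asmooth_sub.
  apply: (ordN_add oO' AO fV sA sB).
    apply: (@ordN_sum _ _ O' A oO' AO _ _ _ _ _
      (fun i eps z => coef j i (lsubmx z) *: ddir (dX i) (g eps) (pairmap z)) fV) => i.
      by move=> eps ee; apply: asmooth_scale => //; exact: cX.
    rewrite -[m]add0r; apply: (@ordN_mul _ _ O' A oO' AO _ _ _ _ (fun=> fun z => coef j i (lsubmx z))
      (fun eps z => ddir (dX i) (g eps) (pairmap z)) fV) => //.
    + exact: cX.
    + by apply: ordN_smooth => //; exact: fincoord_real.
    + apply: (IH _ (fun eps => ddir (dX i) (g eps))); first exact: sX.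
      exact: (ordN_dX oO BO i fV sg og).
  apply: (@ordN_sum _ _ O' A oO' AO _ _ _ _ _
      (fun i eps z => (coef j i (rsubmx z) - coef j i (lsubmx z)) *: ddir (dY i) (g eps) (pairmap z)) fV) => i.
    by move=> eps ee; apply: asmooth_scale; [exact: asmooth_sub|exact: cY].
  (* The coefficient of order 1 restores the power of eps lost by [dY]. *)
  rewrite (_ : m = 1 + (m - 1)); last by lia.
  apply: (@ordN_mul _ _ O' A oO' AO _ _ _ _ (fun=> fun z => coef j i (rsubmx z) - coef j i (lsubmx z))
      (fun eps z => ddir (dY i) (g eps) (pairmap z)) fV) => //.
  + by move=> eps ee; exact: asmooth_sub.
  + exact: cY.
  + apply: ordN_vanish; [exact: fincoord_real|exact: asmooth_sub|].
    by move=> z _ ->; rewrite subrr.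
  + apply: (IH _ (fun eps => ddir (dY i) (g eps))); first exact: sY.
    exact: (ordN_dY oO BO i fV sg og).
- move=> j; apply: (@ordN_eq _ _ O' A oO' AO _ _ _ (fun eps z =>
    \sum_i coef j i (rsubmx z) *: ddir (dY i) (g eps) (pairmap z))).
    by move=> eps z ee Oz; rewrite (ddir_pairmap_dY j fV (sg eps ee) Oz).
  apply: (@ordN_sum _ _ O' A oO' AO _ _ _ _ _
      (fun i eps z => coef j i (rsubmx z) *: ddir (dY i) (g eps) (pairmap z)) fV) => i.
    by move=> eps ee; apply: asmooth_scale => //; exact: cY.
  rewrite -[m - 1]add0r; apply: (@ordN_mul _ _ O' A oO' AO _ _ _ _ (fun=> fun z => coef j i (rsubmx z))
      (fun eps z => ddir (dY i) (g eps) (pairmap z)) fV) => //.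
  + exact: cY.
  + by apply: ordN_smooth => //; exact: fincoord_real.
  + apply: (IH _ (fun eps => ddir (dY i) (g eps))); first exact: sY.
    exact: (ordN_dY oO BO i fV sg og).
Qed.

End CompositionOrder.

(** * Smoothness, LSK1 and LSK2 of the pushed kernel *)

Section PushKernel.
Local Open Scope ring_scope.
Local Open Scope classical_set_scope.
Context {R : realType} (s : scalars) {n : nat}.
Local Notation E := 'rV[R]_n.
Local Notation E2 := 'rV[R]_(n + n).
Local Notation K := (scalar_of R s).
Variables (W W' : set E) (mu : diffeo W W').
Hypotheses (oW : open W) (oW' : open W').
Local Notation nu := (diffeo_inv mu).
Implicit Types (ker : R -> E -> E -> K).

Definition push_kernel ker : R -> E -> E -> K := fun eps x => push_test mu (ker eps (nu x)).

Lemma kernel_test_fun ker eps x : smooth_kernel W ker -> 0 < eps <= 1 -> W x ->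
  test_fun W (ker eps x).
Proof.
move=> sk ee Wx; have [||||d [d0 dW _]] := sk (fun=> eps) (fun=> x) => //.
- by rewrite -scurveE; exact: scurve_cst.
- by rewrite -scurveE; exact: scurve_cst.
by have := dW 0%N 0; rewrite d0.
Qed.

Lemma scurve_nu (x : R -> E) : scurve x -> (forall t, W' (x t)) -> scurve (fun t => nu (x t)).
Proof. by have /asmoothP := asmooth_diffeo_inv mu oW'; exact. Qed.

Lemma smooth_push_kernel ker : smooth_kernel W ker -> smooth_kernel W' (push_kernel ker).
Proof.
move=> sk e x se sx e1 xW; apply: (@smooth_test_curve_push _ _ _ _ _ mu oW oW' (fun t => ker (e t) (nu (x t)))).
apply: (sk e (fun t => nu (x t)) se _ e1) => [|t]; last exact: diffeo_inv_in.
by rewrite -scurveE; apply: (scurve_nu _ xW); rewrite scurveE.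
Qed.

Lemma nu_near (x0 : E) (r : R) : W' x0 -> 0 < r -> exists2 d : R, 0 < d &
  forall x, `|x - x0| <= d -> W' x /\ `|nu x - nu x0| <= r.
Proof.
move=> Wx r0; have [d d0 dW] := open_ball_inside oW' Wx.
have /continuous_normP /(_ _ r0) [d' d'0 h] := asmooth_continuous (@fincoord_row R n) oW'
  (asmooth_diffeo_inv mu oW') Wx.
exists (Num.min d (d' / 2)) => [|x]; first by rewrite lt_min d0 divr_gt0.
by rewrite le_min => /andP[h1 h2]; split; [exact: dW|apply: h; lra].
Qed.

Lemma push_local_support ker : smooth_kernel W ker -> local_support W ker ->
  local_support W' (push_kernel ker).
Proof.
move=> sk ls x0 Wx0; have Wn := diffeo_inv_in mu Wx0.
have [r r0 [e0 e00 [C C0 hC]]] := ls _ Wn.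
have [r4 r40 hr4] := open_ball_inside oW Wn.
have r20 : 0 < r4 / 4 by rewrite divr_gt0.
have hr2 y : `|y - nu x0| <= 4 * (r4 / 4) -> W y by move=> h; apply: hr4; lra.
have [M M0 hM] := lipschitz_ball (@fincoord_row R n) oW (asmooth_diffeo mu oW) r20 hr2.
have rr0 : 0 < Num.min r (r4 / 8) by rewrite lt_min r0 divr_gt0.
have [d d0 hd] := nu_near Wx0 rr0.
(* With C * eps at most r4 / 8, the support of the kernel at [nu x] stays inside the ball of radius
   r4 / 4 on which [diffeo_fun mu] is Lipschitz. *)
exists d => //; exists (Num.min e0 (r4 / 8 / C)); first by rewrite lt_min e00 !divr_gt0.
exists (M * C) => [|x eps xd ee]; first exact: mulr_gt0.
rewrite lt_min => /andP[l1 l2] y sy; have [Wx] := hd x xd; rewrite le_min => /andP[n1 n2].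
have Wnx := diffeo_inv_in mu Wx; have [_ cs] := kernel_test_fun sk ee Wnx.
have [z sz <-] := supp_push_test oW oW' cs (fun _ h => h) sy.
rewrite -{1}(diffeo_invK mu Wx); have zx := hC _ _ n1 ee l1 z sz.
apply: le_trans (hM (nu x) z _ _) _; [lra| |].
  have := ler_normD (z - nu x) (nu x - nu x0); rewrite addrA subrK.
  have : C * eps <= r4 / 8 by rewrite mulrC -ler_pdivlMr // ltW.
  lra.
by rewrite -mulrA; apply: ler_wpM2l => //; exact: ltW.
Qed.

Lemma push_local_order ker : smooth_kernel W ker -> local_support W ker -> local_order W ker ->
  local_order W' (push_kernel ker).
Proof.
move=> sk ls lo x0 Wx0; have Wn := diffeo_inv_in mu Wx0; have fK := @fincoord_scalar R s.
have [r1 r10 h1] := lo _ Wn.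
have [r3 r30 [e3 e30 [D D0 hD]]] := push_local_support sk ls Wx0.
have [r2 r20 hr2] := nu_near Wx0 r10.
have [r4 r40 hr4] := open_ball_inside oW' Wx0.
pose r := Num.min r2 (Num.min r3 (r4 / 4)).
have r0 : 0 < r by rewrite !lt_min r20 r30 divr_gt0.
have rr2 : r <= r2 by rewrite ge_min lexx.
have rr3 : r <= r3 by rewrite !ge_min lexx orbT.
have rr4 : r <= r4 / 4 by rewrite !ge_min lexx !orbT.
have U4 y : `|y - x0| <= 4 * r -> W' y by move=> h; apply: hr4; lra.
have snu := asmooth_diffeo_inv mu oW'.
pose O := [set z : E2 | W (lsubmx z)].
have oO : open O by exact: open_lsub.
have PO z : square W' z -> O (pairmap nu z).
  by move=> [zl _]; rewrite /O /pairmap /= row_mxKl; exact: diffeo_inv_in.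
pose A := tube x0 r D.
have AO eps z : A eps z -> square W' z by exact: (tube_square r0 U4).
have oQ := open_square oW'.
have ordA N : ordN A N (- n%:Z) (fun eps => unc (push_kernel ker eps)).
  apply: (@ordN_eq _ _ (square W') A oQ AO _ _ _
    (fun eps z => jdet mu (rsubmx z) *: unc (ker eps) (pairmap nu z))).
    move=> eps z _ [_ zr]; rewrite /unc /push_kernel push_testE //.
    by rewrite /pairmap row_mxKl row_mxKr.
  have sJ : asmooth (square W') (fun z : E2 => jdet mu (rsubmx z)).
    by apply: (asmooth_unc_r (asmooth_jdet mu oW oW')) => z [].
  have sO eps : 0 < eps <= 1 -> asmooth O (unc (ker eps)) by move=> ee; exact: kernel_smooth.
  rewrite -[- n%:Z]add0r.
  apply: (@ordN_mul _ _ (square W') A oQ AO _ _ _ _ (fun=> fun z : E2 => jdet mu (rsubmx z))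
     (fun eps z => unc (ker eps) (pairmap nu z)) fK) => //.
  - move=> eps ee; exact: (asmooth_comp (asmooth_pairmap snu) PO (sO eps ee)).
  - exact: (@ordN_smooth _ _ W' oW' x0 r D r0 U4 R N _ fincoord_real sJ).
  pose B (eps : R) := [set z : E2 | [/\ W (lsubmx z), W (rsubmx z) & `|lsubmx z - nu x0| <= r1]].
  apply: (@ordN_comp _ _ W' nu O oW' snu oO PO x0 r D r0 D0 U4 K B N (- n%:Z)
     (fun eps => unc (ker eps)) fK) => //.
  - by move=> eps z [].
  - move=> eps z [z1 z2 z3]; rewrite /B /pairmap /= row_mxKl row_mxKr.
    have [w1 b1] := hr2 _ (le_trans z1 rr2); have [w2 b2] := hr2 _ (le_trans z2 rr2).
    by split => //; exact: diffeo_inv_in.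
  move=> a b _; have [e0 e00 [C C0 hC]] := h1 a b.
  exists e0 => //; exists C => // eps ee el z [zl zr zb]; exact: hC.
(* Half the radius: if |y - x| <= D * eps <= r / 2, then y is within r of x0 as the tube demands. *)
exists (r / 2); first by rewrite divr_gt0.
move=> a b; have [e0 e00 [C C0 hC]] := ordA _ a b (leqnn _).
exists (Num.min (Num.min e0 (e3 / 2)) (r / 2 / D)).
  by rewrite !lt_min e00 !divr_gt0.
exists C => // eps ee; rewrite !le_min => /andP[/andP[l0 l3] lD] z zl Wz.
have [zt|zt] := leP `|rsubmx z - lsubmx z| (D * eps).
  apply: hC => //; split => //; first lra.
  have := ler_normD (rsubmx z - lsubmx z) (lsubmx z - x0); rewrite addrA subrK.
  have : D * eps <= r / 2 by rewrite mulrC -ler_pdivlMr.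
  lra.
(* Outside the tube all derivatives at z are 0, because the kernel vanishes on a ball around z:
   moving each entry by less than d keeps their distance above D * eps. *)
pose d := Num.min (r / 2) ((`|rsubmx z - lsubmx z| - D * eps) / 2).
have d0 : 0 < d by rewrite lt_min !divr_gt0 // subr_gt0.
have z0 (y : E2) : ball z d y -> unc (push_kernel ker eps) y = 0.
  rewrite -ball_normE /= distrC lt_min => /andP[y1 y2].
  have yl := norm_lsubmx (y - z); have yr := norm_rsubmx (y - z).
  rewrite !linearB /= in yl yr.
  have ylr : `|lsubmx y - x0| <= r3.
    have := ler_normD (lsubmx y - lsubmx z) (lsubmx z - x0); rewrite addrA subrK; lra.
  apply: contrapT => /eqP hn.
  have sy : supp (push_kernel ker eps (lsubmx y)) (rsubmx y) by exact: subset_closure.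
  have := hD _ _ ylr ee _ _ sy; have e3e : eps < e3 by lra.
  move=> /(_ e3e) hy.
  have := ler_normD (rsubmx z - rsubmx y) (rsubmx y - lsubmx y); rewrite addrA subrK.
  have := ler_normD (rsubmx z - lsubmx y) (lsubmx y - lsubmx z); rewrite addrA subrK.
  rewrite [`|rsubmx z - rsubmx y|]distrC; lra.
have oB : open (ball z d) by exact: ball_open.
rewrite (ddirs_eq_on oB z0 _ (ballxx z d0)); rewrite (_ : ddirs _ _ z = 0); last first.
  elim: (_ ++ _) z {zl Wz zt d d0 z0 oB} => //= v l IH z.
  by rewrite (_ : ddirs l _ = (fun=> 0)); [exact: ddir_cst|exact/funext].
have [e1 _] := andP ee.
by rewrite normr0 mulr_ge0 ?exprz_ge0 // ltW.
Qed.

Lemma basic_space_pull (F : (E -> K) -> E -> K) : basic_space s W' F -> basic_space s W (pull_fun mu F).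
Proof.
move=> bF c x sc sx xW.
apply: (bF (fun t => push_test mu (c t)) (fun t => diffeo_fun mu (x t))).
- exact: smooth_test_curve_push.
- have /asmoothP h := asmooth_diffeo mu oW.
  by rewrite -scurveE; apply: h => //; rewrite scurveE.
- by move=> t; exact: diffeo_fun_in.
Qed.

End PushKernel.

(** * The iterated integral *)

Section LineIntegral.
Local Open Scope ring_scope.
Local Open Scope classical_set_scope.
Context {R : realType}.
Local Notation mu := (@lebesgue_measure R).
Implicit Types (f g : R -> R).

Definition int1 f : R := \int[mu]_(t in [set: R]) f t.

Definition zero_off (T V : normedModType R) (r : R) (f : T -> V) : Prop := forall t, r < `|t| -> f t = 0.

Lemma int1E f r : zero_off r f -> int1 f = \int[mu]_(t in `[- r, r]) f t.
Proof.
move=> f0; rewrite [RHS]Rintegral_mkcond; apply: eq_Rintegral => t _.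
rewrite patchE; case: ifPn => //; rewrite notin_setE /= in_itv /= => h.
by apply: f0; rewrite ltNge ler_norml; apply/negP.
Qed.

Lemma continuous_integrable f a b : continuous f -> mu.-integrable `[a, b] (EFin \o f).
Proof.
move=> cf; apply: continuous_compact_integrable; first exact: segment_compact.
exact: continuous_subspaceT.
Qed.

Lemma int1_add f g r : continuous f -> continuous g -> zero_off r f -> zero_off r g ->
  int1 (fun t => f t + g t) = int1 f + int1 g.
Proof.
move=> cf cg f0 g0; rewrite (int1E f0) (int1E g0) (@int1E _ r) => [|t rt].
  by rewrite RintegralD //; exact: continuous_integrable.
by rewrite f0 // g0 // addr0.
Qed.

Lemma int1_scale (a : R) f r : continuous f -> zero_off r f ->
  int1 (fun t => a * f t) = a * int1 f.
Proof.
move=> cf f0; rewrite (int1E f0) (@int1E _ r) => [|t rt].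
  by rewrite RintegralZl //; exact: continuous_integrable.
by rewrite f0 // mulr0.
Qed.

Lemma int1_bound (r : R) : exists2 M : R, 0 < M & forall f (B : R), continuous f -> zero_off r f ->
  (forall t, `|f t| <= B) -> `|int1 f| <= B * M.
Proof.
exists (1 + fine (mu `[- r, r])) => [|f B cf f0 hB].
  by rewrite ltr_pwDl // fine_ge0.
have B0 : 0 <= B by apply: le_trans (hB 0).
rewrite (int1E f0) mulrDr mulr1 -[leLHS]add0r lerD //.
rewrite -Rintegral_cst //; apply: le_trans (le_normr_Rintegral _ _) _ => //.
  exact: continuous_integrable.
apply: le_Rintegral => //; [|exact: continuous_integrable (fun _ => cvg_cst _)].
apply: (@continuous_integrable (fun t => `|f t|)) => t.
by apply: (@cvg_norm _ _ _ _ _ f (f t)) => //; exact: cf.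
Qed.

Lemma int1_derive f r : scurve f -> zero_off r f -> int1 f^`() = 0.
Proof.
move=> sf f0; pose p := 1 + `|r|; have p0 : 0 < p by rewrite ltr_pwDl.
have rp : r < p by apply: le_lt_trans (ler_norm r) _; rewrite ltrDr.
have f'0 : zero_off p f^`().
  move=> t rt; apply: der_derive1; apply: (@der_near _ _ (fun=> 0)); last exact: der_cst.
  apply/near_normP; exists (`|t| - p) => [|u ut]; first by rewrite subr_gt0.
  rewrite f0 //; have := ler_normD (t - u) u; rewrite subrK distrC; lra.
rewrite (int1E f'0) /Rintegral (@continuous_FTC2 _ _ f).
- by rewrite /= !f0 ?normrN ?gtr0_norm // subrr.
- lra.
- by apply: continuous_subspaceT; exact: scurve_continuous (scurve_derive sf).
- split.
  + by move=> x _; exact: der_derivable (scurve_der x sf).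
  + by apply: cvg_at_right_filter; exact: scurve_continuous.
  + by apply: cvg_at_left_filter; exact: scurve_continuous.
- by [].
Qed.

Lemma int1_opp f r : continuous f -> zero_off r f -> int1 (fun t => f (- t)) = int1 f.
Proof.
move=> cf f0; pose p := `|r|; have f0' : zero_off p f.
  by move=> t pt; apply: f0; apply: le_lt_trans pt; exact: ler_norm.
rewrite (int1E f0') (@int1E _ p); last by move=> t pt; rewrite f0' // normrN.
have pp : - p <= p by rewrite ge0_cp ?normr_ge0.
have := @integration_by_substitution_oppr R f (- p) p pp.
rewrite opprK => h; rewrite /Rintegral h //; exact: continuous_subspaceT.
Qed.

End LineIntegral.

(** * Integrals depending on a parameter *)

Section Families.
Local Open Scope ring_scope.
Local Open Scope classical_set_scope.
Context {R : realType}.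

(** The shape of the arguments in [int_Rn]. The first entry is either the outermost integration
    variable or the parameter of a family. *)
Definition tcons (n : nat) (t : R) (y : 'rV[R]_n) : 'rV[R]_(1 + n) := row_mx (t%:M : 'rV[R]_1) y.

Lemma der_tcons n (t : R -> R) (y : R -> 'rV[R]_n) u dt dy : der t u dt -> der y u dy ->
  der (fun u => tcons (t u) (y u)) u (tcons dt dy).
Proof.
move=> ht hy; apply: der_row_mx => //; apply: der_coord_row => i.
by rewrite ord1 mxE eqxx mulr1n; under eq_fun do rewrite mxE eqxx mulr1n.
Qed.

Lemma scurve_tcons n (t : R -> R) (y : R -> 'rV[R]_n) : scurve t -> scurve y ->
  scurve (fun u => tcons (t u) (y u)).
Proof.
move=> ht hy; apply: scurve_row_mx => //; apply: scurve_coord_row => i.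
by rewrite ord1; under eq_fun do rewrite mxE eqxx mulr1n.
Qed.

Lemma norm_tcons_r n t (y : 'rV[R]_n) : `|y| <= `|tcons t y|.
Proof.
apply: row_norm_le => // i; have := coord_norm_le (tcons t y) (rshift 1 i).
by rewrite /tcons row_mxEr.
Qed.

Lemma norm_tcons_l n t (y : 'rV[R]_n) : `|t| <= `|tcons t y|.
Proof.
have := coord_norm_le (tcons t y) (lshift n ord0).
by rewrite /tcons row_mxEl mxE eqxx mulr1n.
Qed.

Lemma norm_tcons_le n t (y : 'rV[R]_n) (r : R) : `|t| <= r -> `|y| <= r -> `|tcons t y| <= r.
Proof.
move=> h1 h2; apply: row_norm_le => [|i]; first exact: le_trans h2.
rewrite mxE; case: splitP => j _; first by rewrite ord1 mxE eqxx mulr1n.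
exact: le_trans (coord_norm_le _ _) h2.
Qed.

Definition pd0 n (h : 'rV[R]_(1 + n) -> R) : 'rV[R]_(1 + n) -> R := pderiv (lshift n ord0) h.

Lemma delta_tcons0 n : delta_mx 0 (lshift n ord0) = tcons 1 (0 : 'rV[R]_n).
Proof.
rewrite /tcons; apply/rowP => i; rewrite !mxE eqxx -val_eqE /=.
by case: splitP => j ->; rewrite ?ord1 !mxE ?eqxx.
Qed.

Lemma delta_tconsS n k : delta_mx 0 (rshift 1 k) = tcons 0 (delta_mx 0 k : 'rV[R]_n).
Proof.
rewrite /tcons; apply/rowP => i; rewrite !mxE eqxx -val_eqE /=.
case: splitP => j ->; first by rewrite ?ord1 !mxE mul0rn.
by rewrite eqn_add2l !mxE eqxx.
Qed.

Lemma asmooth_der (n : nat) (h : 'rV[R]_n -> R) (c : R -> 'rV[R]_n) t i : asmooth setT h ->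
  der c t (delta_mx 0 i) -> der (fun t => h (c t)) t (pderiv i h (c t)).
Proof.
move=> sh hc; have := asmooth_chain fincoord_real openT sh I hc.
rewrite (bigD1 i) //= big1 ?addr0; first by rewrite mxE !eqxx scale1r.
by move=> k ki; rewrite mxE eqxx /= (negbTE ki) scale0r.
Qed.

Lemma der_first n (h : 'rV[R]_(1 + n) -> R) s y : asmooth setT h ->
  der (fun s => h (tcons s y)) s (pd0 h (tcons s y)).
Proof.
move=> sh; apply: (@asmooth_der _ h (fun s => tcons s y)) => //.
rewrite delta_tcons0; apply: der_tcons; [exact: der_id|exact: der_cst].
Qed.

Lemma asmooth_pd0 n (h : 'rV[R]_(1 + n) -> R) : asmooth setT h -> asmooth setT (pd0 h).
Proof. by move=> sh; apply: asmooth_pderiv => //; [exact: fincoord_real|exact: openT]. Qed.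

Lemma asmoothT_curve (n : nat) (h : 'rV[R]_n -> R) (c : R -> 'rV[R]_n) : asmooth setT h ->
  scurve c -> scurve (fun t => h (c t)).
Proof. by move=> /asmoothP h1 sc; exact: h1. Qed.

(** The support is bounded in the integration variable only, uniformly in the parameter s. *)
Definition supp_in n (r : R) (h : 'rV[R]_(1 + n) -> R) : Prop :=
  forall s y, r < `|y| -> h (tcons s y) = 0.

Lemma supp_in_pd0 n (r : R) (h : 'rV[R]_(1 + n) -> R) : asmooth setT h ->
  supp_in r h -> supp_in r (pd0 h).
Proof.
move=> sh h0 s y ry; apply: (der_uniq (der_first s y sh)).
by under eq_fun do rewrite h0 //; exact: der_cst.
Qed.

Local Notation pt s t := (tcons s (t%:M : 'rV[R]_1)).

Lemma norm_scalar_row (t : R) : `|t%:M : 'rV[R]_1| = `|t|.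
Proof.
apply/eqP; rewrite eq_le; apply/andP; split.
  by apply: row_norm_le => // i; rewrite ord1 mxE eqxx mulr1n.
by have := coord_norm_le (t%:M : 'rV[R]_1) 0; rewrite mxE eqxx mulr1n.
Qed.

Lemma scurve_scalar_row : scurve (fun t : R => t%:M : 'rV[R]_1).
Proof.
apply: scurve_coord_row => i; rewrite ord1; under eq_fun do rewrite mxE eqxx mulr1n.
exact: scurve_id.
Qed.

Lemma scurve_pt (g : 'rV[R]_(1 + 1) -> R) s : asmooth setT g -> scurve (fun t => g (pt s t)).
Proof.
move=> sg; apply: (@asmoothT_curve _ g (fun t => pt s t)) => //.
by apply: scurve_tcons; [exact: scurve_cst|exact: scurve_scalar_row].
Qed.

(** The Taylor remainder in s is at most C h^2 uniformly in t, and it is integrated over a bounded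
    set. *)
Lemma der_int1 (g : 'rV[R]_(1 + 1) -> R) (r : R) s : asmooth setT g -> supp_in r g ->
  der (fun s => int1 (fun t => g (pt s t))) s (int1 (fun t => pd0 g (pt s t))).
Proof.
move=> sg g0; have sg1 := asmooth_pd0 sg; have sg2 := asmooth_pd0 sg1.
have z0 s' : zero_off r (fun t => g (pt s' t)).
  by move=> t rt; rewrite g0 // norm_scalar_row.
have z1 s' : zero_off r (fun t => pd0 g (pt s' t)).
  by move=> t rt; rewrite (supp_in_pd0 sg g0) // norm_scalar_row.
have c0 s' : continuous (fun t => g (pt s' t)) by exact: scurve_continuous (scurve_pt s' sg).
have c1 s' : continuous (fun t => pd0 g (pt s' t)) by exact: scurve_continuous (scurve_pt s' sg1).
have [C C0 hC] := asmooth_bounded fincoord_real openT sg2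
   (@compact_norm_ball R (1 + 1) 0 (`|s| + `|r| + 1)) (fun _ _ => I).
have [M M0 hM] := int1_bound r.
have T (h t : R) : `|h| < 1 -> `|g (pt (s + h) t) + ((-1) * g (pt s t) + (- h) * pd0 g (pt s t))| <= C * h ^+ 2.
  move=> h1; have [rt|tr] := ltP r `|t|.
    rewrite z0 // z0 // z1 // !mulr0 !addr0 normr0 mulr_ge0 ?sqr_ge0 //; exact: ltW.
  have d1 s' := der_first s' (t%:M : 'rV[R]_1) sg.
  have E1 : (fun s => g (pt s t))^`() = fun s => pd0 g (pt s t).
    by apply/funext => s'; apply: der_derive1; exact: d1.
  have sc : scurve (fun s => g (pt s t)).
    apply: (@asmoothT_curve _ g (fun s => pt s t)) => //.
    by apply: scurve_tcons; [exact: scurve_id|exact: scurve_cst].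
  have := scurve_taylor sc (t := s) (r := 1) (C := C) _ h1.
  rewrite E1 mulN1r mulNr addrA; apply => u us.
  rewrite derive1nS derive1n1 E1 (der_derive1 (der_first u (t%:M : 'rV[R]_1) sg1)).
  apply: hC; rewrite /= subr0; apply: norm_tcons_le.
    have := ler_normD (u - s) s; rewrite subrK; have := normr_ge0 r; lra.
  by rewrite norm_scalar_row; have := ler_norm r; have := normr_ge0 s; lra.
apply/der_cvgP/cvgrPdist_le => e e0.
have hh : \forall h \near (0 : R), `|h| < 1 /\ `|h| <= e / (C * M).
  near=> h; split; near: h; first exact: (@nbhs0_lt _ R).
  by apply: (@nbhs0_le _ R); rewrite divr_gt0 // mulr_gt0.
near=> h; have h0 : h != 0 by near: h; exact: nbhs_dnbhs_neq.
have [hr he] : `|h| < 1 /\ `|h| <= e / (C * M) by near: h; exact: cvg_within hh.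
rewrite (addrC h s).
have zA : zero_off r (fun t => (-1) * g (pt s t) + (- h) * pd0 g (pt s t)).
  by move=> t rt; rewrite z0 // z1 // !mulr0 addr0.
have cA : continuous (fun t => (-1) * g (pt s t) + (- h) * pd0 g (pt s t)).
  have sA : scurve (fun t => (-1) * g (pt s t) + (- h) * pd0 g (pt s t)).
    apply: scurve_add; (apply: scurve_mul; first exact: scurve_cst); exact: scurve_pt.
  exact: scurve_continuous.
have E1 : int1 (fun t => g (pt (s + h) t) + ((-1) * g (pt s t) + (- h) * pd0 g (pt s t))) =
    int1 (fun t => g (pt (s + h) t)) - int1 (fun t => g (pt s t)) - h * int1 (fun t => pd0 g (pt s t)).
  have zm1 : zero_off r (fun t => (-1) * g (pt s t)) by move=> t rt; rewrite z0 // mulr0.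
  have zmh : zero_off r (fun t => (- h) * pd0 g (pt s t)) by move=> t rt; rewrite z1 // mulr0.
  have cm1 : continuous (fun t => (-1) * g (pt s t)).
    have sA : scurve (fun t => (-1) * g (pt s t)).
      by apply: scurve_mul; [exact: scurve_cst|exact: scurve_pt].
    exact: scurve_continuous.
  have cmh : continuous (fun t => (- h) * pd0 g (pt s t)).
    have sA : scurve (fun t => (- h) * pd0 g (pt s t)).
      by apply: scurve_mul; [exact: scurve_cst|exact: scurve_pt].
    exact: scurve_continuous.
  rewrite (int1_add (c0 _) cA (z0 _) zA) (int1_add cm1 cmh zm1 zmh).
  rewrite (int1_scale _ (c0 s) (z0 s)) (int1_scale _ (c1 s) (z1 s)).
  by rewrite mulN1r mulNr addrA.
have := hM (fun t => g (pt (s + h) t) + ((-1) * g (pt s t) + (- h) * pd0 g (pt s t))) (C * h ^+ 2).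
rewrite E1 => hB.
set A := int1 (fun t => pd0 g (pt s t)) in hB *.
rewrite (_ : A - _ = - (h^-1 * (int1 (fun t => g (pt (s + h) t)) - int1 (fun t => g (pt s t)) - h * A))).
  rewrite normrN normrM normfV ler_pdivrMl ?normr_gt0 //.
  apply: le_trans (hB _ _ _) _.
  - have sA : scurve (fun t => g (pt (s + h) t) + ((-1) * g (pt s t) + (- h) * pd0 g (pt s t))).
      apply: scurve_add; first exact: scurve_pt.
      apply: scurve_add; (apply: scurve_mul; first exact: scurve_cst); exact: scurve_pt.
    exact: scurve_continuous.
  - by move=> t rt; rewrite z0 // zA // addr0.
  - by move=> t; exact: T.
  rewrite -real_normK ?num_real // (_ : _ * M = `|h| * (`|h| * (C * M))); last by ring.
  by rewrite ler_pM2l ?normr_gt0 // -ler_pdivlMr // mulr_gt0.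
by rewrite mulrBr mulKf // opprB.
Unshelve. all: by end_near. Qed.

Lemma scurve_int1 (g : 'rV[R]_(1 + 1) -> R) (r : R) : asmooth setT g -> supp_in r g ->
  scurve (fun s => int1 (fun t => g (pt s t))).
Proof.
move=> sg g0; apply/scurve_cn => k; elim: k g sg g0 => // k IH g sg g0.
exists (fun s => int1 (fun t => pd0 g (pt s t))); first by move=> s; exact: der_int1 sg g0.
by apply: IH; [exact: asmooth_pd0|exact: supp_in_pd0].
Qed.

End Families.

Section IteratedIntegral.
Local Open Scope ring_scope.
Local Open Scope classical_set_scope.
Context {R : realType}.

Lemma int_RnS n (f : 'rV[R]_n.+1 -> R) :
  int_Rn f = int1 (fun t => int_Rn (fun y : 'rV[R]_n => f (tcons t y))).
Proof. by []. Qed.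

Lemma int_Rn0 n : int_Rn (fun _ : 'rV[R]_n => 0 : R) = 0.
Proof.
elim: n => // n IH; rewrite int_RnS; under eq_fun do rewrite IH.
by rewrite /int1 Rintegral_cst // mul0r.
Qed.

Lemma asmooth_tcons n (h : 'rV[R]_(1 + n) -> R) (p : 'rV[R]_n -> R) :
  asmooth setT h -> asmooth setT p -> asmooth setT (fun y => h (tcons (p y) y)).
Proof.
move=> sh /asmoothP sp; apply/asmoothP => c sc _.
by apply: (@asmoothT_curve _ _ h (fun u => tcons (p (c u)) (c u))) => //; apply: scurve_tcons => //; exact: sp.
Qed.

(** Smoothness and the formula for the derivative are proved together, since the induction needs
    both for the inner integral. *)
Lemma int_Rn_family n (h : 'rV[R]_(1 + n) -> R) (r : R) : asmooth setT h -> supp_in r h ->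
  scurve (fun s => int_Rn (fun y => h (tcons s y))) /\
  forall s, der (fun s => int_Rn (fun y => h (tcons s y))) s (int_Rn (fun y => pd0 h (tcons s y))).
Proof.
elim: n h => [|n IH] h sh h0.
  split=> [|s]; last exact: der_first.
  apply: (@asmoothT_curve _ _ h (fun s => tcons s 0)) => //.
  by apply: scurve_tcons; [exact: scurve_id|exact: scurve_cst].
(* The inner integral as a function of the parameter and the outermost variable. Along a curve it is
   again a one-parameter family, so the induction hypothesis yields its joint smoothness. *)
pose G (z : 'rV[R]_(1 + 1)) : R :=
  int_Rn (fun y : 'rV[R]_n => h (tcons (lsubmx z 0 0) (tcons (rsubmx z 0 0) y))).
have GE s t : G (tcons s t%:M) = int_Rn (fun y : 'rV[R]_n => h (tcons s (tcons t y))).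
  by rewrite /G /tcons row_mxKl row_mxKr !mxE eqxx !mulr1n.
have sup' (s t : R -> R) : supp_in r (fun z : 'rV[R]_(1 + n) =>
    h (tcons (s (lsubmx z 0 0)) (tcons (t (lsubmx z 0 0)) (rsubmx z)))).
  move=> u y ry; rewrite /tcons row_mxKl row_mxKr; apply: h0; apply: lt_le_trans ry _.
  exact: norm_tcons_r.
have sh' (s t : R -> R) : scurve s -> scurve t ->
    asmooth setT (fun z : 'rV[R]_(1 + n) => h (tcons (s (lsubmx z 0 0)) (tcons (t (lsubmx z 0 0)) (rsubmx z)))).
  move=> ss st; apply/asmoothP => c sc _.
  have sl : scurve (fun u => lsubmx (c u) 0 0) by apply: scurve_coord; exact: scurve_lsubmx.
  have sr : scurve (fun u => rsubmx (c u)) by exact: scurve_rsubmx.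
  apply: (@asmoothT_curve _ _ h (fun u => tcons (s (lsubmx (c u) 0 0))
    (tcons (t (lsubmx (c u) 0 0)) (rsubmx (c u))))) => //.
  by apply: scurve_tcons; [exact: scurve_comp sl ss|apply: scurve_tcons => //; exact: scurve_comp sl st].
have E1 (s t : R -> R) u y : (fun z : 'rV[R]_(1 + n) =>
    h (tcons (s (lsubmx z 0 0)) (tcons (t (lsubmx z 0 0)) (rsubmx z)))) (tcons u y) =
    h (tcons (s u) (tcons (t u) y)).
  by rewrite /tcons row_mxKl row_mxKr !mxE eqxx mulr1n.
have sG : asmooth setT G.
  apply/asmoothP => c sc _.
  have sl : scurve (fun u => lsubmx (c u) 0 0) by apply: scurve_coord; exact: scurve_lsubmx.
  have sr : scurve (fun u => rsubmx (c u) 0 0) by apply: scurve_coord; exact: scurve_rsubmx.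
  have [h1 _] := IH _ (sh' _ _ sl sr) (sup' (fun u => lsubmx (c u) 0 0) (fun u => rsubmx (c u) 0 0)).
  rewrite (_ : (fun u => _) = (fun u => int_Rn (fun y : 'rV[R]_n =>
     h (tcons (lsubmx (c u) 0 0) (tcons (rsubmx (c u) 0 0) y))))) //.
  move: h1; rewrite (_ : (fun s => _) = (fun u => int_Rn (fun y : 'rV[R]_n =>
     h (tcons (lsubmx (c u) 0 0) (tcons (rsubmx (c u) 0 0) y))))) //.
  by apply/funext => u; congr int_Rn; apply/funext => y;
    exact: (E1 (fun u => lsubmx (c u) 0 0) (fun u => rsubmx (c u) 0 0) u y).
have G0 : supp_in r G.
  move=> s t rt; have tE : t = (t 0 0)%:M by apply/rowP => i; rewrite ord1 mxE eqxx mulr1n.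
  rewrite tE GE -[RHS](int_Rn0 n); congr int_Rn; apply/funext => y; apply: h0.
  by apply: lt_le_trans (norm_tcons_l _ _); rewrite -norm_scalar_row -tE.
have dG s t : pd0 G (tcons s t%:M) = int_Rn (fun y : 'rV[R]_n => pd0 h (tcons s (tcons t y))).
  have [_ h2] := IH _ (sh' _ _ (@scurve_id R) (@scurve_cst R R t)) (sup' (fun u => u) (fun=> t)).
  have sh2 := sh' _ _ (@scurve_id R) (@scurve_cst R R t).
  have h3 := der_first s (t%:M : 'rV[R]_1) sG.
  apply: (der_uniq h3); under eq_fun do rewrite GE.
  have := h2 s; rewrite (_ : (fun s => _) = (fun s => int_Rn (fun y : 'rV[R]_n => h (tcons s (tcons t y))))).
    rewrite (_ : int_Rn _ = int_Rn (fun y : 'rV[R]_n => pd0 h (tcons s (tcons t y)))) //.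
    congr int_Rn; apply/funext => y; apply: (der_uniq (der_first s y sh2)).
    have := der_first s (tcons t y) sh; congr (der _ _ _); apply/funext => u.
    exact: esym (E1 (fun u => u) (fun=> t) u y).
  by apply/funext => u; congr int_Rn; apply/funext => y; exact: (E1 (fun u => u) (fun=> t) u y).
have E2 s : int_Rn (fun y => h (tcons s y)) = int1 (fun t => G (tcons s t%:M)).
  by rewrite int_RnS; under [in RHS]eq_fun do rewrite GE.
under eq_fun do rewrite E2; split; first exact: scurve_int1 sG G0.
move=> s; rewrite int_RnS; under [X in der _ _ (int1 X)]eq_fun do rewrite -dG.
exact: der_int1 sG G0.
Qed.

Definition cc n (V : normedModType R) (f : 'rV[R]_n -> V) : Prop := asmooth setT f /\ exists r : R, zero_off r f.

Lemma zero_offW (V V1 : normedModType R) (f : V -> V1) (r r' : R) : r <= r' -> zero_off r f -> zero_off r' f.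
Proof. by move=> rr f0 t rt; apply: f0; exact: le_lt_trans rt. Qed.

Lemma cc_slice n (f : 'rV[R]_(1 + n) -> R) t : cc f -> cc (fun y => f (tcons t y)).
Proof.
move=> [sf [r f0]]; split; last first.
  by exists r => y ry; apply: f0; apply: lt_le_trans ry _; exact: norm_tcons_r.
by apply: (asmooth_tcons (p := fun=> t)) => //; exact: asmooth_cst.
Qed.

Lemma cc_supp n (f : 'rV[R]_(1 + n) -> R) (r : R) : zero_off r f -> supp_in r f.
Proof. by move=> f0 s y ry; apply: f0; apply: lt_le_trans ry _; exact: norm_tcons_r. Qed.

Lemma scurve_slice n (f : 'rV[R]_(1 + n) -> R) : cc f ->
  scurve (fun t => int_Rn (fun y => f (tcons t y))).
Proof. by move=> [sf [r f0]]; have [] := int_Rn_family sf (cc_supp f0). Qed.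

Lemma zero_off_slice n (f : 'rV[R]_(1 + n) -> R) (r : R) : zero_off r f ->
  zero_off r (fun t => int_Rn (fun y => f (tcons t y))).
Proof.
move=> f0 t rt; rewrite -[RHS](int_Rn0 n); congr int_Rn; apply/funext => y; apply: f0.
by apply: lt_le_trans rt _; exact: norm_tcons_l.
Qed.

Lemma cc_add n (f g : 'rV[R]_n -> R) : cc f -> cc g -> cc (fun y => f y + g y).
Proof.
move=> [sf [r f0]] [sg [r' g0]]; split; first exact: asmooth_add.
exists (Num.max r r') => y; rewrite gt_max => /andP[h1 h2].
by rewrite f0 // g0 // addr0.
Qed.

Lemma cc_mul n (f g : 'rV[R]_n -> R) : asmooth setT f -> cc g -> cc (fun y => f y * g y).
Proof.
move=> sf [sg [r' g0]]; split; first exact: asmooth_mul.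
by exists r' => y h; rewrite g0 // mulr0.
Qed.

Lemma cc_pderiv n (f : 'rV[R]_n -> R) i : cc f -> cc (pderiv i f).
Proof.
move=> [sf [r f0]]; split; first by apply: asmooth_pderiv => //; [exact: fincoord_real|exact: openT].
exists r => y ry; apply: pderiv_der; apply: (@der_near _ _ (fun=> 0)); last exact: der_cst.
have := scurve_continuous (scurve_line y (delta_mx 0 i)) 0.
move=> /continuous_normP /(_ ((`|y| - r) / 2)).
rewrite divr_gt0 ?subr_gt0 // => /(_ isT)[d d0 hd]; apply/near_normP; exists d => // t /hd.
rewrite scale0r addr0 => h; rewrite f0 //.
have := ler_normD (y - (y + t *: delta_mx 0 i)) (y + t *: delta_mx 0 i); rewrite subrK distrC; lra.
Qed.

Lemma int_Rn_add n (f g : 'rV[R]_n -> R) : cc f -> cc g ->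
  int_Rn (fun y => f y + g y) = int_Rn f + int_Rn g.
Proof.
elim: n f g => // n IH f g cf cg; rewrite !int_RnS.
have [_ [r f0]] := cf; have [_ [r' g0]] := cg.
under eq_fun do rewrite (IH _ _ (cc_slice _ cf) (cc_slice _ cg)).
apply: (@int1_add _ _ _ (Num.max r r')).
- exact: scurve_continuous (scurve_slice cf).
- exact: scurve_continuous (scurve_slice cg).
- by apply: zero_off_slice; apply: zero_offW f0; rewrite le_max lexx.
- by apply: zero_off_slice; apply: zero_offW g0; rewrite le_max lexx orbT.
Qed.

Lemma int_Rn_scale n (a : R) (f : 'rV[R]_n -> R) : cc f ->
  int_Rn (fun y => a * f y) = a * int_Rn f.
Proof.
elim: n f => // n IH f cf; rewrite !int_RnS; have [_ [r f0]] := cf.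
under eq_fun do rewrite (IH _ (cc_slice _ cf)).
apply: (@int1_scale _ _ _ r); [exact: scurve_continuous (scurve_slice cf)|exact: zero_off_slice].
Qed.

Lemma int_Rn_sum n (I : Type) (q : seq I) (f : I -> 'rV[R]_n -> R) : (forall i, cc (f i)) ->
  cc (fun y => \sum_(i <- q) f i y) /\
  int_Rn (fun y => \sum_(i <- q) f i y) = \sum_(i <- q) int_Rn (f i).
Proof.
move=> cf; elim: q => [|i q [IH1 IH2]].
  under eq_fun do rewrite big_nil; rewrite big_nil int_Rn0; split=> //.
  by split; [exact: asmooth_cst|exists 0].
under eq_fun do rewrite big_cons; rewrite big_cons -IH2; split; first exact: cc_add.
exact: int_Rn_add.
Qed.

Lemma pderiv_tail n (h : 'rV[R]_(1 + n) -> R) t y k : asmooth setT h ->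
  pderiv (rshift 1 k) h (tcons t y) = pderiv k (fun y => h (tcons t y)) y.
Proof.
move=> sh; apply/esym; apply: pderiv_der.
have hc : der (fun u : R => tcons t (y + u *: delta_mx 0 k)) 0 (delta_mx 0 (rshift 1 k)).
  by rewrite delta_tconsS; apply: der_tcons; [exact: der_cst|exact: der_line].
by have := asmooth_der sh hc; rewrite scale0r addr0.
Qed.

(** In the first coordinate the derivative is pulled out of the inner integral and the outer one is
    a fundamental theorem of calculus; in the others the inner integral vanishes by induction. *)
Lemma int_Rn_pderiv n (f : 'rV[R]_n -> R) i : cc f -> int_Rn (pderiv i f) = 0.
Proof.
elim: n f i => [f []//|n IH f i cf]; have [sf [r f0]] := cf; rewrite int_RnS.
case: (split_ordP (i : 'I_(1 + n))) => j ->.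
  rewrite ord1 (_ : (fun t => _) = (fun t => int_Rn (fun y => f (tcons t y)))^`()).
    exact: int1_derive (scurve_slice cf) (zero_off_slice f0).
  apply/funext => t; apply/esym; apply: der_derive1.
  by have [_ h] := int_Rn_family sf (cc_supp f0); exact: h.
rewrite (_ : (fun t => _) = (fun=> 0)).
  by rewrite /int1 Rintegral_cst // mul0r.
apply/funext => t; under eq_fun do rewrite (pderiv_tail t _ j sf).
by apply: IH; exact: cc_slice.
Qed.

End IteratedIntegral.

(** * Homotopy invariance and change of variables *)

Section DivergenceOfMinors.
Local Open Scope ring_scope.
Local Open Scope classical_set_scope.
Context {R : realType}.

Lemma pderivM (n : nat) (a b : 'rV[R]_n -> R) i x : asmooth setT a -> asmooth setT b ->
  pderiv i (fun x => a x * b x) x = pderiv i a x * b x + a x * pderiv i b x.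
Proof.
by move=> sa sb; exact: (@ddir_scale _ _ _ setT a b (delta_mx 0 i) x fincoord_real openT sa sb I).
Qed.

Lemma pderiv_prod (n : nat) (I : eqType) (q : seq I) (a : I -> 'rV[R]_n -> R) i x : uniq q ->
  (forall m, asmooth setT (a m)) ->
  pderiv i (fun x => \prod_(m <- q) a m x) x =
    \sum_(k <- q) pderiv i (a k) x * \prod_(m <- q | m != k) a m x.
Proof.
move=> uq sa; elim: q uq => [_|m0 q IH /= /andP[m0q uq]].
  by under eq_fun do rewrite big_nil; rewrite big_nil pderiv_cst.
under eq_fun do rewrite big_cons; rewrite pderivM //; last exact: asmooth_prod.
rewrite IH // !big_cons eqxx /=; congr (_ * _ + _).
  rewrite big_seq_cond [RHS]big_seq_cond; apply: eq_bigl => m.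
  by rewrite andbT; case mq: (m \in q) => //=; apply/esym; apply: contraNneq m0q => <-.
rewrite mulr_sumr [LHS]big_seq [RHS]big_seq; apply: eq_bigr => k kq; rewrite big_cons.
have -> : m0 != k by apply: contraNneq m0q => ->.
by rewrite mulrCA.
Qed.

(** The product has rank at most n and size n + 1. *)
Lemma det_tall_mul (n : nat) (B : 'M[R]_(1 + n, n)) (C : 'M[R]_(n, 1 + n)) : \det (B *m C) = 0.
Proof.
apply/eqP; apply: contraT => h.
have : B *m C \in unitmx by rewrite unitmxE unitfE.
rewrite -row_full_unit => /eqP h1; have := leq_trans (mxrankM_maxl B C) (rank_leq_col B).
by rewrite h1 ltnn.
Qed.

Lemma det_perm_col (n : nat) (A : 'M[R]_n) : \det A = \sum_(f : 'S_n) (-1) ^+ f * \prod_i A (f i) i.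
Proof. by rewrite -det_tr; apply: eq_bigr => f _; congr (_ * _); apply: eq_bigr => i _; rewrite mxE. Qed.

Variables (n : nat) (Th : 'rV[R]_(1 + n) -> 'rV[R]_n) (g : 'rV[R]_n -> R).
Hypotheses (sTh : asmooth setT Th) (sg : asmooth setT g).
Local Notation E := 'rV[R]_(1 + n).
Local Notation o := (lshift n (@ord0 0)).
Local Notation su m := (rshift 1 m).

Let u m (z : E) : R := Th z 0 m.
Let w (z : E) : R := g (Th z).

Lemma asmooth_u m : asmooth setT (u m).
Proof. exact: asmooth_comp_coord. Qed.

Lemma asmooth_w : asmooth setT w.
Proof. by apply: (asmooth_comp sTh _ sg). Qed.

Lemma asmooth_pu i m : asmooth setT (pderiv i (u m)).
Proof. by apply: asmooth_pderiv; [exact: fincoord_real|exact: openT|exact: asmooth_u]. Qed.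

(* The fluxes are, up to sign, the coefficients of the n-form Th^*(g dx_1 ... dx_n);
   its closedness is [flux_divergence]. *)
Definition minor_mx (k : 'I_(1 + n)) (z : E) : 'M[R]_(1 + n) :=
  row_mx (delta_mx k 0 : 'cV[R]_(1 + n)) (\matrix_(p, m) pderiv p (u m) z).

Definition flux (k : 'I_(1 + n)) (z : E) : R := w z * \det (minor_mx k z).

Let term (f : 'S_(1 + n)) (z : E) : R := \prod_m pderiv (f (su m)) (u m) z.

Lemma asmooth_term f : asmooth setT (term f).
Proof. by apply: asmooth_prod => m; exact: asmooth_pu. Qed.

Lemma det_row_mx_term (a : 'cV[R]_(1 + n)) z :
  \det (row_mx a (\matrix_(p, m) pderiv p (u m) z)) =
    \sum_(f : 'S_(1 + n)) (-1) ^+ f * (a (f o) 0 * term f z).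
Proof.
rewrite det_perm_col; apply: eq_bigr => f _; congr (_ * _); rewrite big_split_ord /= big_ord1.
rewrite row_mxEl; congr (_ * _); apply: eq_bigr => m _.
by rewrite row_mxEr mxE.
Qed.

Lemma asmooth_flux k : asmooth setT (flux k).
Proof.
apply: asmooth_mul; first exact: asmooth_w.
apply: asmooth_det => i j; rewrite /minor_mx; case: (split_ordP j) => m ->.
  by under eq_fun do rewrite row_mxEl; exact: asmooth_cst.
by under eq_fun do rewrite row_mxEr mxE; exact: asmooth_pu.
Qed.

(** Composition with the transposition of [o] and k reverses the sign and keeps X. *)
Lemma alternating_sum0 (X : 'S_(1 + n) -> R) (k : 'I_(1 + n)) : k != o ->
  (forall f, X (tperm o k * f)%g = X f) -> \sum_(f : 'S_(1 + n)) (-1) ^+ f * X f = 0.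
Proof.
move=> ko hX; set S := \sum_f _.
suff : S = - S by move=> h; lra.
rewrite {1}/S (reindex_inj (mulgI (tperm o k))) /= -sumrN; apply: eq_bigr => f _.
by rewrite odd_permM odd_tperm eq_sym ko hX /= signrN mulNr.
Qed.

(** If the derivative falls on w, the terms form a determinant whose first column, the gradient of
    w, is a combination of the other n columns by the chain rule. If it falls on an entry of the
    matrix, second derivatives appear, and their symmetry cancels the terms in pairs. *)
Lemma flux_divergence z : \sum_k pderiv k (flux k) z = 0.
Proof.
have E1 k : flux k = fun z => \sum_(f : 'S_(1 + n)) ((-1) ^+ f * (f o == k)%:R) * (w z * term f z).
  apply/funext => x; rewrite /flux /minor_mx det_row_mx_term mulr_sumr; apply: eq_bigr => f _.
  by rewrite mxE eqxx andbT mulrCA !mulrA -!mulrA [w x * _]mulrCA.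
have swt f : asmooth setT (fun z => w z * term f z).
  by apply: asmooth_mul; [exact: asmooth_w|exact: asmooth_term].
have E2 k : pderiv k (flux k) z =
    \sum_(f : 'S_(1 + n)) ((-1) ^+ f * (f o == k)%:R) * pderiv k (fun z => w z * term f z) z.
  have sft (f : {perm 'I_(1 + n)}) :
      asmooth setT (fun z => ((-1) ^+ f * (f o == k)%:R) * (w z * term f z)).
    by apply: asmooth_mul; [exact: asmooth_cst|exact: swt].
  rewrite E1; apply: etrans (@ddir_sum _ _ _ setT _ (index_enum {perm 'I_(1 + n)})
    (fun f z => ((-1) ^+ f * (f o == k)%:R) * (w z * term f z)) (delta_mx 0 k) z
     fincoord_real openT sft I) _.
  apply: eq_bigr => f _; apply: etrans (pderivM _ _ _ _) _ => //; first exact: asmooth_cst.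
  by rewrite pderiv_cst mul0r add0r.
under eq_bigr do rewrite E2; rewrite exchange_big /=.
under eq_bigr => f _.
  rewrite (bigD1 (f o)) //= eqxx mulr1 big1 ?addr0; last first.
    by move=> k; rewrite eq_sym => /negbTE ->; rewrite mulr0 mul0r.
  rewrite pderivM; [|exact: asmooth_w|exact: asmooth_term].
  rewrite {2}/term pderiv_prod; [|exact: index_enum_uniq|by move=> m; exact: asmooth_pu].
  rewrite mulrDr; over.
rewrite big_split /=.
have -> : \sum_(f : 'S_(1 + n)) (-1) ^+ f * (pderiv (f o) w z * term f z) = 0.
  have := det_row_mx_term (\col_p pderiv p w z) z.
  under eq_bigr do rewrite mxE; move=> <-.
  pose B := \matrix_(p, m) pderiv p (u m) z.
  rewrite -/B (_ : row_mx _ _ = B *m row_mx (\col_l pderiv l g (Th z)) 1%:M); first exact: det_tall_mul.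
  rewrite mul_mx_row mulmx1; congr row_mx; apply/colP => p; rewrite !mxE.
  have := ddir_comp openT openT sTh (fun _ _ => I) (delta_mx 0 p) fincoord_real sg (I : setT z).
  rewrite /ddir -/(pderiv p w z) => ->; apply: eq_bigr => l _; rewrite !mxE.
  by rewrite /u (pderiv_coord p l openT sTh).
rewrite add0r; under eq_bigr do rewrite mulr_sumr mulr_sumr; rewrite exchange_big big1 //= => q _.
apply: (@alternating_sum0 (fun f => w z * (pderiv (f o) (pderiv (f (su q)) (u q)) z *
  \prod_(m < n | m != q) pderiv (f (su m)) (u m) z)) (su q)); first by rewrite -val_eqE.
move=> f; rewrite !permM tpermL tpermR.
rewrite (pderiv_swap _ _ fincoord_real openT (asmooth_u q) I); congr (_ * (_ * _)).
apply: eq_bigr => m mq; rewrite permM tpermD // -val_eqE //=.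
by rewrite eqn_add2l val_eqE eq_sym.
Qed.

(** For k = [o] the first column is a unit vector, so the determinant reduces to the block of
    derivatives in y. *)
Lemma flux_first s y :
  flux o (tcons s y) = g (Th (tcons s y)) * \det (jac (fun y => Th (tcons s y)) y).
Proof.
rewrite /flux /w; congr (_ * _); rewrite /minor_mx.
set B := \matrix_(p, m) _.
rewrite (_ : row_mx _ _ = block_mx 1%:M (usubmx B) 0 (dsubmx B)).
  rewrite det_ublock det1 mul1r; congr (\det _); apply/matrixP => p m; rewrite !mxE.
  exact: pderiv_tail s y p (asmooth_u m).
rewrite block_mxEh vsubmxK; congr row_mx; apply/colP => p; rewrite !mxE eqxx andbT.
by case: (split_ordP p) => j ->; rewrite ?ord1 ?col_mxEu ?col_mxEd !mxE -val_eqE.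
Qed.

Lemma homotopy_invariance (r : R) : (forall s y, r < `|y| -> g (Th (tcons s y)) = 0) ->
  forall a b, int_Rn (fun y => g (Th (tcons a y)) * \det (jac (fun y => Th (tcons a y)) y)) =
              int_Rn (fun y => g (Th (tcons b y)) * \det (jac (fun y => Th (tcons b y)) y)).
Proof.
move=> g0 a b.
have f0 k : supp_in r (flux k) by move=> s y ry; rewrite /flux /w g0 ?mul0r.
have [sJ dJ] := int_Rn_family (asmooth_flux o) (f0 o).
suff : int_Rn (fun y => flux o (tcons b y)) - int_Rn (fun y => flux o (tcons a y)) = 0.
  have F t : (fun y => flux o (tcons t y)) =
      (fun y => g (Th (tcons t y)) * \det (jac (fun y => Th (tcons t y)) y)).
    by apply/funext => y; exact: flux_first.
  move=> /subr0_eq E1; have := esym E1; rewrite (F a) (F b); exact.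
have [th _ ->] := scurve_MVT a b sJ.
set s := a + _; rewrite (der_derive1 (dJ s)); apply/eqP; rewrite mulf_eq0; apply/orP; left; apply/eqP.
have cF k t : cc (fun y => flux k (tcons t y)).
  split; last by exists r => y ry; exact: f0.
  by apply: (asmooth_tcons (p := fun=> t)); [exact: asmooth_flux|exact: asmooth_cst].
rewrite (_ : (fun y => _) = (fun y => \sum_k (-1) * pderiv k (fun y => flux (su k) (tcons s y)) y)).
  have cD k : cc (fun y => (-1) * pderiv k (fun y => flux (su k) (tcons s y)) y).
    by apply: cc_mul; [exact: asmooth_cst|exact: cc_pderiv].
  have [_ ->] := int_Rn_sum (index_enum 'I_n) cD; apply: big1 => k _.
  by rewrite int_Rn_scale ?int_Rn_pderiv ?mulr0 //; exact: cc_pderiv.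
apply/funext => y; have := flux_divergence (tcons s y); rewrite big_split_ord /= big_ord1.
move=> /eqP; rewrite addr_eq0 => /eqP E1; apply: (etrans E1); rewrite -sumrN; apply: eq_bigr => k _.
by rewrite mulN1r (pderiv_tail _ _ _ (asmooth_flux _)).
Qed.

End DivergenceOfMinors.

(** * Change of variables for affine maps *)

Section LinearChange.
Local Open Scope ring_scope.
Local Open Scope classical_set_scope.
Context {R : realType}.

Lemma jac_affine (n : nat) (A : 'M[R]_n) (v y : 'rV[R]_n) : jac (fun y => v + y *m A) y = A.
Proof.
apply/matrixP => k m; rewrite mxE; apply: pderiv_der.
have -> : (fun t : R => (v + (y + t *: delta_mx 0 k) *m A) 0 m) =
    (fun t => (v + y *m A) 0 m + t *: A k m).
  by apply/funext => t; rewrite mulmxDl -scalemxAl -rowE !mxE !addrA.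
have := der_add (der_cst ((v + y *m A) 0 m) 0) (der_scale (der_id 0) (der_cst (A k m) 0)).
by rewrite scaler0 addr0 add0r scale1r.
Qed.

Lemma scurve_mulmx (n : nat) (c : R -> 'rV[R]_n) (A : R -> 'M[R]_n) :
  scurve c -> (forall i j, scurve (fun s => A s i j)) -> scurve (fun s => c s *m A s).
Proof.
move=> sc sA; apply: scurve_coord_row => j; under eq_fun do rewrite mxE.
by apply: scurve_sum => k; apply: scurve_mul => //; exact: scurve_coord.
Qed.

Lemma proper_affine (n : nat) (A : 'M[R]_n) (v y : 'rV[R]_n) (C D r : R) : 0 < C ->
  `|y| <= C * `|y *m A| -> `|v| <= D -> C * (r + D) < `|y| -> r < `|v + y *m A|.
Proof.
move=> C0 h1 h2 h3; have := ler_normB (v + y *m A) v; rewrite addrC addKr => h4.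
have : r + D < `|y *m A| by rewrite -(ltr_pM2l C0); exact: lt_le_trans h1.
lra.
Qed.

(** The lower bound on |y *m A s| and the bound on v s, both uniform in s, keep the supports in a
    common ball, as [homotopy_invariance] requires. *)
Lemma affine_homotopy (n : nat) (A : R -> 'M[R]_n) (v : R -> 'rV[R]_n) (C D : R) (g : 'rV[R]_n -> R) :
  (forall i j, scurve (fun s => A s i j)) -> scurve v -> 0 < C ->
  (forall s (y : 'rV[R]_n), `|y| <= C * `|y *m A s|) -> (forall s, `|v s| <= D) -> cc g ->
  forall a b, int_Rn (fun y => g (v a + y *m A a) * \det (A a)) =
              int_Rn (fun y => g (v b + y *m A b) * \det (A b)).
Proof.
move=> sA sv C0 hA hv [sg [r g0]] a b.
pose Th (z : 'rV[R]_(1 + n)) := v (lsubmx z 0 0) + rsubmx z *m A (lsubmx z 0 0).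
have ThE s y : Th (tcons s y) = v s + y *m A s.
  by rewrite /Th /tcons row_mxKl row_mxKr mxE eqxx mulr1n.
have sTh : asmooth setT Th.
  apply/asmoothP => c sc _; have sl : scurve (fun t => lsubmx (c t) 0 0).
    by apply: scurve_coord; exact: scurve_lsubmx.
  apply: scurve_add; first exact: (scurve_comp sl sv).
  apply: scurve_mulmx; first exact: scurve_rsubmx.
  by move=> i j; exact: (scurve_comp sl (sA i j)).
have g1 s y : C * (r + D) < `|y| -> g (Th (tcons s y)) = 0.
  by move=> h; rewrite g0 // ThE; exact: proper_affine h.
have E1 s : (fun y => g (Th (tcons s y)) * \det (jac (fun y => Th (tcons s y)) y)) =
    (fun y => g (v s + y *m A s) * \det (A s)).
  apply/funext => y; have -> : (fun y => Th (tcons s y)) = (fun y => v s + y *m A s).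
    by apply/funext => z; exact: ThE.
  by rewrite ThE jac_affine.
have F s : int_Rn (fun y => g (v s + y *m A s) * \det (A s)) =
    int_Rn (fun y => g (Th (tcons s y)) * \det (jac (fun y => Th (tcons s y)) y)).
  exact: (f_equal (@int_Rn R n) (esym (E1 s))).
apply: (etrans (F a)); apply: (etrans _ (esym (F b))).
exact: (@homotopy_invariance R n Th g sTh sg (C * (r + D)) g1 a b).
Qed.

Lemma unit_proper (n : nat) (A : 'M[R]_n) : A \in unitmx ->
  exists2 C : R, 0 < C & forall y : 'rV[R]_n, `|y| <= C * `|y *m A|.
Proof.
move=> uA; have [C C0 hC] := norm_mulmx_le (invmx A); exists C => // y.
by have := hC (y *m A); rewrite mulmxK.
Qed.

Lemma cc_affine (n : nat) (A : 'M[R]_n) (v : 'rV[R]_n) (g : 'rV[R]_n -> R) : A \in unitmx ->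
  cc g -> cc (fun y => g (v + y *m A)).
Proof.
move=> uA [sg [r g0]]; have [C C0 hC] := unit_proper uA; split.
  apply/asmoothP => c sc _; apply: (asmoothT_curve (c := fun t => v + c t *m A)) => //.
  apply: scurve_add; first exact: scurve_cst.
  by apply: (scurve_mulmx (A := fun=> A)) => // i j; exact: scurve_cst.
by exists (C * (r + `|v|)) => y h; rewrite g0 //; exact: proper_affine h.
Qed.

(** The homotopy parameter ranges over all reals; [smooth_step] keeps the translations bounded while
    s = 0 and s = 1 give the two ends. *)
Lemma int_Rn_translate (n : nat) (v : 'rV[R]_n) (g : 'rV[R]_n -> R) : cc g ->
  int_Rn (fun y => g (v + y)) = int_Rn g.
Proof.
move=> cg; have s01 (s : R) : `|smooth_step s| <= 1.
  by rewrite ger0_norm ?smooth_step_ge0 ?smooth_step_le1.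
have h1 (i j : 'I_n) : scurve (fun _ : R => (1%:M : 'M[R]_n) i j) by exact: scurve_cst.
have h2 : scurve (fun s : R => smooth_step s *: v).
  by apply: scurve_scale; [exact: scurve_smooth_step|exact: scurve_cst].
have h3 (s : R) (y : 'rV[R]_n) : `|y| <= 1 * `|y *m 1%:M| by rewrite mulmx1 mul1r.
have h4 (s : R) : `|smooth_step s *: v| <= `|v| by rewrite normrZ ler_piMl.
have := affine_homotopy h1 h2 ltr01 h3 h4 cg 1 0.
rewrite smooth_step1 // smooth_step0 // scale1r scale0r det1.
under eq_fun do rewrite mulmx1 mulr1.
by under [X in _ = int_Rn X -> _]eq_fun do rewrite mulmx1 add0r mulr1.
Qed.

Definition lin_inv (n : nat) (A : 'M[R]_n) : Prop := forall g : 'rV[R]_n -> R, cc g ->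
  int_Rn (fun y => g (y *m A) * `|\det A|) = int_Rn g.

Lemma lin_inv_mul (n : nat) (A B : 'M[R]_n) : A \in unitmx -> B \in unitmx ->
  lin_inv A -> lin_inv B -> lin_inv (A *m B).
Proof.
move=> uA uB hA hB g cg.
have cgB : cc (fun y => g (y *m B)).
  by have := cc_affine 0 uB cg; under eq_fun do rewrite add0r.
have cgAB : cc (fun y => g (y *m B) * `|\det B|).
  under eq_fun do rewrite mulrC; apply: cc_mul => //; exact: asmooth_cst.
have := hA _ cgAB; rewrite hB // => <-; congr int_Rn; apply/funext => y.
by rewrite mulmxA det_mulmx normrM -!mulrA [`|\det B| * _]mulrC.
Qed.

(** As N squares to 0, the inverse of 1 + t N is 1 - t N. For t in [0, 1] this bounds |y| by (1 + C)
    times the norm of its image, uniformly along the homotopy from the identity. *)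
Lemma lin_inv_shear (n : nat) (N : 'M[R]_n) : N *m N = 0 -> (forall t : R, \det (1%:M + t *: N) = 1) ->
  lin_inv (1%:M + N).
Proof.
move=> NN dN g cg; have [C C0 hC] := norm_mulmx_le N.
have h1 i j : scurve (fun s => (1%:M + smooth_step s *: N) i j).
  under eq_fun do rewrite !mxE; apply: scurve_add; first exact: scurve_cst.
  by apply: scurve_mul; [exact: scurve_smooth_step|exact: scurve_cst].
have h2 : scurve (fun _ : R => 0 : 'rV[R]_n) by exact: scurve_cst.
have C1 : 0 < 1 + C by exact: addr_gt0.
have h3 s (y : 'rV[R]_n) : `|y| <= (1 + C) * `|y *m (1%:M + smooth_step s *: N)|.
  set z := y *m _; have : y = z - smooth_step s *: (z *m N).
    rewrite /z -mulmxA mulmxDl mul1mx -scalemxAl NN scaler0 addr0 mulmxDr mulmx1 -scalemxAr.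
    by rewrite addrK.
  move=> ->; apply: le_trans (ler_normB _ _) _; rewrite mulrDl mul1r lerD2l normrZ.
  rewrite ger0_norm ?smooth_step_ge0 //; apply: le_trans (hC z).
  by rewrite ler_piMl ?smooth_step_le1.
have h4 (s : R) : `|0 : 'rV[R]_n| <= 0 by rewrite normr0.
have := affine_homotopy h1 h2 C1 h3 h4 cg 1 0.
rewrite smooth_step1 // smooth_step0 // scale1r scale0r addr0 det1.
have -> : \det (1%:M + N) = 1 by have := dN 1; rewrite scale1r.
under eq_fun do rewrite add0r mulr1.
under [X in _ = int_Rn X -> _]eq_fun do rewrite add0r mulmx1 mulr1.
by rewrite normr1; under [X in _ -> int_Rn X = _]eq_fun do rewrite mulr1.
Qed.

(** A positive factor b is joined to 1 through factors of at least min 1 b; a negative one is first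
    made positive by the reflection [int1_opp]. *)
Lemma int1_scaling (a : R) (f : R -> R) (r : R) : a != 0 -> scurve f -> zero_off r f ->
  int1 (fun t => f (a * t) * `|a|) = int1 f.
Proof.
move=> a0 sf f0.
have pos (b : R) : 0 < b -> int1 (fun t => f (b * t) * b) = int1 f.
  move=> b0; pose g (y : 'rV[R]_1) := f (y 0 0).
  have cg : cc g.
    split; last first.
      exists r => y ry; apply: f0; apply: lt_le_trans ry _; apply: row_norm_le => // i.
      by rewrite ord1.
    by apply/asmoothP => c sc _; apply: scurve_comp => //; exact: scurve_coord.
  pose e (s : R) := 1 + smooth_step s * (b - 1).
  pose m := Num.min 1 b; have m0 : 0 < m by rewrite lt_min ltr01.
  have em s : m <= e s.
    have h0 := smooth_step_ge0 s; have h1 := smooth_step_le1 s; rewrite /e.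
    have [b1|b1] := leP 1 b.
      by rewrite (le_trans (_ : m <= 1)) ?ge_min ?lexx // lerDl mulr_ge0 // subr_ge0.
    rewrite (le_trans (_ : m <= b)) ?ge_min ?lexx ?orbT //; nra.
  have h1 (i j : 'I_1) : scurve (fun s => (e s)%:M i j).
    under eq_fun do rewrite mxE -mulr_natr; apply: scurve_mul; last exact: scurve_cst.
    apply: scurve_add; first exact: scurve_cst.
    by apply: scurve_mul; [exact: scurve_smooth_step|exact: scurve_cst].
  have h2 : scurve (fun _ : R => 0 : 'rV[R]_1) by exact: scurve_cst.
  have mV : 0 < m^-1 by rewrite invr_gt0.
  have h3 s (y : 'rV[R]_1) : `|y| <= m^-1 * `|y *m (e s)%:M|.
    rewrite mul_mx_scalar normrZ ler_pdivlMl // gtr0_norm; last exact: lt_le_trans (em s).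
    by apply: ler_wpM2r.
  have h4 (s : R) : `|0 : 'rV[R]_1| <= 0 by rewrite normr0.
  have e1 : e 1 = b by rewrite /e smooth_step1 // mul1r addrC subrK.
  have e0 : e 0 = 1 by rewrite /e smooth_step0 // mul0r addr0.
  have := affine_homotopy h1 h2 mV h3 h4 cg 1 0.
  rewrite e1 e0 !int_RnS /= !det_scalar1.
  have E1 (c t : R) : g (0 + tcons t (0 : 'rV[R]_0) *m c%:M) = f (c * t).
    by rewrite add0r mul_mx_scalar /g !mxE; case: splitP => // j _; rewrite ord1 mxE eqxx mulr1n.
  under eq_fun do rewrite E1; by under [X in _ = int1 X -> _]eq_fun do rewrite E1 mul1r mulr1.
have [h|h|h] := ltgtP a 0; last by rewrite h eqxx in a0.
  rewrite ltr0_norm // -[RHS](pos (- a)) ?oppr_gt0 //.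
  have sm : scurve (fun t => f (- a * t) * - a).
    apply: scurve_mul; last exact: scurve_cst.
    apply: (@scurve_comp _ _ f (fun t => - a * t)) => //.
    by apply: scurve_mul; [exact: scurve_cst|exact: scurve_id].
  rewrite -(@int1_opp _ (fun t => f (- a * t) * - a) (r / `|a|)).
  - by under [in RHS]eq_fun do rewrite mulrNN.
  - exact: scurve_continuous.
  - move=> t; rewrite ltr_pdivrMr ?normr_gt0 // => ht; rewrite f0 ?mul0r //.
    by rewrite normrM normrN mulrC.
by rewrite gtr0_norm // pos.
Qed.

Lemma lin_inv_unit (n : nat) (A : 'M[R]_n) : A \in unitmx -> lin_inv A.
Proof.
elim: n A => [A _ g cg|n IH A0].
  by rewrite /int_Rn det_mx00 normr1 mulr1; congr g; apply/rowP => -[].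
have shearU (b : 'rV[R]_n) : lin_inv (block_mx 1 b 0 1%:M : 'M[R]_(1 + n)).
  have -> : block_mx 1 b 0 1%:M = 1%:M + block_mx 0 b 0 0 :> 'M[R]_(1 + n).
    by rewrite (scalar_mx_block 1 n) add_block_mx !addr0 !add0r.
  apply: lin_inv_shear; first by rewrite mulmx_block !mulmx0 !mul0mx !addr0 block_mx0.
  move=> t; rewrite (scalar_mx_block 1 n) scale_block_mx !scaler0 add_block_mx !addr0 add0r.
  by rewrite det_ublock !det1 mulr1.
have shearL (c : 'cV[R]_n) : lin_inv (block_mx 1 0 c 1%:M : 'M[R]_(1 + n)).
  have -> : block_mx 1 0 c 1%:M = 1%:M + block_mx 0 0 c 0 :> 'M[R]_(1 + n).
    by rewrite (scalar_mx_block 1 n) add_block_mx !addr0 !add0r.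
  apply: lin_inv_shear; first by rewrite mulmx_block !mulmx0 !mul0mx !addr0 block_mx0.
  move=> t; rewrite (scalar_mx_block 1 n) scale_block_mx !scaler0 add_block_mx !addr0 add0r.
  by rewrite det_lblock !det1 mulr1.
have unitU (b : 'rV[R]_n) : (block_mx 1 b 0 1%:M : 'M[R]_(1 + n)) \in unitmx.
  by rewrite unitmxE det_ublock !det1 mulr1 unitr1.
have unitL (c : 'cV[R]_n) : (block_mx 1 0 c 1%:M : 'M[R]_(1 + n)) \in unitmx.
  by rewrite unitmxE det_lblock !det1 mulr1 unitr1.
(* The induction hypothesis treats the inner integral at each fixed first coordinate, [int1_scaling]
   the outer one. *)
have diag (a : R) (D : 'M[R]_n) : a != 0 -> D \in unitmx ->
    lin_inv (block_mx a%:M 0 0 D : 'M[R]_(1 + n)).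
  move=> a0 uD g cg; rewrite !int_RnS det_ublock det_scalar1.
  have E1 t : int_Rn (fun y : 'rV[R]_n => g (tcons t y *m block_mx a%:M 0 0 D) * `|a * \det D|) =
      int_Rn (fun y : 'rV[R]_n => g (tcons (a * t) y)) * `|a|.
    have := IH D uD _ (cc_slice (a * t) cg) => <-.
    rewrite [RHS]mulrC -int_Rn_scale; last first.
      under eq_fun do rewrite mulrC; apply: cc_mul; first exact: asmooth_cst.
      by have := cc_affine 0 uD (cc_slice (a * t) cg); under eq_fun do rewrite add0r.
    congr int_Rn; apply/funext => y; rewrite normrM mulrCA; congr (_ * (g _ * _)).
    rewrite /tcons mul_row_block !mulmx0 addr0 add0r; congr row_mx.
    by rewrite mul_mx_scalar scale_scalar_mx.
  under eq_fun do rewrite E1.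
  have [_ [r g0]] := cg.
  apply: (@int1_scaling _ (fun t => int_Rn (fun y => g (tcons t y))) r) => //.
    exact: scurve_slice.
  exact: zero_off_slice.
(* Elimination with pivot a: a lower shear, a block diagonal matrix with the Schur complement, an
   upper shear. *)
have pivot (a : R) (b : 'rV[R]_n) (c : 'cV[R]_n) (D : 'M[R]_n) : a != 0 ->
    (block_mx a%:M b c D : 'M[R]_(1 + n)) \in unitmx -> lin_inv (block_mx a%:M b c D : 'M[R]_(1 + n)).
  move=> a0; have -> : block_mx a%:M b c D = block_mx 1 0 (a^-1 *: c) 1%:M *m
      (block_mx a%:M 0 0 (D - a^-1 *: (c *m b)) *m block_mx 1 (a^-1 *: b) 0 1%:M) :> 'M[R]_(1 + n).
    rewrite !mulmx_block !mulmx0 !mul0mx !mulmx1 !mul1mx !addr0 !add0r.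
    rewrite mul_scalar_mx mul_mx_scalar !scalerA divff // !scale1r.
    by rewrite -scalemxAl [_ + (D - _)]addrC subrK.
  rewrite !unitmx_mul unitL unitU andbT /= => uM.
  have uD : D - a^-1 *: (c *m b) \in unitmx.
    by move: uM; rewrite !unitmxE det_ublock unitrM => /andP[].
  apply: lin_inv_mul => //; first by rewrite unitmx_mul uM unitU.
  by apply: lin_inv_mul => //; exact: diag.
rewrite -[A0](@submxK _ 1 n 1 n); set a := ulsubmx _; set b := ursubmx _.
set c := dlsubmx _; set D := drsubmx _; clearbody a b c D; rewrite [a]mx11_scalar.
have [a0|a0] := eqVneq (a 0 0) 0; last exact: pivot.
move=> uA; have [i ci] : exists i, c i 0 != 0.
  apply: contrapT => hn; move: uA; rewrite unitmxE a0 (_ : c = 0).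
    by rewrite (det_ublock (0%:M : 'M[R]_1) b D) det_scalar1 mul0r unitr0.
  apply/colP => i; rewrite [RHS]mxE; apply/eqP; apply: contraT => h; by case: hn; exists i.
(* For a zero pivot, row i of the lower block is added to the first row, which makes c i 0 the
   pivot; the shear on the left undoes this. *)
have E1 : block_mx (a 0 0)%:M b c D = block_mx 1 (- delta_mx 0 i) 0 1%:M *m
    block_mx (c i 0)%:M (b + row i D) c D :> 'M[R]_(1 + n).
  rewrite mulmx_block !mul0mx !mul1mx !add0r !mulNmx -!rowE; congr block_mx.
    by apply/matrixP => p q; rewrite !ord1 !mxE a0 mul0rn mulr1n subrr.
  by rewrite addrK.
rewrite E1 in uA *; move: uA; rewrite unitmx_mul => /andP[_ uB].
by apply: lin_inv_mul => //; exact: pivot.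
Qed.

Lemma int_Rn_affine (n : nat) (A : 'M[R]_n) (v : 'rV[R]_n) (g : 'rV[R]_n -> R) :
  A \in unitmx -> cc g -> int_Rn (fun y => g (v + y *m A) * `|\det A|) = int_Rn g.
Proof.
move=> uA cg; rewrite -(int_Rn_translate v cg); apply: (lin_inv_unit uA).
have := cc_affine v (unitmx1 _ n) cg; congr cc; apply/funext => y.
by rewrite mulmx1.
Qed.

End LinearChange.

(** * Change of variables near a point *)

Section LocalChange.
Local Open Scope ring_scope.
Local Open Scope classical_set_scope.
Context {R : realType} {n : nat}.
Local Notation E := 'rV[R]_n.

Lemma jac_near (f g : E -> E) x : (\forall y \near x, f y = g y) -> jac f x = jac g x.
Proof.
move=> fg; apply/matrixP => k m; rewrite !mxE; apply: near_eq_derive.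
by apply: filterS fg => y ->.
Qed.

Variables (U : set E) (nu : E -> E) (x0 : E).
Hypotheses (oU : open U) (snu : asmooth U nu) (Ux : U x0) (dnu : \det (jac nu x0) != 0).

(* Near x0, nu is deformed into its first-order Taylor polynomial A. *)
Lemma change_of_variables_near : exists2 delta : R,
  0 < delta /\ (forall y, `|y - x0| <= delta -> U y) & exists2 eta : R, 0 < eta &
  forall g J : E -> R, cc g -> (forall z, eta <= `|z - nu x0| -> g z = 0) ->
    (forall y, `|y - x0| <= delta -> J y = g (nu y) * `|\det (jac nu y)|) ->
    (forall y, delta < `|y - x0| -> J y = 0) -> int_Rn J = int_Rn g.
Proof.
set A := jac nu x0; have uA : A \in unitmx by rewrite unitmxE unitfE.
have [C C0 hC] := unit_proper uA.
pose rho y := nu y - nu x0 - (y - x0) *m A.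
(* Since |y - x0| <= C |(y - x0) *m A|, an error of at most |y - x0| / (2 C) consumes half of the
   linear part; the other half gives [Thfar]. *)
have e0 : 0 < (2 * C)^-1 by rewrite invr_gt0 mulr_gt0.
have [d1 d10 hd1] := smooth_jac oU snu Ux e0.
have [d2 d20 hd2] := open_ball_inside oU Ux.
have sdet : asmooth U (fun y => \det (jac nu y)) by apply: asmooth_det => i j; exact: asmooth_jac.
have /continuous_normP /(_ (`|\det A| / 2)) := asmooth_continuous fincoord_real oU sdet Ux.
rewrite divr_gt0 ?normr_gt0 // => /(_ isT)[d3 d30 hd3].
pose r := Num.min d1 (Num.min d2 d3); have r0 : 0 < r by rewrite !lt_min d10 d20.
have [chi schi [chi01 chi0 chi1]] := asmooth_bump x0 r0.
have rd1 : r <= d1 by rewrite ge_min lexx.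
have rd2 : r <= d2 by rewrite !ge_min lexx orbT.
have rd3 : r <= d3 by rewrite !ge_min lexx !orbT.
(* The Taylor remainder is cut off so that the deformation exists on the whole space; within r / 8
   of x0 it is the true remainder. *)
pose eta (y : E) : E := chi y *: rho y.
have seta : asmooth setT eta.
  apply: (asmooth_glue oU (@closed_norm_ball _ _ x0 (r / 4))).
  - by move=> y /= yr; apply: hd2; lra.
  - apply: asmooth_scale; first exact: asmoothW schi.
    apply: asmooth_sub; first by apply: asmooth_sub => //; exact: asmooth_cst.
    apply/asmoothP => c sc _; apply: (scurve_mulmx (c := fun t => c t - x0) (A := fun=> A)).
      by apply: scurve_sub => //; exact: scurve_cst.
    by move=> i j; exact: scurve_cst.
  - by move=> y /= /negP; rewrite -ltNge => h; rewrite /eta chi0 // scale0r.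
have heta y : `|eta y| <= (2 * C)^-1 * `|y - x0|.
  have [h|h] := leP `|y - x0| (r / 4); last first.
    by rewrite /eta chi0 // scale0r normr0 mulr_ge0 // ltW.
  have /andP[c0 c1] := chi01 y; rewrite normrZ ger0_norm //.
  apply: le_trans (_ : `|rho y| <= _); first by rewrite ler_piMl.
  by apply: hd1; lra.
pose Th (z : 'rV[R]_(1 + n)) := nu x0 + (rsubmx z - x0) *m A + smooth_step (lsubmx z 0 0) *: eta (rsubmx z).
have ThE t y : Th (tcons t y) = nu x0 + (y - x0) *m A + smooth_step t *: eta y.
  by rewrite /Th /tcons row_mxKl row_mxKr mxE eqxx mulr1n.
have sTh : asmooth setT Th.
  apply/asmoothP => c sc _; have sr := scurve_rsubmx sc.
  apply: scurve_add; first apply: scurve_add; first exact: scurve_cst.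
    apply: (scurve_mulmx (c := fun t => rsubmx (c t) - x0) (A := fun=> A)).
      by apply: scurve_sub => //; exact: scurve_cst.
    by move=> i j; exact: scurve_cst.
  apply: scurve_scale; last by have /asmoothP h := seta; exact: (h (fun t => rsubmx (c t))).
  apply: scurve_comp; last exact: scurve_smooth_step.
  by apply: scurve_coord; exact: scurve_lsubmx.
have Thfar t y : `|y - x0| <= 2 * C * `|Th (tcons t y) - nu x0|.
  rewrite ThE -[nu x0 + _ + _]addrA [nu x0 + _]addrC addrK -ler_pdivrMl ?mulr_gt0 //.
  have h1 : `|smooth_step t *: eta y| <= (2 * C)^-1 * `|y - x0|.
    rewrite normrZ ger0_norm ?smooth_step_ge0 //; apply: le_trans (heta y).
    by rewrite ler_piMl ?smooth_step_le1.
  have h2 : 2 * ((2 * C)^-1 * `|y - x0|) <= `|(y - x0) *m A|.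
    by rewrite invfM mulrA mulrA divff // mul1r ler_pdivrMl.
  have := ler_normB ((y - x0) *m A + smooth_step t *: eta y) (smooth_step t *: eta y).
  rewrite addrK; lra.
exists (r / 16); first by split=> [|y yr]; [rewrite divr_gt0|apply: hd2; lra].
(* By [Thfar], a point farther than r / 16 from x0 is sent at least this far from nu x0 at every
   time of the deformation, so g vanishes there. *)
exists (r / 16 / (2 * C)); first by rewrite !divr_gt0 // mulr_gt0.
move=> g J cg g0 J1 J0.
(* Homotopy invariance concerns the determinant itself, not its absolute value. Near x0 the
   determinant keeps the sign it has at x0, and this sign is absorbed into g. *)
pose sg := Num.sg (\det A).
have [sgm [rg g00]] := cg.
have sg' : asmooth setT (fun z => sg * g z) by apply: asmooth_mul => //; exact: asmooth_cst.
have Th0 t y : `|x0| + 2 * C * (rg + `|nu x0|) < `|y| -> sg * g (Th (tcons t y)) = 0.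
  move=> h; rewrite g00 ?mulr0 //; have := Thfar t y.
  have h1 := ler_normB (Th (tcons t y)) (nu x0); have h2 := ler_normD (y - x0) x0.
  rewrite subrK in h2.
  have h3 : 2 * C * (rg + `|nu x0|) < 2 * C * `|Th (tcons t y) - nu x0| -> rg < `|Th (tcons t y)|.
    by rewrite ltr_pM2l ?mulr_gt0 // => h3; lra.
  by move=> h4; apply: h3; lra.
have JE : J = fun y => sg * g (Th (tcons 1 y)) * \det (jac (fun y => Th (tcons 1 y)) y).
  apply/funext => y; have [yr|yr] := leP `|y - x0| (r / 16); last first.
    have gz : g (Th (tcons 1 y)) = 0.
      have h5 := Thfar 1 y; apply: (g0 (Th (tcons 1 y))).
      rewrite ler_pdivrMr; last exact: mulr_gt0.
      by rewrite [leRHS]mulrC; exact: le_trans (ltW yr) h5.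
    by rewrite (J0 y yr) gz mulr0 mul0r.
  have nE z : `|z - x0| <= r / 8 -> Th (tcons 1 z) = nu z.
    move=> h; rewrite ThE smooth_step1 // scale1r /eta chi1 // scale1r /rho.
    by rewrite [LHS]addrC -[X in X + _]addrA -opprD subrK.
  rewrite (jac_near (g := nu)); last first.
    apply/near_normP; exists (r / 16) => [|z zy]; first by rewrite divr_gt0.
    by apply: nE; have := ler_normD (z - y) (y - x0); rewrite addrA subrK; lra.
  rewrite J1 // nE; last lra.
  rewrite mulrAC [RHS]mulrC; congr (_ * _).
  have yd3 : `|y - x0| < d3 by lra.
  have := hd3 y yd3; rewrite -/A /sg; set a := \det A; set b := \det _.
  rewrite ler_norml => /andP[l1 l2]; have a0 : a != 0 by [].
  have [h|h|h] := ltgtP a 0; last by rewrite h eqxx in a0.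
    by rewrite (ltr0_sg h) mulN1r ltr0_norm //; move: l2; rewrite (ltr0_norm h); lra.
  by rewrite (gtr0_sg h) mul1r gtr0_norm //; move: l1; rewrite (gtr0_norm h); lra.
rewrite JE; apply: (etrans (homotopy_invariance sTh sg' Th0 1 0)); rewrite -(int_Rn_affine (nu x0 - x0 *m A) uA cg).
congr int_Rn; apply/funext => y.
have ThA : (fun y => Th (tcons 0 y)) = (fun y => (nu x0 - x0 *m A) + y *m A).
  apply/funext => z; rewrite ThE smooth_step0 // scale0r addr0 mulmxBl.
  by rewrite [z *m A - _]addrC addrA.
have -> : Th (tcons 0 y) = (nu x0 - x0 *m A) + y *m A by rewrite -[RHS]/((fun y => nu x0 - x0 *m A + y *m A) y) -ThA.
rewrite ThA jac_affine mulrAC [RHS]mulrC; congr (_ * _).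
by rewrite [RHS]normrEsg.
Qed.

End LocalChange.

Section DiffeoChange.
Local Open Scope ring_scope.
Local Open Scope classical_set_scope.
Context {R : realType} {n : nat}.
Local Notation E := 'rV[R]_n.
Variables (W W' : set E) (mu : diffeo W W').
Hypotheses (oW : open W) (oW' : open W').
Local Notation nu := (diffeo_inv mu).

(** Continuity of [diffeo_fun mu] at nu x0 ensures that points of W' sent by nu close to nu x0 are
    themselves close to x0, so nothing outside the local chart contributes. *)
Lemma change_of_variables_diffeo x0 : W' x0 -> exists2 eta : R, 0 < eta &
  forall g : E -> R, cc g -> (forall z, eta <= `|z - nu x0| -> g z = 0) ->
    int_Rn (patch (fun=> 0) W' (fun y => jdet mu y * g (nu y))) = int_Rn g.
Proof.
move=> Wx; have snu := asmooth_diffeo_inv mu oW'; have Wn := diffeo_inv_in mu Wx.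
have [d [d0 dW] [eta eta0 H]] := change_of_variables_near oW' snu Wx (det_jacobian_neq0 mu oW oW' Wx).
have [e e0 he] : exists2 e : R, 0 < e & forall z, `|z - nu x0| < e -> `|diffeo_fun mu z - x0| <= d.
  have /continuous_normP /(_ _ d0) := asmooth_continuous (@fincoord_row R n) oW (asmooth_diffeo mu oW) Wn.
  by rewrite diffeo_invK.
exists (Num.min eta e); first by rewrite lt_min eta0.
move=> g cg g0; apply: H => //.
- by move=> z h; apply: g0; rewrite ge_min h.
- move=> y yd; have Wy := dW y yd.
  by rewrite patchT ?inE // mulrC /jdet (jacobianE oW' snu Wy).
move=> y yd; have [Wy|nWy] := pselect (W' y); last by rewrite patchC // inE.
rewrite patchT ?inE // g0 ?mulr0 // ge_min; apply/orP; right.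
rewrite leNgt; apply/negP => /he; rewrite diffeo_invK // => h.
by move: yd; rewrite ltNge h.
Qed.

End DiffeoChange.

(** * Integrals of real and complex functions *)

Section ScalarIntegral.
Local Open Scope ring_scope.
Local Open Scope classical_set_scope.
Context {R : realType}.

Lemma lin_fst : exists2 p : {linear (R * R)%type -> R}, continuous p & forall v, p v = v.1.
Proof.
pose fl := GRing.isLinear.Build R (R * R)%type R _ fst (@fst_linear R).
pose p : {linear (R * R)%type -> R} := HB.pack (fst : R * R -> R) fl.
by exists p => // x; exact: cvg_fst.
Qed.

Lemma lin_snd : exists2 p : {linear (R * R)%type -> R}, continuous p & forall v, p v = v.2.
Proof.
pose fl := GRing.isLinear.Build R (R * R)%type R _ snd (@snd_linear R).
pose p : {linear (R * R)%type -> R} := HB.pack (snd : R * R -> R) fl.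
by exists p => // x; exact: cvg_snd.
Qed.

Lemma asmooth_fst n (U : set 'rV[R]_n) (f : 'rV[R]_n -> R * R) : asmooth U f -> asmooth U (fun y => (f y).1).
Proof.
by have [p cp pE] := lin_fst => /(asmooth_lin cp); under eq_fun do rewrite pE.
Qed.

Lemma asmooth_snd n (U : set 'rV[R]_n) (f : 'rV[R]_n -> R * R) : asmooth U f -> asmooth U (fun y => (f y).2).
Proof.
by have [p cp pE] := lin_snd => /(asmooth_lin cp); under eq_fun do rewrite pE.
Qed.

Lemma asmooth_pair n (U : set 'rV[R]_n) (f g : 'rV[R]_n -> R) : asmooth U f -> asmooth U g ->
  asmooth U (fun y => (f y, g y) : (R * R)%type).
Proof.
move=> sf sg; rewrite (_ : (fun y => _) = (fun y => f y *: ((1, 0) : (R * R)%type) + g y *: ((0, 1) : (R * R)%type))).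
  by apply: asmooth_add; apply: asmooth_scale => //; exact: asmooth_cst.
apply/funext => y; change ((f y, g y) = (f y * 1 + g y * 0, f y * 0 + g y * 1)).
by rewrite !mulr1 !mulr0 addr0 add0r.
Qed.

Lemma cc_fst n (f : 'rV[R]_n -> R * R) : cc f -> cc (fun y => (f y).1).
Proof. by move=> [sf [r f0]]; split; [exact: asmooth_fst|exists r => y ry; rewrite f0]. Qed.

Lemma cc_snd n (f : 'rV[R]_n -> R * R) : cc f -> cc (fun y => (f y).2).
Proof. by move=> [sf [r f0]]; split; [exact: asmooth_snd|exists r => y ry; rewrite f0]. Qed.

Variables (s : scalars).
Local Notation K := (scalar_of R s).

Lemma smulDr (a b c : K) : smul a (b + c) = smul a b + smul a c.
Proof.
move: s a b c => [a b c|[a1 a2] [b1 b2] [c1 c2]]; first exact: mulrDr.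
by congr pair; rewrite /= !mulrDr; ring.
Qed.

Lemma smulr0 (a : K) : smul a 0 = 0.
Proof.
move: s a => [a|[a1 a2]]; first exact: mulr0.
by congr pair; rewrite /= !mulr0 ?subrr ?addr0.
Qed.

Lemma smul_scaler (a b : K) (t : R) : smul a (t *: b) = t *: smul a b.
Proof.
move: s a b => [a b|[a1 a2] [b1 b2]]; first exact: mulrCA.
change ((a1 * (t * b1) - a2 * (t * b2), a1 * (t * b2) + a2 * (t * b1)) =
  (t * (a1 * b1 - a2 * b2), t * (a1 * b2 + a2 * b1))).
by congr pair; ring.
Qed.

Lemma smul_sumr (I : Type) (q : seq I) (a : K) (b : I -> K) :
  smul a (\sum_(i <- q) b i) = \sum_(i <- q) smul a (b i).
Proof. by apply: (big_morph (smul a)); [exact: smulDr|exact: smulr0]. Qed.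

Lemma asmooth_smul n (U : set 'rV[R]_n) (f g : 'rV[R]_n -> K) : asmooth U f -> asmooth U g ->
  asmooth U (fun y => smul (f y) (g y)).
Proof.
move: s f g => [f g|f g sf sg]; first exact: asmooth_mul.
have [f1 f2 g1 g2] := And4 (asmooth_fst sf) (asmooth_snd sf) (asmooth_fst sg) (asmooth_snd sg).
apply: asmooth_pair.
  by apply: asmooth_sub; exact: asmooth_mul.
by apply: asmooth_add; exact: asmooth_mul.
Qed.

Lemma scalar_int_sum n (I : Type) (q : seq I) (c : I -> R) (f : I -> 'rV[R]_n -> K) :
  (forall i, cc (f i)) ->
  scalar_int (fun y => \sum_(i <- q) c i *: f i y) = \sum_(i <- q) c i *: scalar_int (f i).
Proof.
have main (h : I -> 'rV[R]_n -> R) : (forall i, cc (h i)) ->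
    int_Rn (fun y => \sum_(i <- q) c i * h i y) = \sum_(i <- q) c i * int_Rn (h i).
  move=> ch; have ch' i : cc (fun y => c i * h i y) by apply: cc_mul => //; exact: asmooth_cst.
  have [_ ->] := int_Rn_sum q ch'; apply: eq_bigr => i _; exact: int_Rn_scale.
move: s f => [f|f cf]; first exact: main.
have E1 (x : I -> R * R) : (\sum_(i <- q) c i *: x i).1 = \sum_(i <- q) c i * (x i).1.
  by apply: (big_morph fst).
have E2 (x : I -> R * R) : (\sum_(i <- q) c i *: x i).2 = \sum_(i <- q) c i * (x i).2.
  by apply: (big_morph snd).
rewrite /scalar_int [RHS]surjective_pairing E1 E2 /=; congr pair.
  rewrite -(main (fun i y => (f i y).1)) => [|i]; last exact: cc_fst.
  by congr int_Rn; apply/funext => y; rewrite E1.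
rewrite -(main (fun i y => (f i y).2)) => [|i]; last exact: cc_snd.
by congr int_Rn; apply/funext => y; rewrite E2.
Qed.

Variables (n : nat) (W W' : set 'rV[R]_n) (mu : diffeo W W').
Hypotheses (oW : open W) (oW' : open W').
Local Notation nu := (diffeo_inv mu).

Lemma scalar_change_of_variables x0 : W' x0 -> exists2 eta : R, 0 < eta &
  forall g : 'rV[R]_n -> K, cc g -> (forall z, eta <= `|z - nu x0| -> g z = 0) ->
    scalar_int (patch (fun=> 0) W' (fun y => jdet mu y *: g (nu y))) = scalar_int g.
Proof.
move=> Wx; have [eta eta0 H] := change_of_variables_diffeo mu oW oW' Wx; exists eta => //.
move: s => [g cg g0|g cg g0]; first exact: H.
have E1 : (fun y => (patch (fun=> 0) W' (fun y => jdet mu y *: g (nu y)) y).1) =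
    patch (fun=> 0) W' (fun y => jdet mu y * (g (nu y)).1).
  by apply/funext => y; rewrite !patchE; case: ifP.
have E2 : (fun y => (patch (fun=> 0) W' (fun y => jdet mu y *: g (nu y)) y).2) =
    patch (fun=> 0) W' (fun y => jdet mu y * (g (nu y)).2).
  by apply/funext => y; rewrite !patchE; case: ifP.
rewrite /scalar_int E1 E2 (H (fun z => (g z).1)) ?(H (fun z => (g z).2)) //.
- exact: cc_snd.
- by move=> z /g0 ->.
- exact: cc_fst.
- by move=> z /g0 ->.
Qed.

End ScalarIntegral.

(** * Moments of the pushed kernels *)

Section PushMoments.
Local Open Scope ring_scope.
Local Open Scope classical_set_scope.
Context {R : realType}.

Lemma pderivs_pullback (n : nat) (U W : set 'rV[R]_n) (nu : 'rV[R]_n -> 'rV[R]_n) (l : seq 'I_n) :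
  open U -> open W -> asmooth U nu -> (forall y, U y -> W (nu y)) ->
  exists (I : finType) (c : I -> 'rV[R]_n -> R) (w : I -> seq 'I_n),
  (forall k, asmooth U (c k)) /\
  forall (V : normedModType R) (g : 'rV[R]_n -> V), fincoord V -> asmooth W g -> forall y, U y ->
    pderivs l (fun y => g (nu y)) y = \sum_k c k y *: pderivs (w k) g (nu y).
Proof.
move=> oU oW snu nuW.
have [I [c [w [h1 h2]]]] := pderivs_comp oU oW snu nuW (asmooth_cst U (1 : R)) l.
exists I, c, w; split=> [k|V g fV sg y Uy]; first by have [] := h1 k.
rewrite -(h2 V g fV sg y Uy); apply: (f_equal (fun h : 'rV[R]_n -> V => pderivs l h y)).
by apply/funext => x; rewrite scale1r.
Qed.

Context (s : scalars) {n : nat}.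
Local Notation E := 'rV[R]_n.
Local Notation K := (scalar_of R s).
Variables (W W' : set E) (mu : diffeo W W').
Hypotheses (oW : open W) (oW' : open W').
Local Notation nu := (diffeo_inv mu).
Implicit Types (ker : R -> E -> E -> K).

Lemma pdx_words (g : E -> E -> K) l x y :
  pderivs l (g ^~ y) x = ddirs [seq row_mx (delta_mx 0 i) 0 | i <- l] (unc g) (row_mx x y).
Proof.
have h1 x' y' : pderivs l (g ^~ y') x' = foldr (@pdx R s n) g l x' y'.
  elim: l x' => //= i l IH x'; rewrite /pdx; apply: (f_equal (fun h : E -> K => pderiv i h x')).
  exact/funext.
have h2 z : unc (foldr (@pdx R s n) g l) z = ddirs [seq row_mx (delta_mx 0 i) 0 | i <- l] (unc g) z.
  elim: l z {h1} => //= i l IH z; rewrite pdxE; apply: (f_equal (fun h : 'rV[R]_(n + n) -> K => ddir _ h z)).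
  exact/funext.
by rewrite h1 -h2 /unc row_mxKl row_mxKr.
Qed.

Lemma asmooth_kernel_l ker eps y : smooth_kernel W ker -> 0 < eps <= 1 -> asmooth W (ker eps ^~ y).
Proof.
move=> sk ee; have /asmoothP h := kernel_smooth oW sk ee; apply/asmoothP => c sc cW.
have h1 : scurve (fun t => row_mx (c t) y) by apply: scurve_row_mx => //; exact: scurve_cst.
have := h (fun t => row_mx (c t) y) h1.
rewrite (_ : (fun t => _) = fun t => ker eps (c t) y); last first.
  by apply/funext => t; rewrite /unc row_mxKl row_mxKr.
by apply=> t; rewrite /= row_mxKl.
Qed.

Lemma asmooth_kernel_r ker eps x l : smooth_kernel W ker -> 0 < eps <= 1 -> W x ->
  asmooth setT (fun y => pderivs l (ker eps ^~ y) x).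
Proof.
move=> sk ee Wx; under eq_fun do rewrite pdx_words.
have /asmoothP h := asmooth_ddirs [seq row_mx (delta_mx 0 i) 0 | i <- l]
  (@fincoord_scalar R s) (open_lsub oW) (kernel_smooth oW sk ee).
apply/asmoothP => c sc _; apply: (h (fun t => row_mx x (c t))) => [|t]; last by rewrite /= row_mxKl.
by apply: scurve_row_mx => //; exact: scurve_cst.
Qed.

(** The same chain rule coefficients c k x expand the x-derivatives of the pushed kernel and of f =
    f' o nu. The error is therefore the sum of c k x times the LSK3 errors of the given kernel for
    f', and the order q is preserved. *)
Lemma push_LSK3 q ker : smooth_kernel W ker -> local_support W ker -> LSK3 q W ker ->
  LSK3 q W' (push_kernel mu ker).
Proof.
move=> sk ls h L [cL LW] a f sf; rewrite open_interior // in LW.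
have fK := @fincoord_scalar R s; have snu := asmooth_diffeo_inv mu oW'.
have sf1 : asmooth W' f by apply/(asmooth_smooth _ fK oW').
apply: (uniform_bigO_local cL) => [eps /andP[e0 _]|x0 Lx]; first by rewrite exprn_ge0 // ltW.
have Wx0 := LW _ Lx; have Wn := diffeo_inv_in mu Wx0.
have [I [c [w [sc hc]]]] := pderivs_pullback (mseq a) oW' oW snu (@diffeo_inv_in _ _ _ _ mu).
pose f' z := f (diffeo_fun mu z).
have sf' : asmooth W f'.
  by apply: (asmooth_comp (asmooth_diffeo mu oW) _ sf1); exact: diffeo_fun_in.
have [eta eta0 H] := scalar_change_of_variables s mu oW oW' Wx0.
have [r1 r10 [e1 e10 [C C0 hC]]] := ls _ Wn.
have [r2 r20 hr2] := open_ball_inside oW Wn.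
(* [nu x] will be within rr of nu x0 and the support within another rr of [nu x]; a quarter of the
   radii leaves room for a further margin. *)
pose rr := Num.min (Num.min r1 r2) eta / 4.
have rr0 : 0 < rr by rewrite divr_gt0 // !lt_min r10 r20.
have rr1 : 4 * rr <= r1 by rewrite mulrC divfK // !ge_min lexx.
have rr2 : 4 * rr <= r2 by rewrite mulrC divfK // !ge_min lexx orbT.
have rr3 : 4 * rr <= eta by rewrite mulrC divfK // !ge_min lexx !orbT.
have [d d0 hd] := nu_near mu oW' Wx0 rr0.
have /choice[eB heB] : forall k, exists eB : R * R, [/\ 0 < eB.1, 0 < eB.2 &
    forall eps, 0 < eps <= 1 -> eps <= eB.1 -> forall z, `|z - nu x0| <= r2 ->
     sabs (scalar_int (patch (fun=> 0) W (fun y => smul (f' y)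
       (mderiv (mindex_of (w k)) (ker eps ^~ y) z))) - mderiv (mindex_of (w k)) f' z) <= eB.2 * eps ^+ q.+1].
  move=> k; have [|e e0 [B B0 hB]] := h _ (cpt_inside_ball oW hr2) (mindex_of (w k)) f'.
    by apply/(asmooth_smooth _ fK oW).
  by exists (e, B).
have /choice[M hM] : forall k, exists M : R, 0 < M /\ forall x, `|x - x0| <= d -> `|c k x| <= M.
  move=> k; have [M M0 hM] := asmooth_bounded fincoord_real oW' (sc k) (@compact_norm_ball _ _ x0 d)
    (fun x hx => proj1 (hd x hx)); by exists M.
exists d => //.
have m0 : 0 < \big[Num.min/1]_k (eB k).1.
  by apply: lt_bigmin => // k _; have [] := heB k.
exists (Num.min (Num.min (e1 / 2) (rr / C)) (\big[Num.min/1]_k (eB k).1)).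
  by rewrite !lt_min m0 andbT; apply/andP; split; exact: divr_gt0.
exists (1 + 2 * \sum_k M k * (eB k).2).
  rewrite ltr_pwDl // mulr_ge0 // sumr_ge0 // => k _; have [M0 _] := hM k; have [_ b0 _] := heB k.
  by rewrite mulr_ge0 // ltW.
move=> eps ee; rewrite !le_min => /andP[/andP[le1 leC] leB] x /= xd.
have [Wx nx] := hd x xd; set z0 := nu x in nx *; have Wz : W z0 by exact: diffeo_inv_in.
have Ceps : C * eps <= rr by rewrite mulrC -ler_pdivlMr.
have le1' : eps < e1 by lra.
have ker0 l z : C * eps < `|z - z0| -> pderivs l (ker eps ^~ z) z0 = 0.
  move=> zC; apply: pderivs_near0; apply/near_normP.
  exists (Num.min rr (`|z - z0| - C * eps)); first by rewrite lt_min rr0 subr_gt0.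
  move=> y; rewrite lt_min => /andP[y1 y2]; apply: contrapT => /eqP hn.
  have : `|z - y| <= C * eps.
    apply: (hC y eps _ ee le1'); last exact: subset_closure.
    have := ler_normD (y - z0) (z0 - nu x0); rewrite addrA subrK; lra.
  have := ler_normD (z - y) (y - z0); rewrite addrA subrK; lra.
pose Hk k := patch (fun=> 0) W (fun y => smul (f' y) (mderiv (mindex_of (w k)) (ker eps ^~ y) z0)).
have Hk0 k z : C * eps < `|z - z0| -> Hk k z = 0.
  by move=> hz; rewrite /Hk /patch; case: ifP => // _; rewrite /mderiv ker0 // smulr0.
have sHk k : asmooth setT (Hk k).
  apply: (asmooth_glue oW (@closed_norm_ball _ _ z0 (C * eps))).
  - move=> y /= yz; apply: hr2.
    have := ler_normD (y - z0) (z0 - nu x0); rewrite addrA subrK; lra.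
  - apply: (@asmooth_ext _ _ _ _ (fun y => smul (f' y) (mderiv (mindex_of (w k)) (ker eps ^~ y) z0))).
      by move=> y Wy; rewrite /Hk patchT // inE.
    apply: asmooth_smul => //; apply: asmoothW (asmooth_kernel_r _ sk ee Wz) => //.
  - by move=> y /= /negP; rewrite -ltNge; exact: Hk0.
have cHk k : cc (Hk k).
  split=> //; exists (`|z0| + C * eps) => z hz; apply: Hk0.
  have := ler_normD (z - z0) z0; rewrite subrK; lra.
pose G z := \sum_k c k x *: Hk k z.
have cG : cc G.
  split; first by apply: asmooth_sum => k; apply: asmooth_scale => //; exact: asmooth_cst.
  exists (`|z0| + C * eps) => z hz; apply: big1 => k _; rewrite Hk0 ?scaler0 //.
  have := ler_normD (z - z0) z0; rewrite subrK; lra.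
have G0 z : eta <= `|z - nu x0| -> G z = 0.
  move=> hz; apply: big1 => k _; rewrite Hk0 ?scaler0 //.
  have := ler_normD (z - z0) (z0 - nu x0); rewrite addrA subrK; lra.
(* The factor [jdet mu y] does not depend on x, so the derivatives in x act on ker eps (nu x) (nu y)
   alone. *)
have E1 : patch (fun=> 0) W' (fun y => smul (f y) (mderiv a (push_kernel mu ker eps ^~ y) x)) =
    patch (fun=> 0) W' (fun y => jdet mu y *: G (nu y)).
  apply/funext => y; rewrite /patch; case: ifP => //; rewrite inE => Wy.
  have Wny := diffeo_inv_in mu Wy.
  have -> : push_kernel mu ker eps ^~ y = fun x => jdet mu y *: ker eps (nu x) (nu y).
    by apply/funext => x'; rewrite /push_kernel push_testE.
  have sky := asmooth_kernel_l (nu y) sk ee.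
  have skn : asmooth W' (fun x => ker eps (nu x) (nu y)).
    by apply: (asmooth_comp snu _ sky); exact: diffeo_inv_in.
  rewrite /mderiv (pderivs_scale _ _ fK oW' skn Wx) (hc K (ker eps ^~ (nu y)) fK sky x Wx).
  rewrite smul_scaler smul_sumr; congr (_ *: _); apply: eq_bigr => k _.
  rewrite smul_scaler /Hk patchT ?inE // /f' diffeo_invK //.
  by rewrite (pderivs_mderiv _ fK oW sky Wz).
have E2 : mderiv a f x = \sum_k c k x *: mderiv (mindex_of (w k)) f' z0.
  rewrite /mderiv; have -> : pderivs (mseq a) f x = pderivs (mseq a) (fun x => f' (nu x)) x.
    by apply: (pderivs_eq_on oW') => // y Wy; rewrite /f' diffeo_invK.
  rewrite (hc K f' fK sf' x Wx); apply: eq_bigr => k _.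
  congr (_ *: _); exact: (pderivs_mderiv (w k) fK oW sf' Wz).
rewrite E1 (H G cG G0) /G scalar_int_sum // E2 -sumrB.
apply: le_trans (sabs_le_norm _) _; have [ep _] := andP ee.
set S := \sum_k M k * _; apply: (@le_trans _ _ (2 * (S * eps ^+ q.+1))); last first.
  by rewrite mulrA; apply: ler_wpM2r; [apply/exprn_ge0/ltW|rewrite lerDr ler01].
apply: ler_wpM2l; first exact: ler0n.
apply: le_trans (ler_norm_sum _ _ _) _; rewrite mulr_suml.
apply: ler_sum => k _; rewrite -scalerBr normrZ -mulrA; apply: ler_pM => //.
  by have [_] := hM k; exact.
apply: le_trans (norm_le_sabs _) _; have [_ _] := heB k; apply => //.
  by apply: le_trans leB _; exact: bigmin_le_cond.
by lra.
Qed.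

End PushMoments.

(** * Pull-back of generalized functions *)

Section PullBack.
Local Open Scope ring_scope.
Local Open Scope classical_set_scope.
Context {R : realType} (s : scalars) {n : nat}.
Local Notation E := 'rV[R]_n.
Local Notation K := (scalar_of R s).
Implicit Types (W : set E) (ker : R -> E -> E -> K) (F G : (E -> K) -> E -> K).

Lemma uniform_bigO_le (A : set E) (f : R -> E -> R) (g g' : R -> R) :
  (forall eps, 0 < eps <= 1 -> g eps <= g' eps) -> uniform_bigO A f g -> uniform_bigO A f g'.
Proof.
move=> gg [e e0 [C C0 h]]; exists e => //; exists C => // eps ee el x Ax.
by apply: le_trans (h eps ee el x Ax) _; rewrite ler_pM2l // gg.
Qed.

Lemma smoothing_kernel_mono q q' W ker : (q' <= q)%N -> smoothing_kernel q W ker -> smoothing_kernel q' W ker.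
Proof.
move=> qq [sk l1 l2 l3]; split=> // L LW a f sf; apply: uniform_bigO_le (l3 L LW a f sf).
by move=> eps /andP[e0 e1]; apply: ler_wiXn2l; rewrite ?(ltW e0).
Qed.

Lemma asmooth_gf W F ker eps : basic_space s W F -> smooth_kernel W ker -> 0 < eps <= 1 ->
  asmooth W (fun z => F (ker eps z) z).
Proof.
move=> bF sk ee; apply/asmoothP => c sc cW; rewrite scurveE.
apply: (bF (fun t => ker eps (c t)) c) => //; last by rewrite -scurveE.
apply: (sk (fun=> eps) c) => //; rewrite -scurveE //; exact: scurve_cst.
Qed.

Lemma negligible_zero W : negligible_gf s W (fun _ _ => 0).
Proof.
split=> [c x _ _ _|L LW a m]; first by rewrite -scurveE; exact: scurve_cst.
exists 0%N => ker _; exists 1 => //; exists 1 => // eps /andP[e0 _] _ x _.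
apply: le_trans (sabs_le_norm _) _; rewrite /mderiv pderivs_near0; last exact: filterE.
by rewrite normr0 mulr0 mul1r exprn_ge0 // ltW.
Qed.

Lemma negligible_lin W F G (t : R) : open W -> negligible_gf s W F -> negligible_gf s W G ->
  negligible_gf s W (fun phi x => F phi x + t *: G phi x).
Proof.
move=> oW [bF nF] [bG nG]; split=> [c x sc sx xW|L LW a m].
  rewrite -scurveE; apply: scurve_add; first by rewrite scurveE; exact: bF.
  by apply: scurve_scale; [exact: scurve_cst|rewrite scurveE; exact: bG].
have [q1 h1] := nF L LW a m; have [q2 h2] := nG L LW a m.
exists (maxn q1 q2) => ker sk.
have [e1 e10 [C1 C10 k1]] := h1 _ (smoothing_kernel_mono (leq_maxl _ _) sk).
have [e2 e20 [C2 C20 k2]] := h2 _ (smoothing_kernel_mono (leq_maxr _ _) sk).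
exists (Num.min e1 e2); first by rewrite lt_min e10.
exists (2 * (C1 + `|t| * C2)) => [|eps ee]; first by rewrite mulr_gt0 // ltr_pwDl // mulr_ge0 // ltW.
rewrite le_min => /andP[l1 l2] x Lx; have [sk0 _ _ _] := sk.
have Wx : W x by have [_] := LW; rewrite open_interior //; exact.
have fK := @fincoord_scalar R s; have sF := asmooth_gf bF sk0 ee; have sG := asmooth_gf bG sk0 ee.
have stG : asmooth W (fun z => t *: G (ker eps z) z) by apply: asmooth_scale => //; exact: asmooth_cst.
rewrite /mderiv (pderivs_add _ fK oW sF stG Wx) (pderivs_scale _ _ fK oW sG Wx).
apply: le_trans (sabs_le_norm _) _; rewrite -mulrA; apply: ler_wpM2l; first exact: ler0n.
apply: le_trans (ler_normD _ _) _; rewrite normrZ mulrDl -mulrA; apply: lerD.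
  exact: le_trans (norm_le_sabs _) (k1 eps ee l1 x Lx).
by apply: ler_wpM2l => //; exact: le_trans (norm_le_sabs _) (k2 eps ee l2 x Lx).
Qed.

Lemma gf_coset_eq W F G : open W -> negligible_gf s W (fun phi x => F phi x - G phi x) ->
  gf_coset W F = gf_coset W G.
Proof.
move=> oW nFG; apply/seteqP; split=> H nH; rewrite /gf_coset /=.
  rewrite (_ : (fun phi x => _) = (fun phi x => (H phi x - F phi x) + 1 *: (F phi x - G phi x))).
    exact: negligible_lin.
  by apply/funext => phi; apply/funext => x; rewrite scale1r addrA subrK.
rewrite (_ : (fun phi x => _) = (fun phi x => (H phi x - G phi x) + (-1) *: (F phi x - G phi x))).
  exact: negligible_lin.
by apply/funext => phi; apply/funext => x; rewrite scaleN1r opprB addrA subrK.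
Qed.

Variables (W W' : set E) (mu : diffeo W W').
Hypotheses (oW : open W) (oW' : open W').
Local Notation nu := (diffeo_inv mu).

Lemma smoothing_push_kernel q ker : smoothing_kernel q W ker -> smoothing_kernel q W' (push_kernel mu ker).
Proof.
move=> [sk /(LSK1_local _ oW) l1 /(LSK2_local oW sk) l2 l3].
have sk' := smooth_push_kernel mu oW oW' sk; split=> //.
- by apply/(LSK1_local _ oW'); exact: push_local_support.
- by apply/(LSK2_local oW' sk'); exact: push_local_order.
- exact: push_LSK3.
Qed.

(** Derivatives of the pulled-back function tested with a kernel are combinations of derivatives of
    F tested with the pushed kernel. The finite family w depends on a alone, so q and N can be fixed
    before the kernel is given. *)
Lemma pull_fun_bigO (a : mindex n) : exists (J : finType) (w : J -> mindex n),
  forall F L ker (g : R -> R), basic_space s W' F -> cpt_inside L W -> smooth_kernel W ker ->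
    (forall eps, 0 < eps <= 1 -> 0 <= g eps) ->
    (forall j, uniform_bigO (diffeo_fun mu @` L)
       (fun eps x => sabs (mderiv (w j) (fun z => F (push_kernel mu ker eps z) z) x)) g) ->
    uniform_bigO L (fun eps x => sabs (mderiv a (fun z => pull_fun mu F (ker eps z) z) x)) g.
Proof.
have [J [c [w [sc hc]]]] := pderivs_pullback (mseq a) oW oW' (asmooth_diffeo mu oW) (@diffeo_fun_in _ _ _ _ mu).
exists J, (fun j => mindex_of (w j)) => F L ker g bF [cL LW] sk g0 hF.
rewrite open_interior // in LW; have fK := @fincoord_scalar R s.
have sk' := smooth_push_kernel mu oW oW' sk.
have /choice[eB heB] : forall j, exists eB : R * R, [/\ 0 < eB.1, 0 < eB.2 &
    forall eps, 0 < eps <= 1 -> eps <= eB.1 -> forall x, (diffeo_fun mu @` L) x ->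
     sabs (mderiv (mindex_of (w j)) (fun z => F (push_kernel mu ker eps z) z) x) <= eB.2 * g eps].
  by move=> j; have [e e0 [B B0 hB]] := hF j; exists (e, B).
have /choice[M hM] : forall j, exists M : R, 0 < M /\ forall x, L x -> `|c j x| <= M.
  by move=> j; have [M M0 hM] := asmooth_bounded fincoord_real oW (sc j) cL LW; exists M.
exists (\big[Num.min/1]_j (eB j).1); first by apply: lt_bigmin => // j _; have [] := heB j.
have S0 : 0 <= \sum_j M j * (eB j).2.
  by rewrite sumr_ge0 // => j _; have [M0 _] := hM j; have [_ b0 _] := heB j; rewrite mulr_ge0 // ltW.
exists (1 + 2 * \sum_j M j * (eB j).2); first by rewrite ltr_pwDl // mulr_ge0.
move=> eps ee el x Lx; have Wx := LW x Lx; have Wmx := diffeo_fun_in mu Wx.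
pose G z := F (push_kernel mu ker eps z) z.
have sG : asmooth W' G by exact: asmooth_gf.
have -> : mderiv a (fun z => pull_fun mu F (ker eps z) z) x = mderiv a (fun z => G (diffeo_fun mu z)) x.
  apply: (pderivs_eq_on oW) => // z Wz.
  by rewrite /G /push_kernel diffeo_funK.
rewrite /mderiv (hc K G fK sG x Wx); apply: le_trans (sabs_le_norm _) _.
set S := \sum_j M j * _ in S0 *; apply: (@le_trans _ _ (2 * (S * g eps))); last first.
  by rewrite mulrA; apply: ler_wpM2r; [exact: g0|rewrite lerDr ler01].
apply: ler_wpM2l; first exact: ler0n.
apply: le_trans (ler_norm_sum _ _ _) _; rewrite mulr_suml; apply: ler_sum => j _.
rewrite normrZ -mulrA; apply: ler_pM => //; first by have [_] := hM j; exact.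
rewrite (pderivs_mderiv _ fK oW' sG Wmx); apply: le_trans (norm_le_sabs _) _.
have [_ _ hj] := heB j; apply: (hj eps ee); last by exists x.
by apply: le_trans el _; exact: bigmin_le_cond.
Qed.

Lemma leq_bigsum (J : finType) (N : J -> nat) j : (N j <= \sum_i N i)%N.
Proof. by rewrite (bigD1 j) //= leq_addr. Qed.

Lemma moderate_pull F : moderate_gf s W' F -> moderate_gf s W (pull_fun mu F).
Proof.
move=> [bF mF]; split=> [|L LW a]; first exact: basic_space_pull.
have [J [w hw]] := pull_fun_bigO a.
have /choice[qN hqN] : forall j, exists qN : nat * nat, forall ker, smoothing_kernel qN.1 W' ker ->
    uniform_bigO (diffeo_fun mu @` L) (fun eps x => sabs (mderiv (w j) (fun z => F (ker eps z) z) x))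
      (fun eps => eps ^- qN.2).
  by move=> j; have [q [N h]] := mF _ (cpt_inside_image mu oW oW' LW) (w j); exists (q, N).
(* The sums serve as common upper bounds: a larger q leaves fewer kernels, and a larger N weakens
   the bound for eps <= 1. *)
exists (\sum_j (qN j).1)%N, (\sum_j (qN j).2)%N => ker sker.
have [sk _ _ _] := sker; apply: hw => // [eps /andP[e0 _]|j].
  by rewrite invr_ge0 exprn_ge0 // ltW.
apply: uniform_bigO_le (hqN j _ _).
  move=> eps /andP[e0 e1]; rewrite lef_pV2 ?posrE ?exprn_gt0 //.
  by apply: ler_wiXn2l; rewrite ?(ltW e0) // leq_bigsum.
apply: smoothing_kernel_mono (smoothing_push_kernel sker).
exact: (leq_bigsum (fun j => (qN j).1)).
Qed.

Lemma negligible_pull F : negligible_gf s W' F -> negligible_gf s W (pull_fun mu F).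
Proof.
move=> [bF nF]; split=> [|L LW a m]; first exact: basic_space_pull.
have [J [w hw]] := pull_fun_bigO a.
have /choice[q hq] : forall j, exists q : nat, forall ker, smoothing_kernel q W' ker ->
    uniform_bigO (diffeo_fun mu @` L) (fun eps x => sabs (mderiv (w j) (fun z => F (ker eps z) z) x))
      (fun eps => eps ^+ m).
  by move=> j; exact: nF _ (cpt_inside_image mu oW oW' LW) (w j) m.
exists (\sum_j q j)%N => ker sker; have [sk _ _ _] := sker.
apply: hw => // [eps /andP[e0 _]|j]; first by rewrite exprn_ge0 // ltW.
apply: hq; apply: smoothing_kernel_mono (smoothing_push_kernel sker).
exact: leq_bigsum.
Qed.

Lemma negligible_pull_sub F G : negligible_gf s W' (fun phi x => F phi x - G phi x) ->
  negligible_gf s W (fun phi x => pull_fun mu F phi x - pull_fun mu G phi x).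
Proof. exact: (@negligible_pull (fun phi x => F phi x - G phi x)). Qed.

(** An element of the quotient carries a proof of being a coset; proof irrelevance identifies two
    elements with the same underlying set. *)
Lemma gf_represents_inj F (A B : gf_quotient s W) : gf_represents F A -> gf_represents F B -> A = B.
Proof.
case: A B => [A hA] [B hB] [_ /= AE] [_ /= BE]; have AB : A = B by rewrite AE BE.
by move: hB {BE}; rewrite -AB => hB; rewrite (Prop_irrelevance hA hB).
Qed.

Lemma gf_represents_sub F G (A : gf_quotient s W') : gf_represents F A -> gf_represents G A ->
  negligible_gf s W' (fun phi x => F phi x - G phi x).
Proof.
move=> [_ AF] [_ AG]; have : gf_coset W' F F.
  rewrite /gf_coset /= (_ : (fun phi x => _) = (fun _ _ => 0)); first exact: negligible_zero.
  by apply/funext => phi; apply/funext => x; rewrite subrr.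
by rewrite -AF AG.
Qed.

End PullBack.

Local Open Scope classical_set_scope.

Theorem proposition14 (R : realType) (s : scalars) (n : nat)
    (W W' : set 'rV[R]_n) (mu : diffeo W W') :
  open W -> open W' ->
  [/\ pull_fun mu @` moderate_gf s W' `<=` moderate_gf s W,
      pull_fun mu @` negligible_gf s W' `<=` negligible_gf s W &
      exists! mu_pull : gf_quotient s W' -> gf_quotient s W,
        forall F (A : gf_quotient s W'), gf_represents F A ->
          gf_represents (pull_fun mu F) (mu_pull A)].
Proof.
move=> oW oW'; split.
- by move=> _ [F mF <-]; exact: moderate_pull.
- by move=> _ [F nF <-]; exact: negligible_pull.
(* The map on cosets uses a chosen representative; [negligible_pull_sub] makes the result
   independent of this choice. *)
have /choice[rep hrep] : forall A : gf_quotient s W', exists F, gf_represents F A.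
  by move=> [A [F mF AE]]; exists F.
pose cl A : gf_quotient s W := exist _ (gf_coset W (pull_fun mu (rep A)))
  (ex_intro2 _ _ (pull_fun mu (rep A)) (moderate_pull mu oW oW' (proj1 (hrep A))) erefl).
exists cl; split=> [F A FA|cl' hcl'].
  split; first by have [mF _] := FA; exact: moderate_pull.
  apply/esym/gf_coset_eq => //; apply: negligible_pull_sub => //.
  exact: gf_represents_sub FA (hrep A).
apply/funext => A; have clA : gf_represents (pull_fun mu (rep A)) (cl A).
  exact: (conj (moderate_pull mu oW oW' (proj1 (hrep A))) erefl).
exact: gf_represents_inj clA (hcl' _ _ (hrep A)).
Qed.
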